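(* Let $\mathcal D$ be a circular multiply connected domain satisfying Assumption A and with $\rho_a>0$. Then, as $n\to\infty$, the following asymptotic expansion holds: $$(n+1)\kappa_n^{-2}\sim 1+\frac{\rho_x^{-2n-2}}{2\pi}\sum_{k=0}^\infty C_k(0)\,\frac{\Gamma(k+1/2)\,\Gamma(n-k+3/2)}{\Gamma(n+2)} .$$
   Context: Notation: $D(c,r)=\{z\in\mathbb C:|z-c|<r\}$. A circular multiply connected domain (CMCD) is a domain $\mathcal D=D(0,1)\setminus\bigcup_{j=1}^s\overline{D(c_j,r_j)}$ with $s\ge1$, $r_j>0$, where the closed disks $\overline{D(c_j,r_j)}$ are contained in $D(0,1)$ and pairwise disjoint. Let $dA=\pi^{-1}dx\,dy$. For $n\ge0$, $P_n(z)=z^n+\cdots$ is the unique monic polynomial of degree $n$ with $\int_{\mathcal D}P_n(z)\overline{z^m}\,dA(z)=0$ for $0\le m\le n-1$, and $\kappa_n=\left(\int_{\mathcal D}|P_n|^2dA\right)^{-1/2}$. For each $j$ there is a unique pair $a_j\in D(0,1)$, $\sigma_j\in(0,1)$ such that $\Phi_j(z)=\frac{\overline{a_j}}{|a_j|}\frac{z-a_j}{1-\overline{a_j}z}$ maps $D(c_j,r_j)$ onto $D(0,\sigma_j)$ (if $a_j=0$, the factor $\overline{a_j}/|a_j|$ is read as $1$). Put $\rho_a=\max_j|a_j|$ and $T_j(z)=\Phi_j^{-1}(\sigma_j^2\Phi_j(z))$. Let $\mathcal T$ consist of the identity map and all finite compositions $T_{j_n}\cdots T_{j_1}$, $n\ge1$,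 $j_k\in\{1,\dots,s\}$. Assumption A: the series $\sum_{\tau\in\mathcal T}|\tau'(z)|$ converges locally uniformly on $D(0,\rho_a^{-1})$. ($\rho_a>0$ is equivalent to $c_j\ne0$ for some $j$.) Let $\rho_x^{-1}=\max_{j}(|c_j|+r_j)$. For $j$ with $c_j\neq0$ set $$x_j=\frac{c_j/|c_j|}{|c_j|+r_j},\qquad y_j=\frac{c_j/|c_j|}{|c_j|-r_j}\ \ (y_j=\infty\text{ if }|c_j|=r_j),\qquad \epsilon_j=\begin{cases}1,&r_j\ge|c_j|,\\-1,&r_j<|c_j|.\end{cases}$$ If $r_j\ne|c_j|$ let $$R_j(w,z)=\frac{\epsilon_j\left(y_j/x_j-1\right)}{\sqrt{(y_j/x_j)^2-1-w}}\cdot\frac{1-\frac{z}{x_j}+w\left(\frac{y_j-2x_j}{y_j-x_j}+\frac{y_j^2+x_j^2}{y_j^2-x_j^2}\frac{z}{x_j}\right)-\frac{x_jw^2}{y_j-x_j}}{(1-z/x_j)^2+w\left(1-\frac{2z}{y_j+x_j}\right)},$$ where $y_j/x_j$ is real with $(y_j/x_j)^2>1$ and the square root is positive at $w=0$; if $r_j=|c_j|$ let $$R_j(w,z)=-\frac{1-z/x_j+w(1+z/x_j)}{(1-z/x_j)^2+w}.$$ For $z\ne x_j$, $R_j(\cdot,z)$ is analytic near $0$; write $R_j(w,z)=\sum_{k\ge0}R_{j,k}(z)w^k$. Finally $C_k(z)=\sum_{j:\,|c_j|+r_j=\rho_x^{-1}}R_{j,k}(z)$, i.e. the sum over $j$ with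 $|x_j|=\rho_x$ (when $\rho_a>0$, disjointness of the disks forces $c_j\ne0$ for these $j$). The symbol $\sim$ means: for every integer $m\ge0$, the difference between the left-hand side and the right-hand side with the sum truncated at $k=m$ is $O(\rho_x^{-2n}n^{-m-3/2})$ as $n\to\infty$. *)

(* Defs.v *)
From HB Require Import structures.
From mathcomp Require Import all_boot all_order all_algebra.
From mathcomp Require Import all_classical all_reals all_analysis.
From mathcomp Require Import ring.
From mathcomp Require Export complex.

Set Implicit Arguments.
Unset Strict Implicit.
Unset Printing Implicit Defensive.

Import Order.TTheory GRing.Theory Num.Theory numFieldNormedType.Exports.
Import Normc.

Local Open Scope classical_set_scope.
Local Open Scope ring_scope.
Local Open Scope complex_scope.

(** Moduli are taken with [normc : R[i] -> R], since the norm [`|z|] of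
    mathcomp is valued in [R[i]].  Topological notions on the complex plane
    (limits, derivatives, neighbourhoods) are those of [R[i]^o]. *)

Section Domain.
Context {R : realType}.
Implicit Types (z : R[i]) (D : set R[i]).

Definition disk (z0 : R[i]) (rad : R) : set R[i] :=
  [set z | normc (z - z0) < rad].

Definition closed_disk (z0 : R[i]) (rad : R) : set R[i] :=
  [set z | normc (z - z0) <= rad].

Definition is_CMCD (s : nat) (c : 'I_s -> R[i]) (r : 'I_s -> R) : Prop :=
  [/\ (0 < s)%N,
      forall j, 0 < r j,
      forall j, closed_disk (c j) (r j) `<=` disk 0 1
    & forall j k, j != k ->
        closed_disk (c j) (r j) `&` closed_disk (c k) (r k) = set0].

Definition CMCD (s : nat) (c : 'I_s -> R[i]) (r : 'I_s -> R) : set R[i] :=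
  disk 0 1 `\` \bigcup_(j : 'I_s) closed_disk (c j) (r j).

(** Integration with respect to [dA = dx dy / pi]. *)
Definition area_integral D (f : R[i] -> R) : R :=
  pi^-1 * \int[(@lebesgue_measure R \x @lebesgue_measure R)%E]_(p in
                 [set p : R * R | D (p.1 +i* p.2)]) f (p.1 +i* p.2).

Definition area_integralC D (f : R[i] -> R[i]) : R[i] :=
  area_integral D (fun z => complex.Re (f z))
  +i* area_integral D (fun z => complex.Im (f z)).

Definition is_monic_orthogonal D (n : nat) (p : {poly R[i]}) : Prop :=
  [/\ p \is monic, size p = n.+1
    & forall m, (m < n)%N ->
        area_integralC D (fun z => p.[z] * (z ^+ m)^*) = 0].

Definition kappa D (p : {poly R[i]}) : R :=
  area_integral D (fun z => normc p.[z] ^+ 2) `^ (- 2^-1).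

End Domain.

Section Moebius.
Context {R : realType}.

Definition rot (a : R[i]) : R[i] :=
  if a == 0 then 1 else a^* / (normc a)%:C.

Definition Phi (a z : R[i]) : R[i] := rot a * ((z - a) / (1 - a^* * z)).

Definition Phi_inv (a u : R[i]) : R[i] := (u + rot a * a) / (rot a + a^* * u).

Lemma rot_neq0 (a : R[i]) : rot a != 0.
Proof.
rewrite /rot; case: (altP (a =P 0)) => [_|a0]; first by rewrite oner_eq0.
rewrite mulf_neq0 ?conjc_eq0// invr_eq0.
by rewrite -[(normc a)%:C]/(`|a|) normr_eq0.
Qed.

Lemma PhiK (a z : R[i]) : normc a < 1 -> 1 - a^* * z != 0 ->
  Phi_inv a (Phi a z) = z.
Proof.
move=> a1 d0; rewrite /Phi_inv /Phi.
have b0 := rot_neq0 a; set b := rot a in b0 *.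
have e0 : 1 - a^* * a != 0.
  rewrite subr_eq0 eq_sym mulrC -sqr_normc sqrf_eq1.
  apply/negP => /orP[] /eqP h.
    by move: a1; rewrite -(ltcR _ 1) -[(normc a)%:C]/(`|a|) h ltxx.
  by have := normr_ge0 a; rewrite h oppr_ge0 ler10.
have -> : b * ((z - a) / (1 - a^* * z)) + b * a
    = b * (1 - a^* * a) * z / (1 - a^* * z) by field.
have -> : b + a^* * (b * ((z - a) / (1 - a^* * z)))
    = b * (1 - a^* * a) / (1 - a^* * z) by field.
by field; rewrite d0 e0 b0.
Qed.

Definition Tmap (a : R[i]) (sigma : R) (z : R[i]) : R[i] :=
  Phi_inv a ((sigma ^+ 2)%:C * Phi a z).

Definition is_Moebius_data (c : R[i]) (r : R) (a : R[i]) (sigma : R) : Prop :=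
  [/\ normc a < 1, 0 < sigma < 1 & Phi a @` disk c r = disk 0 sigma].

End Moebius.

Section SemigroupT.
Context {R : realType} (s : nat) (a : 'I_s -> R[i]) (sigma : 'I_s -> R).

Definition rho_a : R := \big[Num.max/0]_(j < s) normc (a j).

Definition compositions : set (R[i] -> R[i]) :=
  [set tau | exists w : seq 'I_s,
     tau = foldr (fun j f => Tmap (a j) (sigma j) \o f) id w].

(** [compositions] has no preferred enumeration, so convergence of the series
    is along the finite subsets; since the terms are nonnegative this is the
    same as convergence along any enumeration. *)
Definition assumptionA : Prop :=
  exists S : R[i] -> R, forall z0, disk 0 rho_a^-1 z0 ->
    exists2 delta : R, 0 < delta & forall eps : R, 0 < eps ->
      exists2 F0, fsets compositions F0 &
        forall F, fsets compositions F -> F0 `<=` F ->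
          forall z, disk z0 delta z -> disk 0 rho_a^-1 z ->
            `| \sum_(tau \in F) normc (derive1 (tau : R[i]^o -> R[i]^o) z)
               - S z | < eps.

End SemigroupT.

Section Coefficients.
Context {R : realType}.

Section OneDisk.
Variables (c : R[i]) (r : R).

(** Meaningful for [c != 0]; [ypt] moreover only for [r <> |c|], the point
    being infinity otherwise. *)
Definition xpt : R[i] := c / (normc c)%:C / (normc c + r)%:C.
Definition ypt : R[i] := c / (normc c)%:C / (normc c - r)%:C.
Definition epsilon : R[i] := if normc c <= r then 1 else -1.

(** [sqrtc] is the principal branch, hence analytic near the positive real
    value [(ypt / xpt) ^+ 2 - 1]; the generic [sqrtC] is discontinuous
    there. *)
Definition Rfun (w z : R[i]) : R[i] :=
  let x := xpt in let y := ypt in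
  if r == normc c then
    - ((1 - z / x + w * (1 + z / x)) / ((1 - z / x) ^+ 2 + w))
  else
    epsilon * (y / x - 1) / sqrtc ((y / x) ^+ 2 - 1 - w)
    * ((1 - z / x
        + w * ((y - 2 * x) / (y - x)
               + (y ^+ 2 + x ^+ 2) / (y ^+ 2 - x ^+ 2) * (z / x))
        - x * w ^+ 2 / (y - x))
       / ((1 - z / x) ^+ 2 + w * (1 - 2 * z / (y + x)))).

Definition is_Rcoef (Rk : nat -> R[i] -> R[i]) : Prop :=
  forall z, z != xpt -> \forall w \near (0 : R[i]^o),
    (series (fun k => Rk k z * w ^+ k) : nat -> R[i]^o) @ \oo
      --> (Rfun w z : R[i]^o).

End OneDisk.

Variables (s : nat) (c : 'I_s -> R[i]) (r : 'I_s -> R).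

Definition rho_x : R := (\big[Num.max/0]_(j < s) (normc (c j) + r j))^-1.

Definition Ccoef (Rk : 'I_s -> nat -> R[i] -> R[i]) (k : nat) (z : R[i]) :
    R[i] :=
  \sum_(j < s | normc (c j) + r j == rho_x^-1) Rk j k z.

End Coefficients.

(** Euler's integral, the Gamma function at [x > 0]. *)
Definition Gamma {R : realType} (x : R) : R :=
  \int[@lebesgue_measure R]_(t in `]0, +oo[) (t `^ (x - 1) * expR (- t)).

(** The right-hand side of the expansion, truncated at [k = m]. The argument
    [n - k + 3/2] is positive as soon as [m <= n]. *)
Definition truncated_expansion {R : realType} (s : nat)
    (c : 'I_s -> R[i]) (r : 'I_s -> R) (Rk : 'I_s -> nat -> R[i] -> R[i])
    (m n : nat) : R[i] :=
  1 + (rho_x c r ^- (2 * n + 2) / (2 * pi))%:C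
      * \sum_(0 <= k < m.+1)
          Ccoef c r Rk k 0
          * (Gamma (k%:R + 1 / 2 : R) * Gamma (n%:R - k%:R + 3 / 2 : R)
             / Gamma (n%:R + 2 : R))%:C.

(* Main.v *)
Require Import Defs.
From HB Require Import structures.
From mathcomp Require Import all_boot all_order all_algebra.
From mathcomp Require Import all_classical all_reals all_analysis.
From mathcomp Require Import measurable_realfun.
From mathcomp Require Import ring lra.
From mathcomp Require Import complex.

(** Write [P n = z^n + q] and let [D] be the unit disk minus the holes [D_j].
    Orthogonality gives [int_D |P n|^2 = int_D |z|^(2n) - int_D |q|^2].  On a
    hole with centre [c] and radius [r] the moments of [z^k (z^n)^*], [k <= n],
    are at most [(|c| + r^2/(1-|c|))^n], a rate strictly below
    [(|c| + r)^n <= rho_x^(-n)]; pairing [q] with [z^n] therefore shows that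
    [int_D |q|^2] is exponentially smaller than the remainder allowed.

    What is left is [(n+1) int_(D_j) |z|^(2n)] for each hole.  With
    [b = (|c|-r)/(|c|+r)], it is the binomial sum [disk_sum], hence a
    trigonometric integral, and the substitution
    [sin y = sqrt(1-b^2) sin x], followed by [w = tan^2 y], turns it into
    [(|c|+r)^(2n+2)/pi] times the integral of [cos^(2n+2) y F0 b w], where
    [F0 b w = - R_j(w,0)].  Watson's lemma in the variable [w] gives the
    expansion, since the integral of [sin^(2k) cos^(2N)] over [[0, pi/2]] is
    [Gamma(k+1/2) Gamma(N+1/2) / (2 Gamma(k+N+1))]. *)

Set Implicit Arguments.
Unset Strict Implicit.
Unset Printing Implicit Defensive.

Import Order.TTheory GRing.Theory Num.Theory numFieldNormedType.Exports.
Import Normc.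
Local Open Scope classical_set_scope.
Local Open Scope ring_scope.
Local Open Scope complex_scope.

(** * Integrals over segments *)

Section Calculus.
Context {R : realType}.
Local Notation mu := (@lebesgue_measure R).
Implicit Types (f F G : R -> R) (a b : R).

(** The lower-order part [q] is controlled through itself. On the full disk it is orthogonal to
    [z^n], so [B = int_D |q|^2 = - int_D q conj(z^n)] sees only the holes and is at most the small
    moments times the sum of the moduli of the coefficients of [q]. Those coefficients are in turn
    O(sqrt(n B)), because [D] contains an annulus outside all holes, on which monomials are
    orthogonal. Hence [B <= K sqrt(B)] with [K] exponentially small, and [B <= K^2]. Holes with
    [|c| + r < 1 / rho_x] are themselves below the allowed remainder, so only the extremal ones are
    expanded. The hypothesis [0 < rho_a] enters there: it excludes an extremal hole centred at 0,
    where [x_j] would make no sense. The variable [w = tan^2 y] is chosen because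
    [cos^(2n+2) y * w^k] is again a product of even powers of sine and cosine, so every Taylor term
    integrates to an exact Gamma quotient. The coefficients [Rk] are given as complex numbers: their
    real parts are matched with [- F0], their imaginary parts with the expansion of the zero
    function. *)

Lemma is_derive_continuous f (x df : R) : is_derive x 1 f df -> {for x, continuous f}.
Proof.
by move=> [dF _]; apply/differentiable_continuous; rewrite -derivable1_diffP.
Qed.

Lemma is_derive_expn f n (x df : R) : is_derive x 1 f df ->
  is_derive x 1 (fun y => f y ^+ n) (n%:R * f x ^+ n.-1 * df).
Proof.
move=> h; have -> : (fun y => f y ^+ n) = f ^+ n.
  by elim: n => [|n IH]; apply/funext => y; rewrite ?expr0// exprS -[in RHS]/(f y * _) exprS -IH.
exact: is_deriveX.
Qed.

Lemma segment_integrable f a b : {within `[a, b], continuous f} ->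
  mu.-integrable `[a, b] (EFin \o f).
Proof. by apply: continuous_compact_integrable; exact: segment_compact. Qed.

Lemma derivable_segment_LRcontinuous F f a b :
  (forall x, a <= x <= b -> is_derive x 1 F (f x)) -> a <= b ->
  derivable_oo_LRcontinuous F a b.
Proof.
move=> dF ab; split.
- by move=> x /[!in_itv]/= /andP[ax xb]; have [] := dF x; rewrite ?(ltW ax) ?(ltW xb).
- apply: cvg_at_right_filter; apply: is_derive_continuous.
  by apply: dF; rewrite lexx.
- apply: cvg_at_left_filter; apply: is_derive_continuous.
  by apply: dF; rewrite lexx ab.
Qed.

Lemma Rintegral_derive F f a b : a <= b ->
  (forall x, a <= x <= b -> is_derive x 1 F (f x)) ->
  {within `[a, b], continuous f} ->
  \int[mu]_(x in `[a, b]) f x = F b - F a.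
Proof.
rewrite le_eqVlt => /predU1P[->|ab] dF cf.
  by rewrite set_itv1 Rintegral_set1 subrr.
rewrite /Rintegral (@continuous_FTC2 _ f F)//.
  exact: derivable_segment_LRcontinuous dF (ltW ab).
move=> x /[!in_itv]/= /andP[ax xb]; rewrite derive1E.
by have [] := dF x; rewrite ?(ltW ax) ?(ltW xb).
Qed.

(** Positivity of the derivative is required only inside the interval: in [Rintegral_halfcircle] it
    is [r * cos t], which vanishes at both ends. *)
Lemma Rintegral_substitution F f G a b : a <= b ->
  (forall x, a <= x <= b -> is_derive x 1 F (f x)) ->
  (forall x, a <= x <= b -> {for x, continuous f}) ->
  (forall x, a < x < b -> 0 < f x) ->
  (forall x, a <= x <= b -> {for F x, continuous G}) ->
  {within `[F a, F b], continuous G} ->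
  \int[mu]_(x in `[F a, F b]) G x = \int[mu]_(x in `[a, b]) (G (F x) * f x).
Proof.
rewrite le_eqVlt => /predU1P[->|ab] dF cf f0 cGF cG.
  by rewrite !set_itv1 !Rintegral_set1.
have F'f x : a < x < b -> (derive1 F) x = f x.
  move=> /andP[ax xb]; rewrite derive1E.
  by have [] := dF x; rewrite ?(ltW ax) ?(ltW xb).
have dLR := derivable_segment_LRcontinuous dF (ltW ab).
have Finc : {in `[a, b] &, {homo F : x y / x < y}}.
  move=> x y /[!in_itv]/= /andP[ax _] /andP[_ yb] xy.
  apply: (@gtr0_derive1_incr R F a b) => //.
  - move=> u /[!in_itv]/= /andP[au ub].
    by have [] := dF u; rewrite ?(ltW au) ?(ltW ub).
  - by move=> u /[!in_itv]/= uab; rewrite F'f// f0.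
  - exact: derivable_oo_LRcontinuous_within.
(* [derive1 F] is known to be [f] only inside the interval, so its limits are transferred from [f]
   along filters that live in []a, b[]. *)
have cv (A : set_system R) : Filter A -> (\forall x \near A, x \in `]a, b[) -> forall l, f x @[x
  --> A] --> l -> (derive1 F) x @[x --> A] --> l.
  move=> FA Aab l; apply: cvg_trans; apply: near_eq_cvg.
  by apply: filterS Aab => x /=; rewrite in_itv/= => /F'f ->.
have cprod x : a <= x <= b -> {for x, continuous (fun x => G (F x) * f x)}.
  move=> xab; apply: cvgM; last exact: cf.
  apply: (@continuous_comp _ _ _ F G); last exact: cGF.
  exact: is_derive_continuous (dF _ xab).
have mprod : measurable_fun `]a, b[ (fun x => G (F x) * f x).
  apply: open_continuous_measurable_fun => // x; rewrite inE/= in_itv/= => /andP[ax xb].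
  by apply: cprod; rewrite !ltW.
have a1 : \forall x \near a^'+, x \in `]a, b[ by near=> x; rewrite in_itv/=; apply/andP; split;
  near: x; [exact: nbhs_right_gt|exact: nbhs_right_lt].
have b1 : \forall x \near b^'-, x \in `]a, b[ by near=> x; rewrite in_itv/=; apply/andP; split;
  near: x; [exact: nbhs_left_gt|exact: nbhs_left_lt].
rewrite /Rintegral integration_by_substitution_increasing//.
- congr fine; apply: eq_integral_itv_bounded => //.
    apply: (eq_measurable_fun _ _ mprod) => x; rewrite inE/= in_itv/= => xab.
    by transitivity (G (F x) * derive1 F x) => //; rewrite F'f.
  move=> x; rewrite in_itv/= => xab.
  by transitivity (G (F x) * derive1 F x) => //; rewrite F'f.
- exact: ltW.
- move=> x xab; have := xab; rewrite in_itv/= => /andP[ax xb].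
  rewrite /continuous_at F'f ?ax//.
  apply: cv; first exact: near_in_itvoo.
  by apply: cf; rewrite !ltW.
- apply/cvg_ex; exists (f a); apply: cv; first by [].
  by apply: cvg_at_right_filter; apply: cf; rewrite lexx ltW.
- apply/cvg_ex; exists (f b); apply: cv; first by [].
  by apply: cvg_at_left_filter; apply: cf; rewrite lexx ltW.
Unshelve. all: by end_near. Qed.
End Calculus.

(** * The Gamma function at integers and half-integers *)

Section GammaHalf.
Context {R : realType}.
Local Notation mu := (@lebesgue_measure R).

Let xs n : R := n.+1%:R.
(** Compact segments exhausting the open half-line. The exponent [k] is there so that squaring
    carries [K 1 n] onto [K 2 n]. *)
Let K k n : set R := `[(xs n)^-1 ^+ k, (xs n) ^+ k].

Let xs_ge1 n : 1 <= xs n. Proof. by rewrite ler1n. Qed.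
Let xs_gt0 n : 0 < xs n. Proof. by rewrite ltr0n. Qed.

Let K_gt0 k n x : K k n x -> 0 < x.
Proof.
rewrite /K/= in_itv/= => /andP[+ _]; apply: lt_le_trans.
by rewrite exprn_gt0// invr_gt0.
Qed.

Let xsV_le k n : (xs n)^-1 ^+ k <= xs n ^+ k.
Proof. apply: lerXn2r; rewrite ?nnegrE ?invr_ge0 ?(ltW (xs_gt0 n))//.
by apply: (le_trans _ (xs_ge1 n)); rewrite invf_le1. Qed.

Let K_nd k : nondecreasing_seq (K k).
Proof.
move=> m n mn; rewrite subsetEset => x; rewrite /K/= !in_itv/= => /andP[h1 h2].
have h : xs m <= xs n by rewrite ler_nat.
apply/andP; split.
  by apply: le_trans h1; rewrite lerXn2r ?nnegrE ?invr_ge0 ?(ltW (xs_gt0 _))// lef_pV2 ?posrE ?xs_gt0.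
by apply: (le_trans h2); rewrite lerXn2r ?nnegrE ?(ltW (xs_gt0 _)).
Qed.

Let bigcup_K k : (0 < k)%N -> \bigcup_n K k n = `]0%R, +oo[%classic.
Proof.
move=> k0; apply/seteqP; split=> [x [n _ /K_gt0]|x].
  by rewrite /= in_itv/= andbT.
rewrite /= in_itv/= andbT => x0.
pose N := (Num.bound x + Num.bound x^-1)%N.
have h1 : x <= xs N.
  have := archi_boundP (ltW x0); move/ltW/le_trans; apply.
  by rewrite ler_nat /N leqW// leq_addr.
have h2 : (xs N)^-1 <= x.
  have : x^-1 <= xs N.
    have := archi_boundP (ltW x0); rewrite -invr_gt0 in x0.
    have := archi_boundP (ltW x0); move/ltW/le_trans => + _; apply.
    by rewrite ler_nat /N leqW// leq_addl.
  by move=> h; rewrite -[leRHS]invrK lef_pV2 ?posrE ?invr_gt0 ?xs_gt0.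
exists N => //; rewrite /K/= in_itv/=; apply/andP; split.
  apply: le_trans h2; rewrite -[leRHS]expr1; apply: ler_wiXn2l => //.
    by rewrite invr_ge0 ltW.
  by rewrite invf_le1.
by apply: (le_trans h1); rewrite -[leLHS]expr1; apply: ler_weXn2l.
Qed.

Let Rint_cvg k (f : R -> R) (l : R) : (0 < k)%N ->
  (forall x, 0 < x -> {for x, continuous f}) -> (forall x, 0 < x -> 0 <= f x) ->
  (fun n => \int[mu]_(x in K k n) f x) @ \oo --> l ->
  (\int[mu]_(x in `]0%R, +oo[) (f x)%:E = l%:E)%E.
Proof.
move=> k0 cf f0 fl.
have : (\int[mu]_(x in K k n) (f x)%:E @[n --> \oo] -->
   \int[mu]_(x in \bigcup_n K k n) (f x)%:E)%E.
  apply: ge0_nondecreasing_set_cvg_integral => //.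
  - by move=> i; exact: measurable_itv.
  - move=> i; apply/measurable_EFinP.
    apply: subspace_continuous_measurable_fun; first exact: measurable_itv.
    by apply: continuous_in_subspaceT => x /set_mem /K_gt0 /cf.
  - by move=> i x /K_gt0 /f0; rewrite lee_fin.
rewrite bigcup_K// => h.
have : (\int[mu]_(x in K k n) (f x)%:E @[n --> \oo] --> l%:E)%E.
  have -> : (fun n => \int[mu]_(x in K k n) (f x)%:E)%E =
     EFin \o (fun n => \int[mu]_(x in K k n) f x).
    apply/funext => n /=; rewrite /Rintegral fineK//.
    apply: integrable_fin_num => //; first exact: measurable_itv.
    apply: segment_integrable; apply: continuous_in_subspaceT => x.
    by rewrite inE => /K_gt0/cf.
  by apply: cvg_EFin => //; exact: nearW.
by move=> h'; exact: (cvg_unique _ h h').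
Qed.

Let gam (x t : R) : R := t `^ (x - 1) * expR (- t).

Let gam_cont x t : 0 < t -> {for t, continuous (gam x)}.
Proof.
move=> t0; apply: continuousM.
  exact: is_derive_continuous (is_derive1_powR _ t0).
by apply: (@continuous_comp _ _ _ (fun t : R => - t) expR); [exact: continuousN|exact: continuous_expR].
Qed.

Let gam_ge0 x t : 0 <= gam x t.
Proof. by rewrite mulr_ge0 ?powR_ge0 ?expR_ge0. Qed.

Let Gamma_lim k x l : (0 < k)%N ->
  (fun n => \int[mu]_(t in K k n) gam x t) @ \oo --> l -> Gamma x = l.
Proof.
by move=> k0 /(Rint_cvg k0 (@gam_cont x) (fun t _ => gam_ge0 x t)) h; rewrite /Gamma /Rintegral h.
Qed.

(** Boundary term at the upper end. With [y = (n+1)^2], the bounds [y^x <= y^p] and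
    [expR y >= y^(p+1) / (p+1)!] leave at most [(p+1)! / (n+1)]. *)
Let bnd_cvg x : 2^-1 <= x ->
 (fun n => (xs n ^+ 2) `^ x * expR (- xs n ^+ 2)) @ \oo --> (0 : R).
Proof.
move=> x1; pose p := Num.bound x.
apply: (@squeeze_cvgr _ _ _ _ (fun=> 0) (fun n => (p.+1`!)%:R * harmonic n)).
- apply: nearW => n; rewrite mulr_ge0 ?powR_ge0 ?expR_ge0//=.
  have xs2 : 1 <= xs n ^+ 2 by rewrite -[leLHS](expr1n _ 2) lerXn2r ?nnegrE ?(ltW (xs_gt0 _)).
  have e0 : 0 < expR (xs n ^+ 2) by exact: expR_gt0.
  rewrite expRN ler_pdivrMr//.
  have h1 : (xs n ^+ 2) `^ x <= (xs n ^+ 2) ^+ p.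
    rewrite -(powR_mulrn p) ?(le_trans _ xs2)//; apply: ler_powR => //.
    by apply/ltW/archi_boundP; apply: le_trans x1; rewrite invr_ge0.
  apply: (le_trans h1).
  have := @expR_ge1Dxn R (xs n ^+ 2) p (le_trans ler01 xs2).
  set E := expR _ => hE.
  have : (xs n ^+ 2) ^+ p.+1 / (p.+1)`!%:R <= E by apply: le_trans hE; rewrite lerDr.
  rewrite ler_pdivrMr ?ltr0n ?fact_gt0// => hE'.
  rewrite /harmonic/= -/(xs n) mulrAC ler_pdivlMr//.
  rewrite mulrC [leRHS]mulrC; apply: le_trans hE'.
  rewrite exprS ler_wpM2r//; first by rewrite exprn_ge0// (le_trans _ xs2).
  by rewrite expr1 -[leLHS]mulr1 ler_wpM2l// ltW.
- exact: cvg_cst.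
- by rewrite -[X in _ --> X](mulr0 (p.+1`!%:R)); apply: cvgM; [exact: cvg_cst|exact: cvg_harmonic].
Qed.

(** Boundary term at the lower end; the assumption on [x] dominates [(n+1)^(-2x)] by [1 / (n+1)]. *)
Let bnd_cvg0 x : 2^-1 <= x ->
 (fun n => ((xs n)^-1 ^+ 2) `^ x * expR (- (xs n)^-1 ^+ 2)) @ \oo --> (0 : R).
Proof.
move=> x1.
apply: (@squeeze_cvgr _ _ _ _ (fun=> 0) (@harmonic R)).
- apply: nearW => n; rewrite mulr_ge0 ?powR_ge0 ?expR_ge0//=.
  rewrite -[leRHS]mulr1; apply: ler_pM; rewrite ?powR_ge0 ?expR_ge0//; last first.
    by rewrite -expR0 ler_expR lerNl oppr0 exprn_ge0// invr_ge0 ltW.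
  have h0 : 0 < (xs n)^-1 by rewrite invr_gt0.
  apply: (@le_trans _ _ (((xs n)^-1 ^+ 2) `^ 2^-1)).
    apply: ger_powR => //; rewrite exprn_gt0//= exprn_ile1 ?(ltW h0)//.
    by rewrite invf_le1.
  by rewrite powR12_sqrt ?exprn_ge0 ?(ltW h0)// sqrtr_sqr ger0_norm// ltW.
- exact: cvg_cst.
- exact: cvg_harmonic.
Qed.

(** Integration by parts; the bracket collects the boundary terms that [bnd_cvg] and [bnd_cvg0]
    remove in the limit. *)
Let gam_succ x n : 0 < x ->
  \int[mu]_(t in K 2 n) gam (x + 1) t = x * \int[mu]_(t in K 2 n) gam x t
   - ((xs n ^+ 2) `^ x * expR (- xs n ^+ 2)
      - ((xs n)^-1 ^+ 2) `^ x * expR (- (xs n)^-1 ^+ 2)).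
Proof.
move=> x0.
have cK y : {within K 2 n, continuous (gam y)}.
  by apply: continuous_in_subspaceT => t /set_mem /K_gt0 /(@gam_cont y).
have iK y := segment_integrable (cK y).
have mK : measurable (K 2 n) by exact: measurable_itv.
pose F t := t `^ x * expR (- t).
have dF t : (xs n)^-1 ^+ 2 <= t <= xs n ^+ 2 -> is_derive t 1 F (x * gam x t - gam (x + 1) t).
  move=> /andP[t1 _]; have t0 : 0 < t by apply: lt_le_trans t1; rewrite exprn_gt0// invr_gt0.
  have d1 := is_derive1_powR x t0.
  have d2 : is_derive t 1 (fun t : R => expR (- t)) (- expR (- t)).
    have := @is_derive1_comp R expR (fun t => - t) t (expR (- t)) (-1).
    by rewrite mulrN1; apply.
  apply: is_derive_eq.
  rewrite /gam addrK /GRing.scale/=; ring.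
have cF : {within K 2 n, continuous (fun t => x * gam x t - gam (x + 1) t)}.
  apply: continuous_in_subspaceT => t; rewrite inE => /K_gt0 t0.
  apply: cvgB; last exact: gam_cont.
  by apply: cvgM; [exact: cvg_cst|exact: gam_cont].
have := Rintegral_derive (xsV_le 2 n) dF cF.
rewrite -/(K 2 n) RintegralB//; last first.
  apply: segment_integrable; apply: continuous_in_subspaceT => t /set_mem /K_gt0 t0.
  by apply: cvgM; [exact: cvg_cst|exact: gam_cont].
rewrite RintegralZl// => <-; ring.
Qed.

Let Gcvg (x l : R) := (fun n => \int[mu]_(t in K 2 n) gam x t) @ \oo --> l.

Let Gcvg_succ x l : 2^-1 <= x -> Gcvg x l -> Gcvg (x + 1) (x * l).
Proof.
move=> x1 h; rewrite /Gcvg.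
have -> : (fun n => \int[mu]_(t in K 2 n) gam (x + 1) t) =
  (fun n => x * \int[mu]_(t in K 2 n) gam x t
   - ((xs n ^+ 2) `^ x * expR (- xs n ^+ 2)
      - ((xs n)^-1 ^+ 2) `^ x * expR (- (xs n)^-1 ^+ 2))).
  by apply/funext => n; rewrite gam_succ// (lt_le_trans _ x1)// invr_gt0.
have -> : x * l = x * l - (0 - 0) by rewrite !subr0.
apply: cvgB; last by apply: cvgB; [exact: bnd_cvg|exact: bnd_cvg0].
by apply: cvgM => //; exact: cvg_cst.
Qed.

Let Gcvg1 : Gcvg 1 1.
Proof.
have E n : \int[mu]_(t in K 2 n) gam 1 t = expR (- harmonic n ^+ 2) - expR (- xs n ^+ 2).
  have dF t : (xs n)^-1 ^+ 2 <= t <= xs n ^+ 2 -> is_derive t 1 (fun t : R => - expR (- t)) (gam 1 t).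
    move=> _.
    have d2 : is_derive t 1 (fun t : R => expR (- t)) (- expR (- t)).
      have := @is_derive1_comp R expR (fun t => - t) t (expR (- t)) (-1).
      by rewrite mulrN1; apply.
    apply: is_derive_eq; rewrite /gam subrr powRr0; ring.
  rewrite (Rintegral_derive (xsV_le 2 n) dF).
    by rewrite opprK addrC.
  by apply: continuous_in_subspaceT => t /set_mem /K_gt0 /(@gam_cont 1).
rewrite /Gcvg (funext E).
have -> : (1 : R) = expR 0 - 0 by rewrite expR0 subr0.
apply: cvgB.
  apply: (@cvg_comp _ _ _ (fun n => - harmonic n ^+ 2) expR); last exact: continuous_expR.
  rewrite -oppr0; apply: cvgN.
  rewrite -[X in _ --> X](mulr0 0); under eq_cvg do rewrite expr2.
  by apply: cvgM; exact: cvg_harmonic.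
apply: (@squeeze_cvgr _ _ _ _ (fun=> 0) (fun n => (xs n ^+ 2) `^ 2^-1 * expR (- xs n ^+ 2))).
- apply: nearW => n; rewrite expR_ge0/= ler_peMl ?expR_ge0//.
  by rewrite powR12_sqrt ?exprn_ge0 ?(ltW (xs_gt0 _))// sqrtr_sqr ger0_norm// ltW.
- exact: cvg_cst.
- exact: bnd_cvg.
Qed.

(** The substitution [t = v ^+ 2] cancels the singular factor [t^(-1/2)] and leaves twice the
    Gaussian integral over the half-line. *)
Let Gcvg_half : Gcvg 2^-1 (Num.sqrt pi).
Proof.
have E n : \int[mu]_(t in K 2 n) gam 2^-1 t = 2 * \int[mu]_(t in K 1 n) gauss_fun t.
  transitivity (\int[mu]_(v in `[(xs n)^-1, xs n]) (gam 2^-1 (v ^+ 2) * (2 * v))).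
    apply: (@Rintegral_substitution R (fun v => v ^+ 2) (fun v => 2 * v)).
    - by have := xsV_le 1 n; rewrite !expr1.
    - by move=> x _; apply: is_derive_eq; rewrite /GRing.scale/=; ring.
    - by move=> x _; apply: cvgM; [exact: cvg_cst|exact: cvg_id].
    - by move=> x /andP[x1 _]; rewrite mulr_gt0//; apply: lt_trans x1; rewrite invr_gt0.
    - move=> x /andP[x1 _]; apply: gam_cont; rewrite exprn_gt0//.
      by apply: lt_le_trans x1; rewrite invr_gt0.
    - by apply: continuous_in_subspaceT => t /set_mem ht; apply: gam_cont; exact: (@K_gt0 2 n).
  rewrite /K !expr1 -RintegralZl//; last first.
  by apply: segment_integrable; apply: continuous_subspaceT; exact: continuous_gauss_fun.
  apply: eq_Rintegral => v; rewrite inE/= in_itv/= => /andP[v1 _].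
  have v0 : 0 < v by apply: lt_le_trans v1; rewrite invr_gt0.
  rewrite /gam /gauss_fun.
  have -> : 2^-1 - 1 = - 2^-1 :> R by field.
  rewrite powRN powR12_sqrt ?exprn_ge0 ?(ltW v0)// sqrtr_sqr gtr0_norm//.
  by field; rewrite gt_eqF.
rewrite /Gcvg (funext E).
have -> : Num.sqrt pi = 2 * (Num.sqrt pi / 2) :> R by field.
apply: cvgM; first exact: cvg_cst.
have : (\int[mu]_(x in K 1 n) (gauss_fun x)%:E @[n --> \oo] -->
   \int[mu]_(x in \bigcup_n K 1 n) (gauss_fun x)%:E)%E.
  apply: ge0_nondecreasing_set_cvg_integral => //.
  - by move=> i; exact: measurable_itv.
  - by move=> i; apply/measurable_EFinP; apply: measurable_funTS; exact: measurable_gauss_fun.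
  - by move=> i x _; rewrite lee_fin gauss_fun_ge0.
rewrite bigcup_K// integral_itv_obnd_cbnd; last first.
  by apply/measurable_EFinP; apply: measurable_funTS; exact: measurable_gauss_fun.
rewrite integral0y_gauss => /fine_cvg.
by apply.
Qed.

Lemma Gamma_half k : Gamma (k%:R + 1 / 2 : R) =
  Num.sqrt pi * \prod_(i < k) (i%:R + 1 / 2).
Proof.
apply: (@Gamma_lim 2) => //; elim: k => [|k IH].
  by rewrite big_ord0 mulr1 add0r div1r; exact: Gcvg_half.
rewrite big_ord_recr/= mulrA [_ * (_ + 1/2)]mulrC.
have -> : k.+1%:R + 1 / 2 = k%:R + 1 / 2 + 1 :> R by rewrite -natr1; ring.
by apply: Gcvg_succ => //; rewrite div1r lerDr.
Qed.

Lemma Gamma_natr n : Gamma (n%:R + 1 : R) = n`!%:R.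
Proof.
apply: (@Gamma_lim 2) => //; elim: n => [|n IH].
  by rewrite add0r fact0; exact: Gcvg1.
rewrite factS natrM -natr1; apply: Gcvg_succ => //.
by rewrite (@le_trans _ _ 1)// ?lerDr// invf_le1// ler1n.
Qed.

End GammaHalf.

(** * The trigonometric moments *)

Section TrigMoments.
Context {R : realType}.
Local Notation mu := (@lebesgue_measure R).

Lemma cont_sum (I : Type) (s : seq I) (f : I -> R -> R) :
  (forall i, continuous (f i)) -> continuous (fun x => \sum_(i <- s) f i x).
Proof.
move=> cf; elim: s => [|i s IH].
  by under eq_fun do rewrite big_nil; move=> x; exact: cvg_cst.
under eq_fun do rewrite big_cons.
by move=> x; apply: cvgD; [exact: cf|exact: IH].
Qed.

Lemma cont_exp (f : R -> R) n : continuous f -> continuous (fun x => f x ^+ n).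
Proof.
move=> cf; elim: n => [|n IH] x; first by under eq_fun do rewrite expr0; exact: cvg_cst.
under eq_fun do rewrite exprS.
by apply: cvgM; [exact: cf|exact: IH].
Qed.

Lemma cont_itv_integrable (f : R -> R) a b : continuous f ->
  mu.-integrable `[a, b] (EFin \o f).
Proof. by move=> cf; apply: segment_integrable; exact: continuous_subspaceT. Qed.

Lemma cont_itv_integrable_oc (f : R -> R) a b : continuous f ->
  mu.-integrable `]a, b] (EFin \o f).
Proof.
move=> cf; apply: (integrableS _ _ _ (cont_itv_integrable a b cf)) => //.
by move=> x /=; rewrite !in_itv/= => /andP[/ltW -> ->].
Qed.

Lemma Rintegral_split (f : R -> R) a b c : a <= b -> b <= c -> continuous f ->
  \int[mu]_(x in `[a, c]) f x = \int[mu]_(x in `[a, b]) f x + \int[mu]_(x in `]b, c]) f x.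
Proof.
move=> ab bc cf; rewrite -(@Rintegral_itvB _ f (BLeft a) (BRight c) b)//; first by rewrite addrC subrK.
exact: cont_itv_integrable.
Qed.

Lemma Rintegral_itv_sum (I : Type) (s : seq I) (f : I -> R -> R) a b :
  (forall i, continuous (f i)) ->
  \int[mu]_(x in `[a, b]) (\sum_(i <- s) f i x) = \sum_(i <- s) \int[mu]_(x in `[a, b]) f i x.
Proof.
move=> cf; elim: s => [|i s IH].
  under eq_Rintegral do rewrite big_nil.
  by rewrite big_nil Rintegral_cst// mul0r.
under eq_Rintegral do rewrite big_cons.
rewrite RintegralD ?IH ?big_cons//; first exact: cont_itv_integrable.
by apply: cont_itv_integrable; exact: cont_sum.
Qed.

(** Half the Beta function at [(k + 1/2, N + 1/2)]. *)
Definition sc k N : R := \int[mu]_(x in `[0, pi / 2]) (sin x ^+ (2 * k) * cos x ^+ (2 * N)).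

Let cont_sc k N : continuous (fun x : R => sin x ^+ k * cos x ^+ N).
Proof.
by move=> x; apply: cvgM; apply: cont_exp; [exact: continuous_sin|exact: continuous_cos].
Qed.

Let pi2_ge0 : 0 <= pi / 2 :> R. Proof. by rewrite divr_ge0// pi_ge0. Qed.

Lemma sc_ge0 k N : 0 <= sc k N.
Proof. by apply: Rintegral_ge0 => x _; rewrite !exprM mulr_ge0// exprn_ge0// sqr_ge0. Qed.

Lemma sc_sum k N : sc k.+1 N + sc k N.+1 = sc k N.
Proof.
rewrite /sc -RintegralD//; [|exact: cont_itv_integrable..].
apply: eq_Rintegral => x _; rewrite !mulnS 2!exprD.
have := cos2Dsin2 x; rewrite !expr2 => h.
transitivity ((cos x * cos x + sin x * sin x) * (sin x ^+ (2 * k) * cos x ^+ (2 * N))).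
  by ring.
by rewrite h mul1r.
Qed.

(** Integrate the derivative of [sin^(2k+1) cos^(2N+1)], a function that vanishes at both 0 and
    [pi / 2]. *)
Lemma sc_parts k N : (2 * N).+1%:R * sc k.+1 N = (2 * k).+1%:R * sc k N.+1.
Proof.
pose F (x : R) := sin x ^+ (2 * k).+1 * cos x ^+ (2 * N).+1.
pose f (x : R) := (2 * k).+1%:R * (sin x ^+ (2 * k) * cos x ^+ (2 * N.+1))
   - (2 * N).+1%:R * (sin x ^+ (2 * k.+1) * cos x ^+ (2 * N)).
have c1 : continuous (fun x : R => (2 * k).+1%:R * (sin x ^+ (2 * k) * cos x ^+ (2 * N.+1))).
  by move=> x; apply: cvgM; [exact: cvg_cst|exact: cont_sc].
have c2 : continuous (fun x : R => (2 * N).+1%:R * (sin x ^+ (2 * k.+1) * cos x ^+ (2 * N))).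
  by move=> x; apply: cvgM; [exact: cvg_cst|exact: cont_sc].
have dF x : 0 <= x <= pi / 2 -> is_derive x 1 F (f x).
  move=> _; rewrite /F.
  have d1 := is_derive_expn (2 * k).+1 (is_derive_sin x).
  have d2 := is_derive_expn (2 * N).+1 (is_derive_cos x).
  apply: is_derive_eq.
  rewrite /f /GRing.scale/=.
  have -> : (2 * k.+1 = (2 * k).+2)%N by rewrite mulnS.
  have -> : (2 * N.+1 = (2 * N).+2)%N by rewrite mulnS.
  rewrite !exprS; ring.
have : \int[mu]_(x in `[0, pi / 2]) f x = 0.
  rewrite (Rintegral_derive pi2_ge0 dF).
    by rewrite /F sin0 cos_pihalf !exprS !mul0r mulr0 subr0.
  by apply: continuous_subspaceT => x; apply: cvgB; [exact: c1|exact: c2].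
rewrite /f RintegralB//; [|exact: cont_itv_integrable..].
rewrite !RintegralZl//; [|exact: cont_itv_integrable..].
by move/eqP; rewrite subr_eq0 => /eqP ->.
Qed.

(** [sc_sum] and [sc_parts] are two linear equations for [sc k.+1 N] and [sc k N.+1]; solving them
    gives this recurrence and [scSr]. *)
Lemma scSl k N : sc k.+1 N = (k%:R + 1 / 2) / (k + N).+1%:R * sc k N.
Proof.
have h1 := sc_sum k N; have h2 := sc_parts k N.
have n0 : (k + N).+1%:R != 0 :> R by rewrite pnatr_eq0.
have h : 2 * (k + N).+1%:R * sc k.+1 N = (2 * k).+1%:R * sc k N.
  rewrite -h1 mulrDr -h2 -!natr1 !natrM natrD; ring.
apply: (mulfI (_ : 2 * (k + N).+1%:R != 0)); first by rewrite mulf_neq0// pnatr_eq0.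
rewrite h -(natr1 (2 * k)) natrM; field.
by rewrite -natrD nat1r pnatr_eq0.
Qed.

Lemma scSr k N : sc k N.+1 = (N%:R + 1 / 2) / (k + N).+1%:R * sc k N.
Proof.
have h1 := sc_sum k N; have h2 := sc_parts k N.
have n0 : (k + N).+1%:R != 0 :> R by rewrite pnatr_eq0.
have h : 2 * (k + N).+1%:R * sc k N.+1 = (2 * N).+1%:R * sc k N.
  rewrite -h1 mulrDr h2 -!natr1 !natrM natrD; ring.
apply: (mulfI (_ : 2 * (k + N).+1%:R != 0)); first by rewrite mulf_neq0// pnatr_eq0.
rewrite h -(natr1 (2 * N)) natrM; field.
by rewrite -natrD nat1r pnatr_eq0.
Qed.

Lemma sc00 : sc 0 0 = pi / 2.
Proof.
rewrite /sc; under eq_Rintegral do rewrite !muln0 !expr0 mulr1.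
rewrite Rintegral_cst// mul1r.
have := @lebesgue_measure_itv R `[0, pi / 2].
rewrite /= lte_fin => ->; by rewrite divr_gt0 ?pi_gt0//= oppr0 addr0.
Qed.

Lemma scE k N : sc k N = pi / 2 * (\prod_(i < k) (i%:R + 1 / 2)) *
   (\prod_(i < N) (i%:R + 1 / 2)) / (k + N)`!%:R.
Proof.
elim: k => [|k IH].
  elim: N => [|N IH]; first by rewrite sc00 !big_ord0 fact0 !mulr1 invr1 mulr1.
  rewrite scSr IH big_ord_recr/= !add0n big_ord0 factS natrM.
  have n0 : N.+1%:R != 0 :> R by rewrite pnatr_eq0.
  have f0 : N`!%:R != 0 :> R by rewrite pnatr_eq0 -lt0n fact_gt0.
  by field; rewrite ?nat1r ?n0 ?f0.
rewrite scSl IH big_ord_recr/= addSn factS natrM.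
have n0 : (k + N).+1%:R != 0 :> R by rewrite pnatr_eq0.
have f0 : (k + N)`!%:R != 0 :> R by rewrite pnatr_eq0 -lt0n fact_gt0.
by move: n0 f0; move: ((k + N).+1%:R) ((k + N)`!%:R) => a b n0 f0; field; rewrite n0 f0.
Qed.

(** A Wallis bound: the quotient is the central binomial coefficient of [2N] over [4^N]. It is
    proved for squares, where the induction step is [(x + 1/2)^2 (x + 2) <= (x + 1)^3]; the two
    sides differ by [(3x + 2) / 4]. *)
Let half_prod_le N : (\prod_(i < N) (i%:R + 1 / 2)) / N`!%:R <= (Num.sqrt (N.+1%:R))^-1 :> R.
Proof.
have p0 M : 0 <= (\prod_(i < M) (i%:R + 1 / 2)) / M`!%:R :> R.
  by rewrite divr_ge0// prodr_ge0// => i _; rewrite addr_ge0.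
rewrite -[leLHS]ger0_norm// -sqrtr_sqr -sqrtrV// ler_wsqrtr//.
elim: N => [|N IH]; first by rewrite big_ord0 fact0 divr1 expr1n invr1.
rewrite big_ord_recr/= factS natrM invfM.
set A := _ / N`!%:R in IH.
have -> : (\prod_(i < N) (i%:R + 1 / 2) * (N%:R + 1 / 2)) * (N.+1%:R^-1 / N`!%:R) =
   A * ((N%:R + 1 / 2) / N.+1%:R) :> R by rewrite /A; ring.
rewrite exprMn.
apply: (@le_trans _ _ ((N.+1%:R)^-1 * ((N%:R + 1 / 2) / N.+1%:R) ^+ 2)).
  by rewrite ler_wpM2r// sqr_ge0.
rewrite -(natr1 N.+1) -(natr1 N); have : 0 <= N%:R :> R by []; move: (N%:R) => x x0.
rewrite -subr_ge0.
have -> : (x + 1 + 1)^-1 - (x + 1)^-1 * ((x + 1 / 2) / (x + 1)) ^+ 2 =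
  ((x + 1)^+3 - (x + 1 / 2)^+2 * (x + 1 + 1)) / ((x + 1 + 1) * (x + 1) ^+ 3).
  by field; apply/andP; split; rewrite gt_eqF//; lra.
apply: divr_ge0; last by rewrite mulr_ge0 ?exprn_ge0//; lra.
nra.
Qed.

(** The decay is of order [N^(-k-1/2)]; at [k = m + 1] this is the exponent [- m - 3/2] of the
    remainder. *)
Lemma sc_le k N : sc k N <= pi / 2 * (\prod_(i < k) (i%:R + 1 / 2)) / N.+1%:R ^+ k / Num.sqrt N.+1%:R.
Proof.
rewrite scE.
have f0 n : 0 < n`!%:R :> R by rewrite ltr0n fact_gt0.
set A := \prod_(i < k) _; set B := \prod_(i < N) _.
have A0 : 0 <= A by rewrite prodr_ge0// => i _; rewrite addr_ge0.
have B0 : 0 <= B by rewrite prodr_ge0// => i _; rewrite addr_ge0.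
have -> : pi / 2 * A * B / (k + N)`!%:R = (pi / 2 * A) * (N`!%:R / (k + N)`!%:R) * (B / N`!%:R).
  by field; rewrite !gt_eqF.
apply: ler_pM; rewrite ?mulr_ge0 ?invr_ge0 ?pi_ge0 ?half_prod_le// ?ler0n//.
apply: ler_wpM2l; first by rewrite !mulr_ge0// pi_ge0.
rewrite ler_pdivrMr// mulrC ler_pdivlMr ?exprn_gt0//.
elim: k {A A0} => [|k IH]; first by rewrite expr0 mulr1.
rewrite exprS mulrCA addSn factS natrM; apply: ler_pM => //.

by rewrite ler_nat ltnS leq_addl.
Qed.

End TrigMoments.

(** * Watson's lemma for powers of the cosine *)

Section Laplace.
Context {R : realType}.
Local Notation mu := (@lebesgue_measure R).
Implicit Types (b c r : R).

Let cont_sc k N : continuous (fun x : R => sin x ^+ k * cos x ^+ N).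
Proof.
by move=> x; apply: cvgM; apply: cont_exp; [exact: continuous_sin|exact: continuous_cos].
Qed.

Let sc_tail (t : R) k N : 0 <= t <= pi / 2 ->
  `|\int[mu]_(x in `]t, pi / 2]) (sin x ^+ (2 * k) * cos x ^+ (2 * N))|
    <= pi / 2 * cos t ^+ (2 * N).
Proof.
move=> /andP[t0 tpi].
have ci : mu.-integrable `]t, pi / 2] (EFin \o (fun x : R => sin x ^+ (2 * k) * cos x ^+ (2 * N))).
  exact: cont_itv_integrable_oc.
have cc : mu.-integrable `]t, pi / 2] (EFin \o (fun x : R => cos t ^+ (2 * N))).
  by apply: cont_itv_integrable_oc => x; exact: cvg_cst.
apply: (le_trans (le_normr_Rintegral _ ci)) => //.
apply: (@le_trans _ _ (\int[mu]_(x in `]t, pi / 2]) (cos t ^+ (2 * N)))).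
  apply: le_Rintegral => //.
    exact: integrable_norm.
  move=> x /=; rewrite in_itv/= => /andP[tx xpi].
  have c0 : 0 <= cos x.
    apply: cos_ge0_pihalf; rewrite xpi andbT (le_trans _ (ltW (le_lt_trans t0 tx)))//.
    by rewrite oppr_le0 divr_ge0// pi_ge0.
  have ct : cos x <= cos t.
    rewrite ltW// ltr_cos// in_itv/=.
      by rewrite t0/=; have := @pi_ge0 R; lra.
    by rewrite (le_trans t0 (ltW tx))/=; have := @pi_ge0 R; lra.
  rewrite !exprM normrM !normrX -[leRHS]mul1r; apply: ler_pM; rewrite ?exprn_ge0//.
    by rewrite !exprn_ile1 ?sqr_ge0// sin_max.
  by rewrite ger0_norm// lerXn2r ?nnegrE ?sqr_ge0// lerXn2r ?nnegrE// (le_trans c0).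
rewrite Rintegral_cst// mulrC ler_wpM2r//.
  by rewrite exprM exprn_ge0// sqr_ge0.
have := @lebesgue_measure_itv R `]t, pi / 2].
rewrite /= lte_fin => ->; case: ifP => _ /=; last by rewrite divr_ge0 ?pi_ge0.
by rewrite gerDl oppr_le0.
Qed.

Definition wsub (x : R) : R := (sin x / cos x) ^+ 2.

(** Since [wsub] is the squared tangent, [cos^(2n+2) * wsub^k = sin^(2k) cos^(2(n+1-k))]. The Taylor
    polynomial therefore integrates to the numbers [sc] up to the part beyond [t], and the Taylor
    error to [sc m.+1 (n - m)]. The bound [m <= n] makes the subtractions of exponents genuine. *)
Lemma laplace_error (F : R -> R) (a : nat -> R) m (K t : R) : 0 <= t < pi / 2 -> 0 <= K ->
  {within `[0, t], continuous (fun x => F (wsub x))} ->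
  (forall x, 0 <= x <= t ->
     `|F (wsub x) - \sum_(k < m.+1) a k * wsub x ^+ k| <= K * wsub x ^+ m.+1) ->
  forall n, (m <= n)%N ->
  `|\int[mu]_(x in `[0, t]) (cos x ^+ (2 * n.+1) * F (wsub x))
     - \sum_(k < m.+1) a k * sc k (n.+1 - k)|
   <= K * sc m.+1 (n - m) + \sum_(k < m.+1) `|a k| * (pi / 2 * cos t ^+ (2 * (n.+1 - k))).
Proof.
move=> /andP[t0 tpi] K0 cF hF n mn.
pose p (k : 'I_m.+1) (x : R) := a k * (sin x ^+ (2 * k) * cos x ^+ (2 * (n.+1 - k))).
have cp k : continuous (p k) by move=> x; apply: cvgM; [exact: cvg_cst|exact: cont_sc].
pose P x := \sum_k p k x.
have cP : continuous P by exact: cont_sum.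
pose f x := cos x ^+ (2 * n.+1) * F (wsub x).
have cf : {within `[0, t], continuous f}.
  have c1 : {within `[0, t], continuous (fun x : R => cos x ^+ (2 * n.+1))}.
    by apply: continuous_subspaceT; apply: cont_exp; exact: continuous_cos.
  by move=> x; apply: cvgM; [exact: c1|exact: cF].
have ifi := segment_integrable cf.
have iP := cont_itv_integrable 0 t cP.
have ip k u v := cont_itv_integrable u v (cp k).
have split (k : 'I_m.+1) : a k * sc k (n.+1 - k) = \int[mu]_(x in `[0, t]) p k x + a k *
     \int[mu]_(x in `]t, pi / 2]) (sin x ^+ (2 * k) * cos x ^+ (2 * (n.+1 - k))).
  rewrite /sc (@Rintegral_split _ _ 0 t) ?(ltW tpi)// mulrDr; congr (_ + _).
  by rewrite /p RintegralZl//; exact: cont_itv_integrable.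
under eq_bigr do rewrite split.
rewrite big_split/= -Rintegral_itv_sum// -/P opprD addrA -RintegralB//.
apply: (le_trans (ler_normB _ _)); apply: lerD; last first.
  apply: (le_trans (ler_norm_sum _ _ _)); apply: ler_sum => k _.
  by rewrite normrM ler_wpM2l// sc_tail// t0 ltW.
have iD : mu.-integrable `[0, t] (EFin \o (fun x => f x - P x)).
  have cP' : {within `[0, t], continuous P} by exact: continuous_subspaceT.
  by apply: segment_integrable => x; apply: cvgB; [exact: cf|exact: cP'].
apply: (le_trans (le_normr_Rintegral _ iD)) => //.
pose q (x : R) := K * (sin x ^+ (2 * m.+1) * cos x ^+ (2 * (n - m))).
have cq : continuous q by move=> x; apply: cvgM; [exact: cvg_cst|exact: cont_sc].
apply: (@le_trans _ _ (\int[mu]_(x in `[0, t]) q x)).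
  apply: le_Rintegral => //.
  - exact: integrable_norm.
  - exact: cont_itv_integrable.
  move=> x /=; rewrite in_itv/= => /andP[x0 xt].
  have c0 : 0 < cos x.
    apply: cos_gt0_pihalf; rewrite (le_lt_trans xt tpi) andbT.
    by rewrite (lt_le_trans _ x0)// oppr_lt0 divr_gt0// pi_gt0.
  have cw k : (k <= n.+1)%N -> cos x ^+ (2 * n.+1) * wsub x ^+ k = sin x ^+ (2 * k) * cos x ^+ (2 *
    (n.+1 - k)).
    move=> kn; rewrite /wsub -exprM expr_div_n -[in LHS](subnK kn) mulnDr exprD.
    by field; rewrite expf_neq0// gt_eqF.
  have -> : f x - P x = cos x ^+ (2 * n.+1) * (F (wsub x) - \sum_(k < m.+1) a k * wsub x ^+ k).
    rewrite mulrBr /f /P mulr_sumr; congr (_ - _); apply: eq_bigr => k _.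
    by rewrite /p -cw; [ring|rewrite ltnW// ltnS (leq_trans _ mn)// -ltnS].
  rewrite normrM ger0_norm; last by rewrite exprn_ge0// ltW.
  rewrite /q -[(n - m)%N]subSS -cw ?ltnS// mulrCA ler_wpM2l ?exprn_ge0 ?(ltW c0)//.
  by apply: hF; rewrite x0.
rewrite RintegralZl//; last exact: cont_itv_integrable.
rewrite ler_wpM2l// /sc (@Rintegral_split _ _ 0 t (pi / 2)) ?(ltW tpi)// lerDl.
by apply: Rintegral_ge0 => x _; rewrite !exprM mulr_ge0// exprn_ge0// sqr_ge0.
Qed.

(* [- F0 b w] is [Rfun c r w 0] for [b = (|c| - r) / (|c| + r)]. *)
Definition F0 b w : R := (1 - b - w * b) / Num.sqrt (1 - b ^+ 2 - w * b ^+ 2).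

Lemma sin_asin (u : R) : 0 <= u < 1 -> sin (asin u) = u.
Proof.
by move=> /andP[u0 u1]; rewrite asinK// in_itv/= (ltW u1) (le_trans _ u0)// lerN10.
Qed.

Lemma asin_le (u v : R) : 0 <= u -> u <= v -> v < 1 -> asin u <= asin v.
Proof.
move=> u0 uv v1; rewrite leNgt; apply/negP => h.
have u1 := le_lt_trans uv v1; have v0 := le_trans u0 uv.
have ni (w : R) : 0 <= w -> w < 1 -> asin w \in `[- (pi / 2), pi / 2].
  move=> w0 w1; rewrite in_itv/=.
  by rewrite asin_geNpi2 ?asin_lepi2// (ltW w1) (le_trans _ w0)// lerN10.
have := ltr_sin (ni _ v0 v1) (ni _ u0 u1).
by rewrite h !sin_asin ?u0 ?v0// ltNge uv.
Qed.

Lemma asin0 : asin 0 = 0 :> R.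
Proof. by rewrite -{1}sin0 sinK// in_itv/= oppr_le0 andbb divr_ge0// pi_ge0. Qed.

Lemma asin_bound (u : R) : 0 <= u < 1 -> 0 <= asin u < pi / 2.
Proof.
move=> /andP[u0 u1].
rewrite asin_ltpi2 ?u1 ?andbT; last by rewrite (le_trans _ u0)// lerN10.
by rewrite -asin0 asin_le.
Qed.

Lemma sin_le_asin (x u : R) : 0 <= u < 1 -> 0 <= x <= asin u -> 0 <= sin x <= u.
Proof.
move=> u01 /andP[x0 xu]; have /andP[a0 api] := asin_bound u01.
have p0 := @pi_gt0 R.
rewrite -[X in _ && (_ <= X)](sin_asin u01); apply/andP; split.
  by apply: sin_ge0_pi; rewrite x0; lra.
rewrite le_eqVlt; have [->|/= ne] := eqVneq x (asin u); first by rewrite eqxx.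
rewrite ltr_sin ?in_itv/= ?lt_neqAle ?ne ?xu ?orbT//; apply/andP; split; lra.
Qed.

Lemma cos_gt0_asin (x u : R) : 0 <= u < 1 -> 0 <= x <= asin u -> 0 < cos x.
Proof.
move=> u01 /andP[x0 xu]; have /andP[a0 api] := asin_bound u01.
by apply: cos_gt0_pihalf; have p0 := @pi_gt0 R; apply/andP; split; lra.
Qed.

(** * The substitution [sin y = sqrt(1 - b^2) sin x] *)

Section change.
Variables (b s : R).
Hypotheses (b1 : -1 < b < 1) (s1 : 0 < s < 1).
Let k := Num.sqrt (1 - b ^+ 2).

Let b2 : 0 < 1 - b ^+ 2.
Proof.
have -> : 1 - b ^+ 2 = (1 - b) * (1 + b) by ring.
by case/andP: b1 => ? ?; rewrite mulr_gt0//; lra.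
Qed.
Let k0 : 0 < k. Proof. by rewrite sqrtr_gt0. Qed.
Let k2 : k ^+ 2 = 1 - b ^+ 2. Proof. by rewrite sqr_sqrtr// ltW. Qed.
Let k1 : k <= 1. Proof. by rewrite -(sqrtr1 R) ler_wsqrtr// gerDl oppr_le0 sqr_ge0. Qed.

Lemma ks_bound : 0 <= k * s < 1.
Proof.
case/andP: s1 => s0 s1'.
rewrite mulr_ge0 ?(ltW k0) ?(ltW s0)//=; apply: (le_lt_trans _ s1'); rewrite ler_piMl//; exact: ltW.
Qed.

(** Under the root stands [(1 - b^2 - sin^2 x) / cos^2 x], which is positive as long as [sin x < k];
    taking [s < 1] secures this. *)
Lemma F0_cont x : 0 <= x <= asin (k * s) -> {for x, continuous (fun x => F0 b (wsub x))}.
Proof.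
move=> xb.
have /andP[s0 sk] := sin_le_asin ks_bound xb.
have c0 := cos_gt0_asin ks_bound xb.
have cw : {for x, continuous wsub}.
  have -> : wsub = fun x => (sin x / cos x) * (sin x / cos x).
    by apply/funext => y; rewrite /wsub expr2.
  have cd : {for x, continuous (fun x : R => sin x / cos x)}.
    apply: cvgM; first exact: continuous_sin.
    by apply: cvgV; [rewrite gt_eqF|exact: continuous_cos].
  by apply: cvgM; exact: cd.
have d0 : 0 < 1 - b ^+ 2 - wsub x * b ^+ 2.
  have h : sin x ^+ 2 < k ^+ 2.
    rewrite ltrXn2r//.
    apply: (le_lt_trans sk); case/andP: s1 => ? s1'.
    by rewrite -[ltRHS]mulr1 ltr_pM2l.
  rewrite k2 in h.
  have -> : 1 - b ^+ 2 - wsub x * b ^+ 2 = (1 - b ^+ 2 - sin x ^+ 2) / cos x ^+ 2.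
    have -> : 1 - b ^+ 2 - sin x ^+ 2 = cos x ^+ 2 * (1 - b ^+ 2) - sin x ^+ 2 * b ^+ 2.
      by rewrite cos2sin2; ring.
    by rewrite /wsub; field; rewrite gt_eqF.
  by rewrite divr_gt0 ?exprn_gt0// subr_gt0.
apply: cvgM.
  apply: cvgB; first exact: cvg_cst.
  by apply: cvgM; [exact: cw|exact: cvg_cst].
apply: cvgV; first by rewrite gt_eqF// sqrtr_gt0.
apply: (@continuous_comp _ _ _ (fun x => 1 - b ^+ 2 - wsub x * b ^+ 2) Num.sqrt); last exact: sqrt_continuous.
apply: cvgB; first exact: cvg_cst.
by apply: cvgM; [exact: cw|exact: cvg_cst].
Qed.

(** Put [q = cos^2 y = 1 - k^2 sin^2 x], so [wsub y = (1 - q) / q]. The numerator of [F0] becomes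
    [(q - b) / q], and its root is exactly the Jacobian [k cos x / sqrt q], so the two cancel and
    [q^n (q - b)] is left. *)
Lemma Rintegral_sin_substitution n :
  \int[mu]_(x in `[0, asin s]) ((1 - k ^+ 2 * sin x ^+ 2) ^+ n * (1 - k ^+ 2 * sin x ^+ 2 - b))
  = \int[mu]_(x in `[0, asin (k * s)]) (cos x ^+ (2 * n.+1) * F0 b (wsub x)).
Proof.
pose A x : R := asin (k * sin x).
pose f x := k * cos x / Num.sqrt (1 - (k * sin x) ^+ 2).
pose G x := cos x ^+ (2 * n.+1) * F0 b (wsub x).
have s01 : 0 <= s < 1 by case/andP: s1 => h1 h2; rewrite ltW.
have /andP[as0 aspi] := asin_bound s01.
have A0 : A 0 = 0 by rewrite /A sin0 mulr0 asin0.
have As : A (asin s) = asin (k * s) by rewrite /A sin_asin.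
have ksb x : 0 <= x <= asin s -> 0 <= k * sin x < 1.
  move=> /(sin_le_asin s01)/andP[h1 h2]; rewrite mulr_ge0 ?(ltW k0)//=.
  by case/andP: ks_bound => _; apply: le_lt_trans; rewrite ler_wpM2l// ltW.
have ks1 x : 0 <= x <= asin s -> 0 < 1 - (k * sin x) ^+ 2.
  by move=> /ksb/andP[h1 h2]; rewrite subr_gt0 exprn_ilt1.
have Ab x : 0 <= x <= asin s -> 0 <= A x <= asin (k * s).
  move=> xs; have /andP[h1 h2] := ksb _ xs.
  have /andP[-> _]/= := asin_bound (ksb _ xs).
  apply: asin_le => //; last by case/andP: ks_bound.
  by have /andP[_ ?] := sin_le_asin s01 xs; rewrite ler_wpM2l// ltW.
have ksc : continuous (fun x => k * sin x).
  by move=> x; apply: cvgM; [exact: cvg_cst|exact: continuous_sin].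
have GcA x : 0 <= x <= asin (k * s) -> {for x, continuous G}.
  move=> xs; apply: cvgM; last exact: F0_cont.
  by apply: cont_exp; exact: continuous_cos.
rewrite -[in RHS]As -[in RHS]A0.
transitivity (\int[mu]_(x in `[0, asin s]) (G (A x) * f x)); last first.
  apply/esym; apply: Rintegral_substitution => //.
  - move=> x xs.
    have /andP[h1 h2] := ksb _ xs.
    have d1 : is_derive x 1 (fun x => k * sin x) (k * cos x).
      apply: is_derive_eq; rewrite /GRing.scale/=; ring.
    have d2 : is_derive (k * sin x) 1 asin (Num.sqrt (1 - (k * sin x) ^+ 2))^-1.
      by apply: is_derive1_asin; rewrite h2 andbT (lt_le_trans _ h1).
    have := @is_derive1_comp _ asin (fun x => k * sin x) x _ _ d2 d1.
    by rewrite mulrC.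
  - move=> x xs; apply: cvgM.
      by apply: cvgM; [exact: cvg_cst|exact: continuous_cos].
    apply: cvgV; first by rewrite gt_eqF// sqrtr_gt0 ks1.
    apply: (@continuous_comp _ _ _ (fun x => 1 - (k * sin x) ^+ 2) Num.sqrt); last exact: sqrt_continuous.
    apply: cvgB; first exact: cvg_cst.
    exact: (@cont_exp _ _ 2 ksc).
  - move=> x /andP[/ltW h1 /ltW h2]; have xs : 0 <= x <= asin s by rewrite h1.
    by rewrite divr_gt0 ?sqrtr_gt0 ?ks1// mulr_gt0// (cos_gt0_asin s01 xs).
  - by move=> x xs; apply: GcA; exact: Ab.
  - rewrite A0 As; apply: continuous_in_subspaceT => x; rewrite inE/= in_itv/=.
    exact: GcA.
apply: eq_Rintegral => x; rewrite inE/= in_itv/= => xs.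
have q0 := ks1 _ xs; have /andP[h1 h2] := ksb _ xs.
have c0 := cos_gt0_asin s01 xs.
have sA : sin (A x) = k * sin x by rewrite /A sin_asin ?ksb.
have cA : cos (A x) = Num.sqrt (1 - (k * sin x) ^+ 2).
  by rewrite /A cos_asin// (ltW h2) (le_trans _ h1)// lerN10.
set q := 1 - (k * sin x) ^+ 2 in q0 cA *.
have Q0 : 0 < Num.sqrt q by rewrite sqrtr_gt0.
have Q2 : Num.sqrt q ^+ 2 = q by rewrite sqr_sqrtr// ltW.
have e : (k * sin x) ^+ 2 = 1 - q by rewrite /q; ring.
have wA : wsub (A x) = (1 - q) / q.
  by rewrite /wsub sA cA expr_div_n Q2 e.
have -> : G (A x) = q ^+ n.+1 * F0 b ((1 - q) / q).
  by rewrite /G wA cA exprM Q2.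
have -> : f x = k * cos x / Num.sqrt q by [].
rewrite /F0.
have -> : 1 - b ^+ 2 - (1 - q) / q * b ^+ 2 = (k * cos x / Num.sqrt q) ^+ 2.
  rewrite expr_div_n Q2 exprMn cos2sin2 mulrBr mulr1 -exprMn e k2.
  by field; rewrite gt_eqF.
rewrite sqrtr_sqr ger0_norm; last by rewrite divr_ge0 ?mulr_ge0 ?(ltW k0) ?(ltW c0) ?(ltW Q0).
rewrite -exprMn -/q exprS; field.
by rewrite !gt_eqF.
Qed.
End change.
End Laplace.

(** * The moment of a disk as a trigonometric integral *)

Section DiskSum.
Context {R : realType}.
Local Notation mu := (@lebesgue_measure R).

(* [n.+1] times the integral of [|z|^(2n)] over a disk of radius [r] whose
   centre has modulus [c]: expand [z^n] around the centre. *)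
Definition disk_sum (c r : R) n : R :=
  \sum_(l < n.+1) 'C(n, l)%:R * 'C(n.+1, l.+1)%:R * (c ^+ (2 * (n - l)) * r ^+ (2 * l.+1)).

Let sin_natpi p : sin (p%:R * pi : R) = 0.
Proof.
elim: p => [|p IH]; first by rewrite mul0r sin0.
by rewrite -natr1 mulrDl mul1r sinD IH sinpi mulr0 mul0r addr0.
Qed.

Let cos_cont (d : R) : continuous (fun x : R => cos (d * (2 * x))).
Proof.
move=> x; apply: (@continuous_comp _ _ _ (fun x : R => d * (2 * x)) cos); last exact: continuous_cos.
by apply: cvgM; [exact: cvg_cst|apply: cvgM; [exact: cvg_cst|exact: cvg_id]].
Qed.

(** Only real parts will be integrated, so half a turn of [E x] is enough: the antiderivative is a
    sine that vanishes at integer multiples of [pi]. *)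
Let orth (p q : nat) : \int[mu]_(x in `[0, pi / 2]) cos ((p%:R - q%:R) * (2 * x)) =
  (p == q)%:R * (pi / 2).
Proof.
have pi2 : 0 <= pi / 2 :> R by rewrite divr_ge0// pi_ge0.
have [->|pq] := eqVneq p q.
  under eq_Rintegral do rewrite subrr mul0r cos0.
  rewrite Rintegral_cst// !mul1r; have := @lebesgue_measure_itv R `[0, pi / 2].
  by rewrite /= lte_fin => ->; rewrite divr_gt0 ?pi_gt0//= oppr0 addr0.
rewrite mul0r; set d := p%:R - q%:R.
have d0 : d != 0 :> R by rewrite subr_eq0 eqr_nat.
have dF x : 0 <= x <= pi / 2 ->
    is_derive x 1 (fun x => sin (d * (2 * x)) * (d * 2)^-1) (cos (d * (2 * x))).
  move=> _.
  have d1 : is_derive x 1 (fun x => d * (2 * x)) (d * 2).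
    by apply: is_derive_eq; rewrite /GRing.scale/=; ring.
  have d2 := @is_derive1_comp R sin (fun x => d * (2 * x)) x _ _ (is_derive_sin _) d1.
  apply: is_derive_eq; rewrite /GRing.scale/= mulr0 add0r; field.
  by rewrite d0.
rewrite (Rintegral_derive pi2 dF); last by apply: continuous_subspaceT; exact: cos_cont.
have -> : d * (2 * (pi / 2)) = p%:R * pi - q%:R * pi by rewrite /d; field.
have -> : d * (2 * 0) = 0 by rewrite !mulr0.
have s1 : sin (p%:R * pi - q%:R * pi) = 0 :> R by rewrite sinB !sin_natpi mul0r mulr0 subr0.
by rewrite s1 sin0 mul0r subrr.
Qed.

Let E (x : R) : R[i] := cos (2 * x) +i* sin (2 * x).

Let expE x p : E x ^+ p = cos (p%:R * (2 * x)) +i* sin (p%:R * (2 * x)).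
Proof.
elim: p => [|p IH]; first by rewrite expr0 mul0r cos0 sin0.
have e : p.+1%:R * (2 * x) = p%:R * (2 * x) + 2 * x by rewrite -(natr1 p); ring.
rewrite exprSr IH e cosD sinD /E.
by apply/eqP; rewrite eq_complex/= !eqxx/= addrC eqxx.
Qed.

Let Re_E x p q : complex.Re (E x ^+ p * (E x)^* ^+ q) = cos ((p%:R - q%:R) * (2 * x)).
Proof.
have -> : (E x)^* ^+ q = (E x ^+ q)^* by rewrite rmorphXn.
have -> : (p%:R - q%:R) * (2 * x) = p%:R * (2 * x) - q%:R * (2 * x) by ring.
by rewrite !expE cosB /= mulrN opprK.
Qed.

Let EE x : E x * (E x)^* = 1.
Proof.
apply/eqP; rewrite eq_complex/=; have := cos2Dsin2 (2 * x); rewrite !expr2 => h.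
by apply/andP; split; apply/eqP; [rewrite mulrN opprK|rewrite mulrN mulrC addNr].
Qed.

Let Re_realM (u : R) (z : R[i]) : complex.Re (u%:C * z) = u * complex.Re z.
Proof. by case: z => z1 z2 /=; rewrite mul0r subr0. Qed.

Let CM (x y : R) : (x * y)%:C = x%:C * y%:C. Proof. exact: (rmorphM (real_complex R)). Qed.
Let CX (x : R) n : (x ^+ n)%:C = x%:C ^+ n. Proof. exact: (rmorphXn (real_complex R)). Qed.
Let Cn n : (n%:R : R)%:C = n%:R. Proof. exact: (rmorph_nat (real_complex R)). Qed.

Let integrand (c r x : R) n :
  complex.Re ((c%:C + r%:C * E x) ^+ n * (c%:C + r%:C * (E x)^*) ^+ n.+1 * (r%:C * E x)) =
  (c ^+ 2 + r ^+ 2 + 2 * c * r * cos (2 * x)) ^+ n * (r ^+ 2 + c * r * cos (2 * x)).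
Proof.
set u := c%:C + _; set v := c%:C + _.
have -> : u ^+ n * v ^+ n.+1 * (r%:C * E x) = (u * v) ^+ n * (v * (r%:C * E x)).
  by rewrite exprMn exprSr; ring.
have -> : u * v = (c ^+ 2 + r ^+ 2 + 2 * c * r * cos (2 * x))%:C.
  have -> : u * v = c%:C ^+ 2 + r%:C ^+ 2 * (E x * (E x)^*) + c%:C * r%:C * (E x + (E x)^*).
    rewrite /u /v; ring.
  rewrite EE; apply/eqP; rewrite eq_complex /E /=; apply/andP; split; apply/eqP; ring.
have -> : v * (r%:C * E x) = c%:C * r%:C * E x + r%:C ^+ 2 * (E x * (E x)^*).
  rewrite /v; ring.
by rewrite EE -CX Re_realM /=; congr (_ * _); ring.
Qed.

Let expand (c r x : R) n :
  complex.Re ((c%:C + r%:C * E x) ^+ n * (c%:C + r%:C * (E x)^*) ^+ n.+1 * (r%:C * E x)) =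
  \sum_(i < n.+1) \sum_(j < n.+2)
     ('C(n, i)%:R * 'C(n.+1, j)%:R * (c ^+ (n - i + (n.+1 - j)) * r ^+ (i + j).+1)) *
     cos ((i.+1%:R - j%:R) * (2 * x)).
Proof.
rewrite !exprDn -mulrA mulr_suml raddf_sum; apply: eq_bigr => i _.
rewrite mulr_suml mulr_sumr raddf_sum; apply: eq_bigr => j _ /=.
rewrite -Re_E -Re_realM; congr complex.Re.
rewrite -(mulr_natr _ 'C(n, i)) -(mulr_natr _ 'C(n.+1, j)) !CM !CX !Cn !exprMn !exprS !exprD; ring.
Qed.

(** This extracts a constant Fourier coefficient. Because of the extra factor [r E], the power [i]
    in [(c + r E)^n] meets [j = i + 1] in [(c + r conj E)^(n+1)], and each such pair integrates to
    [pi / 2]. As [E] has modulus 1, the product also has the closed real form under the integral. *)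
Lemma disk_sum_integral (c r : R) n :
  disk_sum c r n = 2 / pi * \int[mu]_(x in `[0, pi / 2])
    ((c ^+ 2 + r ^+ 2 + 2 * c * r * cos (2 * x)) ^+ n * (r ^+ 2 + c * r * cos (2 * x))).
Proof.
under eq_Rintegral do rewrite -integrand expand.
rewrite Rintegral_itv_sum; last first.
  move=> i; apply: cont_sum => j x; apply: cvgM; [exact: cvg_cst|exact: cos_cont].
have pi0 : pi != 0 :> R by rewrite gt_eqF// pi_gt0.
rewrite mulr_sumr; apply: eq_bigr => i _.
rewrite Rintegral_itv_sum; last first.
  by move=> j x; apply: cvgM; [exact: cvg_cst|exact: cos_cont].
have ii : (i.+1 < n.+2)%N by rewrite ltnS.
rewrite (bigD1 (Ordinal ii))//= big1 ?addr0; last first.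
  move=> j ji; rewrite RintegralZl//; last by apply: cont_itv_integrable; exact: cos_cont.
  rewrite orth; case: eqP => [e|_]; last by rewrite mul0r mulr0.
  by case/eqP: ji; apply: val_inj => /=; rewrite e.
rewrite RintegralZl//; last by apply: cont_itv_integrable; exact: cos_cont.
rewrite orth eqxx mul1r subSS.
have -> : (2 * (n - i) = n - i + (n - i))%N by rewrite mul2n addnn.
have -> : (2 * i.+1 = (i + i.+1).+1)%N by rewrite mul2n -addnn addSn addnS.
by move: (pi : R) pi0 => P P0; field.
Qed.

(** [disk_sum] consists of the terms with [j = i + 1] in the expansion of
    [(c + r)^n (c + r)^(n+1) r], and all the other terms are nonnegative. *)
Lemma disk_sum_le (c r : R) n : 0 <= c -> 0 <= r ->
  disk_sum c r n <= (c + r) ^+ (2 * n).+1 * r.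
Proof.
move=> c0 r0.
have -> : (c + r) ^+ (2 * n).+1 * r = (c + r) ^+ n * (c + r) ^+ n.+1 * r.
  by rewrite mul2n -addnn -addnS exprD.
rewrite !exprDn -mulrA mulr_suml ler_sum// => i _.
rewrite -(mulr_natr _ 'C(n, i)); have ii : (i.+1 < n.+2)%N by rewrite ltnS.
rewrite (bigD1 (Ordinal ii))//= subSS -(mulr_natr _ 'C(n.+1, i.+1)).
have -> : (2 * (n - i) = n - i + (n - i))%N by rewrite mul2n addnn.
have -> : (2 * i.+1 = (i + i.+1).+1)%N by rewrite mul2n -addnn addSn addnS.
rewrite [leRHS](_ : _ = 'C(n, i)%:R * 'C(n.+1, i.+1)%:R *
   (c ^+ (n - i + (n - i)) * r ^+ (i + i.+1).+1) + c ^+ (n - i) * r ^+ i * 'C(n, i)%:R *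
   ((\sum_(j < n.+2 | j != Ordinal ii) c ^+ (n.+1 - j) * r ^+ j *+ 'C(n.+1, j)) * r)); last first.
  by rewrite !exprD (exprS r (_ + _)) exprD; ring.
rewrite ?mul1r lerDl !mulr_ge0 ?exprn_ge0 ?ler0n// sumr_ge0// => j _.
by rewrite mulrn_wge0// mulr_ge0 ?exprn_ge0.
Qed.

Lemma disk_sum_ge0 (c r : R) n : 0 <= c -> 0 <= r -> 0 <= disk_sum c r n.
Proof.
by move=> c0 r0; rewrite sumr_ge0// => l _; rewrite !mulr_ge0 ?exprn_ge0 ?ler0n.
Qed.

End DiskSum.

(** * Asymptotic expansion of the moment of one disk *)

Section DiskAsymptotics.
Context {R : realType}.
Local Notation mu := (@lebesgue_measure R).

(** [F] is left general because it is taken once as [F0 b], for the real parts of the coefficients,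
    and once as 0, for their imaginary parts. *)
Lemma laplace_geometric (b w0 : R) (F : R -> R) (a : nat -> R) m (K : R) :
  -1 < b < 1 -> 0 < w0 -> 0 <= K ->
  (forall w, 0 <= w <= w0 -> `|F w - \sum_(k < m.+1) a k * w ^+ k| <= K * w ^+ m.+1) ->
  (forall s x, 0 < s < 1 -> 0 <= x <= asin (Num.sqrt (1 - b ^+ 2) * s) -> {for x, continuous (fun x
    => F (wsub x))}) ->
  exists s : R, 0 < s < 1 /\ exists C : R, 0 <= C /\ forall n, (m <= n)%N ->
  `|\int[mu]_(x in `[0, asin (Num.sqrt (1 - b ^+ 2) * s)]) (cos x ^+ (2 * n.+1) * F (wsub x))
     - \sum_(k < m.+1) a k * sc k (n.+1 - k)|
   <= C * (sc m.+1 (n - m) + (1 - (1 - b ^+ 2) * s ^+ 2) ^+ n).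
Proof.
move=> b1 w00 K0 hF Fc.
(* On the interval of integration [sin x <= s], hence [sin^2 x <= w0 / 4] and [cos^2 x >= 3 / 4];
   this keeps [wsub x] below [w0]. *)
pose s := Num.min (1 / 2) (w0 / 2).
have s0 : 0 < s by rewrite lt_min; apply/andP; split; lra.
have s12 : s <= 1 / 2 by rewrite ge_min lexx.
have sw0 : s <= w0 / 2 by rewrite ge_min lexx orbT.
have s1 : 0 < s < 1 by rewrite s0/=; lra.
exists s; split => //.
set k := Num.sqrt (1 - b ^+ 2).
have ksb := ks_bound b1 s1; rewrite -/k in ksb.
have k2 : k ^+ 2 = 1 - b ^+ 2.
  rewrite sqr_sqrtr//; case/andP: b1 => ? ?.
  have -> : 1 - b ^+ 2 = (1 - b) * (1 + b) by ring.
  by rewrite mulr_ge0//; lra.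
have kle1 : k <= 1 by rewrite -(sqrtr1 R) ler_wsqrtr// gerDl oppr_le0 sqr_ge0.
set t := asin (k * s).
have tb : 0 <= t < pi / 2 by exact: asin_bound.
pose rho := 1 - (1 - b ^+ 2) * s ^+ 2.
have ct : cos t ^+ 2 = rho by rewrite cos2sin2 sin_asin// exprMn k2.
have ct0 : 0 < cos t.
  by apply: (cos_gt0_asin ksb); rewrite lexx andbT; case/andP: tb.
have rho0 : 0 < rho by rewrite -ct exprn_gt0.
have wb x : 0 <= x <= t -> 0 <= wsub x <= w0.
  move=> xt; have /andP[h1 h2] := sin_le_asin ksb xt.
  have c0 := cos_gt0_asin ksb xt.
  rewrite /wsub sqr_ge0/= expr_div_n cos2sin2.
  have h3 : sin x <= s by apply: (le_trans h2); rewrite ler_piMl// ltW.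
  have h4 : sin x ^+ 2 <= s * (1 / 2) by rewrite expr2; apply: ler_pM => //; lra.
  rewrite ler_pdivrMr; last by rewrite -cos2sin2 exprn_gt0.
  nra.
(* The tail of the term [k] is at most [pi / 2] times [rho^(n+1-k)], and
   [rho^(n+1-k) <= rho^(-k) rho^n]. *)
exists (K + \sum_(k < m.+1) `|a k| * (pi / 2 * rho ^- k)).
have C1 : 0 <= \sum_(k < m.+1) `|a k| * (pi / 2 * rho ^- k).
  by rewrite sumr_ge0// => i _; rewrite !mulr_ge0 ?pi_ge0// invr_ge0 exprn_ge0 ?(ltW rho0).
split; first exact: addr_ge0.
move=> n mn.
apply: (le_trans (@laplace_error R F a m K t tb K0 _ _ n mn)).
- apply: continuous_in_subspaceT => x; rewrite inE/= in_itv/= => xt.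
  exact: (Fc s).
- by move=> x xt; apply: hF; exact: wb.
have sc0 := sc_ge0 m.+1 (n - m) : 0 <= sc _ _ :> R.
have rn0 : 0 <= rho ^+ n by rewrite exprn_ge0 ?(ltW rho0).
rewrite -/rho; set S := \sum_(k < m.+1) `|a k| * (pi / 2 * rho ^- k) in C1 *.
apply: (@le_trans _ _ (K * sc m.+1 (n - m) + S * rho ^+ n)); last first.
  by rewrite mulrDr; apply: lerD; rewrite ler_wpM2r// ?lerDl ?lerDr.
rewrite lerD2l /S.
rewrite mulr_suml; apply: ler_sum => i _.
rewrite -[leRHS]mulrA ler_wpM2l// -[leRHS]mulrA; apply: ler_wpM2l; first by rewrite divr_ge0 ?pi_ge0.
have ? : rho != 0 by rewrite gt_eqF.
rewrite exprM ct ler_pdivlMl ?exprn_gt0// -exprD addnC subnK; last first.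
  by rewrite ltnW// (leq_trans (ltn_ord i)).
by rewrite exprS ler_piMl// /rho gerDl oppr_le0 -k2 mulr_ge0// sqr_ge0.
Qed.

(** With [b = (c - r) / (c + r)] one has [1 - b^2 = 4 c r / (c + r)^2]; writing [cos (2x)] as
    [1 - 2 sin^2 x] lets [(c + r)^2] factor out of the squared modulus. *)
Lemma disk_sum_sin_integral (c r : R) n : 0 < c -> 0 < r ->
  disk_sum c r n = (c + r) ^+ (2 * n.+1) / pi *
    \int[mu]_(x in `[0, pi / 2])
     ((1 - (1 - ((c - r) / (c + r)) ^+ 2) * sin x ^+ 2) ^+ n *
      (1 - (1 - ((c - r) / (c + r)) ^+ 2) * sin x ^+ 2 - (c - r) / (c + r))).
Proof.
move=> c0 r0; have cr : c + r != 0 by rewrite gt_eqF// addr_gt0.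
have cc : continuous (fun x : R => (1 - (1 - ((c - r) / (c + r)) ^+ 2) * sin x ^+ 2) ^+ n *
      (1 - (1 - ((c - r) / (c + r)) ^+ 2) * sin x ^+ 2 - (c - r) / (c + r))).
  have c1 : continuous (fun x : R => (1 - (1 - ((c - r) / (c + r)) ^+ 2) * sin x ^+ 2)).
    move=> x; apply: cvgB; first exact: cvg_cst.
    by apply: cvgM; [exact: cvg_cst|apply: cont_exp; exact: continuous_sin].
  have c2 := @cont_exp _ _ n c1.
  have c3 : continuous (fun x : R => (1 - (1 - ((c - r) / (c + r)) ^+ 2) * sin x ^+ 2) - (c - r) / (c + r)).
    by move=> x; apply: cvgB; [exact: c1|exact: cvg_cst].
  by move=> x; apply: cvgM; [exact: c2|exact: c3].
rewrite disk_sum_integral.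
have -> : \int[mu]_(x in `[0, pi / 2]) ((c ^+ 2 + r ^+ 2 + 2 * c * r * cos (2 * x)) ^+ n *
    (r ^+ 2 + c * r * cos (2 * x))) = \int[mu]_(x in `[0, pi / 2]) ((c + r) ^+ (2 * n.+1) / 2 * ((1
      - (1 - ((c - r) / (c + r)) ^+ 2) * sin x ^+ 2) ^+ n *
      (1 - (1 - ((c - r) / (c + r)) ^+ 2) * sin x ^+ 2 - (c - r) / (c + r)))).
  apply: eq_Rintegral => x _.
  have -> : cos (2 * x) = 1 - 2 * sin x ^+ 2.
    have -> : 2 * x = x + x by ring.
    by rewrite cosD -!expr2 cos2sin2; ring.
  have -> : c ^+ 2 + r ^+ 2 + 2 * c * r * (1 - 2 * sin x ^+ 2) =
     (c + r) ^+ 2 * (1 - (1 - ((c - r) / (c + r)) ^+ 2) * sin x ^+ 2) by field.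
  have -> : r ^+ 2 + c * r * (1 - 2 * sin x ^+ 2) =
     (c + r) ^+ 2 / 2 * (1 - (1 - ((c - r) / (c + r)) ^+ 2) * sin x ^+ 2 - (c - r) / (c + r)) by field.
  by rewrite exprMn -exprM mulnS exprD; field.
rewrite RintegralZl//; last exact: cont_itv_integrable.
have : pi != 0 :> R by rewrite gt_eqF// pi_gt0.
by move: (pi : R) => P P0; field.
Qed.

(** The integral is cut at [asin s]. Below it the substitution and [laplace_geometric] apply; above
    it the base of the power [n] is at most [rho < 1], so that piece is geometric. *)
Lemma disk_sum_asymp (c r w0 K : R) (a : nat -> R) m : 0 < c -> 0 < r -> 0 < w0 -> 0 <= K ->
  (forall w, 0 <= w <= w0 ->
    `|F0 ((c - r) / (c + r)) w - \sum_(k < m.+1) a k * w ^+ k| <= K * w ^+ m.+1) ->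
  exists C rho : R, [/\ 0 <= C, 0 <= rho < 1 & forall n, (m <= n)%N ->
    `|disk_sum c r n / (c + r) ^+ (2 * n.+1) - pi^-1 * \sum_(k < m.+1) a k * sc k (n.+1 - k)|
     <= C * (sc m.+1 (n - m) + rho ^+ n)].
Proof.
move=> c0 r0 w00 K0 hF.
have cr : 0 < c + r by rewrite addr_gt0.
set b := (c - r) / (c + r) in hF *.
have b1 : -1 < b < 1 by rewrite ltr_pdivlMr// ltr_pdivrMr//; apply/andP; split; lra.
have Fc s x : 0 < s < 1 -> 0 <= x <= asin (Num.sqrt (1 - b ^+ 2) * s) ->
    {for x, continuous (fun x => F0 b (wsub x))} by move=> s1; exact: F0_cont.
have [s [s1 [C [C0 hC]]]] := laplace_geometric b1 w00 K0 hF Fc.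
pose rho := 1 - (1 - b ^+ 2) * s ^+ 2.
have b2 : 0 < 1 - b ^+ 2.
  case/andP: b1 => ? ?; have -> : 1 - b ^+ 2 = (1 - b) * (1 + b) by ring.
  by rewrite mulr_gt0//; lra.
have b2' : 1 - b ^+ 2 <= 1 by rewrite gerDl oppr_le0 sqr_ge0.
case/andP: (s1) => s0 s1'.
have ss : 0 < s ^+ 2 < 1 by rewrite exprn_gt0//= exprn_ilt1// ltW.
case/andP: ss => ss0 ss1.
have rho1 : 0 <= rho < 1.
  have h1 : 0 < (1 - b ^+ 2) * s ^+ 2 by rewrite mulr_gt0.
  have h2 : (1 - b ^+ 2) * s ^+ 2 <= 1.
    by rewrite -[leRHS]mulr1; apply: ler_pM => //; rewrite ltW.
  by rewrite /rho; apply/andP; split; lra.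
have [rho0 rholt] := andP rho1.
have p0 := @pi_gt0 R.
(* The summand [pi] pays for the piece beyond [asin s]: its length is at most [pi / 2] and its
   integrand at most [2 * rho ^+ n]. *)
exists (pi^-1 * (C + pi)), rho; split => //.
  apply: mulr_ge0; first by rewrite invr_ge0 ltW.
  by apply: addr_ge0 => //; exact: ltW.
move=> n mn; rewrite disk_sum_sin_integral// -/b.
set I := \int[mu]_(x in _) _.
have -> : (c + r) ^+ (2 * n.+1) / pi * I / (c + r) ^+ (2 * n.+1) = pi^-1 * I.
  have gen (A P J : R) : A != 0 -> P != 0 -> A / P * J / A = P^-1 * J.
    by move=> A0 P0; field; rewrite A0 P0.
  by apply: gen; [rewrite expf_neq0// gt_eqF|rewrite gt_eqF].
rewrite -mulrBr normrM gtr0_norm ?invr_gt0// -mulrA ler_wpM2l ?invr_ge0 ?(ltW p0)//.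
pose f (x : R) := (1 - (1 - b ^+ 2) * sin x ^+ 2) ^+ n * (1 - (1 - b ^+ 2) * sin x ^+ 2 - b).
have q1c : continuous (fun x : R => (1 - (1 - b ^+ 2) * sin x ^+ 2)).
  move=> x; apply: cvgB; first exact: cvg_cst.
  by apply: cvgM; [exact: cvg_cst|apply: cont_exp; exact: continuous_sin].
have fc : continuous f.
  have c2 := @cont_exp _ _ n q1c.
  have c3 : continuous (fun x : R => (1 - (1 - b ^+ 2) * sin x ^+ 2) - b).
    by move=> x; apply: cvgB; [exact: q1c|exact: cvg_cst].
  by move=> x; apply: cvgM; [exact: c2|exact: c3].
have s01 : 0 <= s < 1 by rewrite ltW.
have /andP[t0 tpi] := asin_bound s01.
have k2 : Num.sqrt (1 - b ^+ 2) ^+ 2 = 1 - b ^+ 2 by rewrite sqr_sqrtr// ltW.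
rewrite /I (@Rintegral_split _ f 0 (asin s) (pi / 2)) ?(ltW tpi)//.
have -> : \int[mu]_(x in `[0, asin s]) f x =
   \int[mu]_(x in `[0, asin (Num.sqrt (1 - b ^+ 2) * s)]) (cos x ^+ (2 * n.+1) * F0 b (wsub x)).
  by rewrite -(Rintegral_sin_substitution b1 s1) k2.
rewrite addrAC; apply: (le_trans (ler_normD _ _)).
rewrite [leRHS]mulrDl; apply: lerD; first exact: hC.
have sc0 := sc_ge0 m.+1 (n - m) : 0 <= sc _ _ :> R.
apply: (@le_trans _ _ (pi * rho ^+ n)); last by rewrite ler_wpM2l ?(ltW p0)// lerDr.
have fi := cont_itv_integrable_oc (asin s) (pi / 2) fc.
apply: (le_trans (le_normr_Rintegral _ fi)) => //.
apply: (@le_trans _ _ (\int[mu]_(x in `]asin s, pi / 2]) (2 * rho ^+ n))).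
  apply: le_Rintegral => //.
  - exact: integrable_norm.
  - by apply: cont_itv_integrable_oc => x; exact: cvg_cst.
  move=> x /=; rewrite in_itv/= => /andP[tx xpi].
  have sx : s <= sin x.
    rewrite -[leLHS](sin_asin s01) ltW// ltr_sin// in_itv/=; apply/andP; split; lra.
  have sx1 : sin x ^+ 2 <= 1 by rewrite exprn_ile1 ?sin_le1// (le_trans _ sx)// ltW.
  have sx2 : s ^+ 2 <= sin x ^+ 2 by rewrite lerXn2r ?nnegrE ?(ltW s0)// (le_trans _ sx)// ltW.
  have q0 : 0 <= 1 - (1 - b ^+ 2) * sin x ^+ 2.
    rewrite subr_ge0 -[leRHS]mulr1; apply: ler_pM => //; first exact: ltW.
    exact: sqr_ge0.
  have q1 : 1 - (1 - b ^+ 2) * sin x ^+ 2 <= rho.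
    by rewrite /rho lerD2l lerN2 ler_wpM2l// ltW.
  rewrite /f normrM mulrC; apply: ler_pM => //.
    by case/andP: b1 => ? ?; rewrite ler_norml; apply/andP; split; lra.
  by rewrite normrX ger0_norm// lerXn2r.
rewrite Rintegral_cst// mulrC.
have -> : pi * rho ^+ n = pi / 2 * (2 * rho ^+ n) by field.
rewrite ler_wpM2r//; first by rewrite mulr_ge0// exprn_ge0.
have := @lebesgue_measure_itv R `]asin s, pi / 2].
rewrite /= lte_fin tpi => -> /=.
by rewrite gerDl oppr_le0.
Qed.

(** Meant for the imaginary parts of the coefficients: they are treated as an expansion of the zero
    function, which avoids showing that each of them vanishes. *)
Lemma zero_asymp (w0 K : R) (a : nat -> R) m : 0 < w0 -> 0 <= K ->
  (forall w, 0 <= w <= w0 -> `|\sum_(k < m.+1) a k * w ^+ k| <= K * w ^+ m.+1) ->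
  exists C rho : R, [/\ 0 <= C, 0 <= rho < 1 & forall n, (m <= n)%N ->
    `|\sum_(k < m.+1) a k * sc k (n.+1 - k)| <= C * (sc m.+1 (n - m) + rho ^+ n)].
Proof.
move=> w00 K0 ha.
have b1 : ((-1 : R) < 0) && ((0 : R) < 1) by rewrite ltrN10 ltr01.
have h0 w : 0 <= w <= w0 -> `|0 - \sum_(k < m.+1) a k * w ^+ k| <= K * w ^+ m.+1.
  by move=> /ha; rewrite sub0r normrN.
have [s [/andP[s0 s1] [C [C0 hC]]]] := laplace_geometric (F := fun=> 0) b1 w00 K0 h0 (fun _ _ _ _
  => cvg_cst _).
exists C, (1 - s ^+ 2); split => //.
  have : 0 < s ^+ 2 < 1 by rewrite exprn_gt0//= exprn_ilt1// ltW.
  by move=> /andP[? ?]; apply/andP; split; lra.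
move=> n mn; have := hC n mn.
under eq_Rintegral do rewrite mulr0.
by rewrite Rintegral_cst// mul0r sub0r normrN expr0n/= subr0 mul1r.
Qed.

End DiskAsymptotics.

(** * Moments of a disk *)

Section AreaIntegral.
Context {R : realType}.
Local Notation mu := (@lebesgue_measure R).
Local Notation mu2 := (mu \x mu)%E.
Local Notation C := R[i].
Implicit Types (D : set C) (f g : C -> C).

Definition plane D : set (R * R) := [set p : R * R | D (p.1 +i* p.2)].

Lemma Re_le_normc (z : C) : `|complex.Re z| <= normc z.
Proof. by case: z => x y /=; rewrite -[leLHS]sqrtr_sqr ler_wsqrtr// lerDl sqr_ge0. Qed.

Lemma Im_le_normc (z : C) : `|complex.Im z| <= normc z.
Proof. by case: z => x y /=; rewrite -[leLHS]sqrtr_sqr ler_wsqrtr// lerDr sqr_ge0. Qed.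

Lemma normc_ge0 (z : C) : 0 <= normc z.
Proof. by case: z => x y /=; exact: sqrtr_ge0. Qed.

Lemma normc_conj (z : C) : normc z^* = normc z.
Proof. by case: z => x y /=; rewrite sqrrN. Qed.

Lemma sqr_normcE (z : C) : normc z ^+ 2 = complex.Re z ^+ 2 + complex.Im z ^+ 2.
Proof. by case: z => x y /=; rewrite sqr_sqrtr// addr_ge0 ?sqr_ge0. Qed.

(** A class of integrands containing the polynomials in [z] and its conjugate, closed under sums,
    products and conjugation; the bound on the closed unit disk makes its members integrable over
    every [domain]. *)
Definition regular f :=
  [/\ measurable_fun setT (fun p : R * R => complex.Re (f (p.1 +i* p.2))),
      measurable_fun setT (fun p : R * R => complex.Im (f (p.1 +i* p.2)))
    & exists M : R, forall z, normc z <= 1 -> normc (f z) <= M].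

Lemma regular_cst (k : C) : regular (fun=> k).
Proof. by split; [exact: measurable_cst|exact: measurable_cst|exists (normc k)]. Qed.

Lemma regular_id : regular id.
Proof. by split; [exact: measurable_fst|exact: measurable_snd|exists 1]. Qed.

Lemma regular_conj f : regular f -> regular (fun z => (f z)^*).
Proof.
move=> [mr mi [M hM]]; split.
- have -> : (fun p : R * R => complex.Re (f (p.1 +i* p.2))^*) =
     (fun p => complex.Re (f (p.1 +i* p.2))) by apply/funext => p; case: (f _).
  exact: mr.
- have -> : (fun p : R * R => complex.Im (f (p.1 +i* p.2))^*) =
     (fun p => - complex.Im (f (p.1 +i* p.2))) by apply/funext => p; case: (f _).
  exact: measurable_funN.
- by exists M => z /hM; rewrite normc_conj.
Qed.

Lemma regularD f g : regular f -> regular g -> regular (fun z => f z + g z).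
Proof.
move=> [mr mi [M hM]] [mr' mi' [M' hM']]; split.
- have -> : (fun p : R * R => complex.Re (f (p.1 +i* p.2) + g (p.1 +i* p.2))) =
     (fun p => complex.Re (f (p.1 +i* p.2)) + complex.Re (g (p.1 +i* p.2))).
    by apply/funext => p; case: (f _); case: (g _).
  exact: measurable_funD.
- have -> : (fun p : R * R => complex.Im (f (p.1 +i* p.2) + g (p.1 +i* p.2))) =
     (fun p => complex.Im (f (p.1 +i* p.2)) + complex.Im (g (p.1 +i* p.2))).
    by apply/funext => p; case: (f _); case: (g _).
  exact: measurable_funD.
- exists (M + M') => z z1; apply: (le_trans (le_normcD _ _)).
  by apply: lerD; [exact: hM|exact: hM'].
Qed.

Lemma regularM f g : regular f -> regular g -> regular (fun z => f z * g z).
Proof.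
move=> [mr mi [M hM]] [mr' mi' [M' hM']]; split.
- have -> : (fun p : R * R => complex.Re (f (p.1 +i* p.2) * g (p.1 +i* p.2))) =
     (fun p => complex.Re (f (p.1 +i* p.2)) * complex.Re (g (p.1 +i* p.2))
       - complex.Im (f (p.1 +i* p.2)) * complex.Im (g (p.1 +i* p.2))).
    by apply/funext => p; case: (f _); case: (g _).
  by apply: measurable_funB; exact: measurable_funM.
- have -> : (fun p : R * R => complex.Im (f (p.1 +i* p.2) * g (p.1 +i* p.2))) =
     (fun p => complex.Re (f (p.1 +i* p.2)) * complex.Im (g (p.1 +i* p.2))
       + complex.Im (f (p.1 +i* p.2)) * complex.Re (g (p.1 +i* p.2))).
    by apply/funext => p; case: (f _); case: (g _).
  by apply: measurable_funD; exact: measurable_funM.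
- exists (M * M') => z z1; rewrite normcM.
  by apply: ler_pM; rewrite ?normc_ge0 ?hM ?hM'.
Qed.

Lemma regularX f n : regular f -> regular (fun z => f z ^+ n).
Proof.
move=> rf; elim: n => [|n IH]; first by under eq_fun do rewrite expr0; exact: regular_cst.
by under eq_fun do rewrite exprS; exact: regularM.
Qed.

Lemma regular_sum (I : Type) (s : seq I) (F : I -> C -> C) :
  (forall i, regular (F i)) -> regular (fun z => \sum_(i <- s) F i z).
Proof.
move=> rF; elim: s => [|i s IH].
  by under eq_fun do rewrite big_nil; exact: regular_cst.
by under eq_fun do rewrite big_cons; exact: regularD.
Qed.

Lemma regular_horner (p : {poly C}) : regular (fun z => p.[z]).
Proof.
under eq_fun do rewrite horner_coef.
apply: regular_sum => i; apply: regularM; first exact: regular_cst.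
by apply: regularX; exact: regular_id.
Qed.

Definition domain D := measurable (plane D) /\ (forall z, D z -> normc z <= 1).

Lemma domain_setD D1 D2 : domain D1 -> domain D2 -> domain (D1 `\` D2).
Proof. by move=> [m1 b1] [m2 b2]; split; [exact: measurableD|move=> z [/b1]]. Qed.

Lemma domain_bigcup (I : finType) (F : I -> set C) :
  (forall i, domain (F i)) -> domain (\bigcup_i F i).
Proof.
move=> dF; split; last by move=> z [i _ /(dF i).2].
have -> : plane (\bigcup_i F i) = \bigcup_i plane (F i) by [].
apply: fin_bigcup_measurable; first exact: finite_finset.
by move=> i _; exact: (dF i).1.
Qed.

Lemma plane_finite D : domain D -> (mu2 (plane D) < +oo)%E.
Proof.
move=> [mD bD].
have mB : measurable (`[-1, 1]%classic `*` `[-1, 1]%classic : set (R * R)).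
  exact: measurableX.
have sub : plane D `<=` `[-1, 1]%classic `*` `[-1, 1]%classic.
  move=> [x y] /= /bD h; split => /=; rewrite in_itv/= -ler_norml.
    exact: (le_trans (Re_le_normc (x +i* y)) h).
  exact: (le_trans (Im_le_normc (x +i* y)) h).
apply: (@le_lt_trans _ _ (mu2 (`[-1, 1]%classic `*` `[-1, 1]%classic))).
  by apply: le_measure; rewrite ?inE.
rewrite product_measure1E//.
have e : lebesgue_measure `[-1, 1]%classic = (1 - -1)%:E :> \bar R.
  by rewrite lebesgue_measure_itv/= lte_fin gtrN.
rewrite [X in (X < _)%E](_ : _ = ((1 - -1)%:E * (1 - -1)%:E)%E).
  by rewrite -EFinM ltry.
by congr (_ * _)%E; exact: e.
Qed.

Lemma regular_integrable D f : domain D -> regular f ->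
  mu2.-integrable (plane D) (EFin \o (fun p => complex.Re (f (p.1 +i* p.2)))) /\
  mu2.-integrable (plane D) (EFin \o (fun p => complex.Im (f (p.1 +i* p.2)))).
Proof.
move=> dD [mr mi [M hM]]; split; apply: measurable_bounded_integrable.
- exact: dD.1.
- exact: plane_finite.
- exact: measurable_funTS.
- exists M; split; first exact: num_real.
  move=> M' /ltW MM' p /= /dD.2 /hM h.
  by apply: le_trans MM'; apply: le_trans h; exact: Re_le_normc.
- exact: dD.1.
- exact: plane_finite.
- exact: measurable_funTS.
- exists M; split; first exact: num_real.
  move=> M' /ltW MM' p /= /dD.2 /hM h.
  by apply: le_trans MM'; apply: le_trans h; exact: Im_le_normc.
Qed.

Local Notation IC := area_integralC.

Lemma ICD D f g : domain D -> regular f -> regular g ->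
  IC D (fun z => f z + g z) = IC D f + IC D g.
Proof.
move=> dD rf rg; have [rf1 rf2] := regular_integrable dD rf.
have [rg1 rg2] := regular_integrable dD rg.
rewrite /area_integralC /area_integral.
have -> : \int[mu2]_(p in plane D) complex.Re (f (p.1 +i* p.2) + g (p.1 +i* p.2)) =
  \int[mu2]_(p in plane D) (complex.Re (f (p.1 +i* p.2)) + complex.Re (g (p.1 +i* p.2))).
  by apply: eq_Rintegral => p _; case: (f _); case: (g _).
have -> : \int[mu2]_(p in plane D) complex.Im (f (p.1 +i* p.2) + g (p.1 +i* p.2)) =
  \int[mu2]_(p in plane D) (complex.Im (f (p.1 +i* p.2)) + complex.Im (g (p.1 +i* p.2))).
  by apply: eq_Rintegral => p _; case: (f _); case: (g _).
by rewrite !RintegralD ?mulrDr//; exact: dD.1.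
Qed.

Lemma ICZ D (k : C) f : domain D -> regular f ->
  IC D (fun z => k * f z) = k * IC D f.
Proof.
move=> dD rf; have [rf1 rf2] := regular_integrable dD rf.
case: k => a b; rewrite /area_integralC /area_integral.
have iZ (t : R) (h : R * R -> R) : mu2.-integrable (plane D) (EFin \o h) ->
  mu2.-integrable (plane D) (EFin \o (fun p => t * h p)).
  move=> ih; have -> : EFin \o (fun p => t * h p) = (fun p => (t%:E * (EFin \o h) p)%E) by [].
  by apply: integrableZl => //; exact: dD.1.
have -> : \int[mu2]_(p in plane D) complex.Re ((a +i* b) * f (p.1 +i* p.2)) =
  \int[mu2]_(p in plane D) (a * complex.Re (f (p.1 +i* p.2)) - b * complex.Im (f (p.1 +i* p.2))).
  by apply: eq_Rintegral => p _; case: (f _).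
have -> : \int[mu2]_(p in plane D) complex.Im ((a +i* b) * f (p.1 +i* p.2)) =
  \int[mu2]_(p in plane D) (a * complex.Im (f (p.1 +i* p.2)) + b * complex.Re (f (p.1 +i* p.2))).
  by apply: eq_Rintegral => p _; case: (f _).
have mD := dD.1.
rewrite RintegralB ?RintegralD ?RintegralZl//; try exact: iZ.
by congr (_ +i* _); ring.
Qed.

Lemma IC_sum D (I : Type) (s : seq I) (F : I -> C -> C) : domain D ->
  (forall i, regular (F i)) ->
  IC D (fun z => \sum_(i <- s) F i z) = \sum_(i <- s) IC D (F i).
Proof.
move=> dD rF; elim: s => [|i s IH].
  under [X in IC D X]eq_fun do rewrite big_nil.
  rewrite big_nil; have := ICZ 0 dD (regular_cst 0).
  by under [X in IC D X = _]eq_fun do rewrite mul0r; rewrite mul0r.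
under [X in IC D X]eq_fun do rewrite big_cons.
by rewrite ICD// ?IH ?big_cons//; exact: regular_sum.
Qed.

Lemma IC_real D (h : C -> R) : IC D (fun z => (h z)%:C) = (area_integral D h)%:C.
Proof.
rewrite /area_integralC /=; congr (_ +i* _).
by rewrite /area_integral /Rintegral integral0 mulr0.
Qed.

Lemma IC_setU D1 D2 f : domain D1 -> domain D2 -> regular f -> D1 `&` D2 = set0 ->
  IC (D1 `|` D2) f = IC D1 f + IC D2 f.
Proof.
move=> d1 d2 rf dis.
have dU : domain (D1 `|` D2).
  by split; [exact: (measurableU _ _ d1.1 d2.1)|move=> z [/d1.2|/d2.2]].
have [i1 i2] := regular_integrable dU rf.
have dj : [disjoint plane D1 & plane D2].
  apply/eqP; rewrite -subset0 => -[x y] [/= h1 h2].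
  by have : (D1 `&` D2) (x +i* y) by []; rewrite dis.
rewrite /area_integralC /area_integral -/(plane _) -/(plane D1) -/(plane D2).
have -> : plane (D1 `|` D2) = plane D1 `|` plane D2 by [].
by rewrite !Rintegral_setU ?mulrDr//; [exact: d1.1|exact: d2.1|exact: d1.1|exact: d2.1].
Qed.

Lemma IC_setD D1 D2 f : domain D1 -> domain D2 -> regular f -> D2 `<=` D1 ->
  IC (D1 `\` D2) f = IC D1 f - IC D2 f.
Proof.
move=> d1 d2 rf s21.
have := IC_setU (domain_setD d1 d2) d2 rf; rewrite setDKU// => ->; first by rewrite addrK.
by rewrite setDE -setIA setICl setI0.
Qed.

Lemma IC_bigcup (I : finType) (F : I -> set C) f : (forall i, domain (F i)) -> regular f ->
  (forall i j, i != j -> F i `&` F j = set0) ->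
  IC (\bigcup_i F i) f = \sum_i IC (F i) f.
Proof.
move=> dF rf dis.
have H (s : seq I) : uniq s -> domain (\bigcup_(i in [set` s]) F i) /\
    IC (\bigcup_(i in [set` s]) F i) f = \sum_(i <- s) IC (F i) f.
  elim: s => [_|i s IH /= /andP[ins us]].
    rewrite set_nil bigcup_set0 big_nil; split; first by split => //; exact: measurable0.
    rewrite /area_integralC /area_integral.
    have -> : [set p : R * R | set0 (p.1 +i* p.2)] = set0 :> set (R * R) by [].
    by rewrite !Rintegral_set0 mulr0.
  have [d e] := IH us.
  have -> : [set` i :: s] = [set i] `|` [set` s].
      apply/seteqP; split => x /=; first by rewrite inE => /orP[/eqP|]; [left|right].
      by move=> [->|xs]; rewrite inE ?eqxx// xs orbT.
    rewrite bigcup_setU bigcup_set1 big_cons; split.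
    split; last by move=> z [/(dF i).2|/d.2].
    exact: (measurableU _ _ (dF i).1 d.1).
  rewrite IC_setU ?e//.
  rewrite -subset0 => z [Fi [j js Fj]].
  have ij : i != j by apply: contraNneq ins => ->.
  by have : (F i `&` F j) z by []; rewrite dis.
have := (H (enum I) (enum_uniq _)).2.
rewrite big_enum/= => <-; congr (IC _ f).
by apply: eq_bigcupl; split => i //= _; rewrite mem_enum.
Qed.

(* One definition for the open unit disk and the closed holes. *)
Definition gdisk (b : bool) (c : C) (r : R) : set C :=
  if b then closed_disk c r else disk c r.

Lemma gdiskE b (c : C) (r : R) : 0 < r -> plane (gdisk b c r) =
  [set p : R * R | if b then (p.1 - complex.Re c) ^+ 2 + (p.2 - complex.Im c) ^+ 2 <= r ^+ 2
     else (p.1 - complex.Re c) ^+ 2 + (p.2 - complex.Im c) ^+ 2 < r ^+ 2].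
Proof.
move=> r0; apply/funext => -[x y]; rewrite /plane /gdisk /closed_disk /disk/=.
have -> : (x - complex.Re c) ^+ 2 + (y - complex.Im c) ^+ 2 = normc (x +i* y - c) ^+ 2.
  by rewrite sqr_normcE; case: c.
have n0 := normc_ge0 (x +i* y - c); have r0' := ltW r0.
by case: b; rewrite /mkset ?ler_pXn2r ?ltr_pXn2r ?nnegrE.
Qed.

Lemma gdisk_measurable b (c : C) (r : R) : 0 < r -> measurable (plane (gdisk b c r)).
Proof.
move=> r0; rewrite gdiskE//.
pose g (p : R * R) := (p.1 - complex.Re c) ^+ 2 + (p.2 - complex.Im c) ^+ 2.
have mg : measurable_fun setT g.
  apply: measurable_funD; apply: measurable_funX; apply: measurable_funB => //;
    exact: measurable_cst.
have -> : [set p : R * R | if b then (p.1 - complex.Re c) ^+ 2 + (p.2 - complex.Im c) ^+ 2 <= r ^+ 2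
     else (p.1 - complex.Re c) ^+ 2 + (p.2 - complex.Im c) ^+ 2 < r ^+ 2] =
   setT `&` g @^-1` [set` Interval -oo%O (BSide (~~ b) (r ^+ 2))].
  by apply/seteqP; split=> p; rewrite /g; case: b => /=; rewrite in_itv/=; [|move=>?; split|move=>
    []|move=> []].
by apply: mg => //; exact: measurable_itv.
Qed.

Lemma fubini1_real (A : set (R * R)) (phi : R * R -> R) (H : R -> R) : measurable A ->
  mu2.-integrable A (EFin \o phi) ->
  (forall x, (\int[mu]_(y in [set y | A (x, y)]) (phi (x, y))%:E = (H x)%:E)%E) ->
  \int[mu2]_(p in A) phi p = \int[mu]_x H x.
Proof.
move=> mA iA hH; rewrite /Rintegral; congr fine.
rewrite integral_mkcond -integral12_prod_meas1; last by rewrite -integrable_mkcond.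
apply: eq_integral => x _; rewrite -hH [in RHS]integral_mkcond.
by apply: eq_integral => y _; rewrite /patch/= (_ : ((x, y) \in A) = (y \in [set y | A (x, y)]))//;
  apply/idP/idP => /set_mem h; exact/mem_set.
Qed.

Lemma fubini2_real (A : set (R * R)) (phi : R * R -> R) (H : R -> R) : measurable A ->
  mu2.-integrable A (EFin \o phi) ->
  (forall y, (\int[mu]_(x in [set x | A (x, y)]) (phi (x, y))%:E = (H y)%:E)%E) ->
  \int[mu2]_(p in A) phi p = \int[mu]_y H y.
Proof.
move=> mA iA hH; rewrite /Rintegral; congr fine.
rewrite integral_mkcond -integral21_prod_meas1; last by rewrite -integrable_mkcond.
apply: eq_integral => x _; rewrite -hH [in RHS]integral_mkcond.
by apply: eq_integral => y _; rewrite /patch/= (_ : ((y, x) \in A) = (y \in [set y | A (y, x)]))//;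
  apply/idP/idP => /set_mem h; exact/mem_set.
Qed.

Definition slice b (c2 h : R) : set R :=
  [set y : R | if b then (y - c2) ^+ 2 <= h else (y - c2) ^+ 2 < h].

(** No sign of [h] is assumed: for [h < 0] the line misses the disk, and the convention that the
    root is 0 makes the right-hand side vanish too. *)
Lemma slice_integral b (c2 h : R) (G g : R -> R) : continuous g ->
  (forall y : R, is_derive y 1 G (g y)) ->
  (\int[mu]_(y in slice b c2 h) (g y)%:E =
   (G (c2 + Num.sqrt h) - G (c2 - Num.sqrt h))%:E)%E.
Proof.
move=> cg dG; have [h0|h0] := ltP h 0.
  have -> : slice b c2 h = set0.
    apply/seteqP; split => // y /=; have := sqr_ge0 (y - c2).
    by rewrite /slice/=; case: b => /= h1 h2; lra.
  by rewrite integral_set0 ltr0_sqrtr// addr0 subr0 subrr.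
set s := Num.sqrt h; have s0 : 0 <= s by exact: sqrtr_ge0.
have hs : h = s ^+ 2 by rewrite sqr_sqrtr.
have -> : slice b c2 h =
   [set` Interval (BSide b (c2 - s)) (BSide (~~ b) (c2 + s))].
  rewrite /slice; apply/seteqP; split => y /=; rewrite hs in_itv/= -(real_normK (num_real (y -
    c2))); case: b => /=.
  - by rewrite ler_pXn2r ?nnegrE// ler_norml => /andP[? ?]; apply/andP; split; lra.
  - by rewrite ltr_pXn2r ?nnegrE// ltr_norml => /andP[? ?]; apply/andP; split; lra.
  - by move=> /andP[? ?]; rewrite ler_pXn2r ?nnegrE// ler_norml; apply/andP; split; lra.
  - by move=> /andP[? ?]; rewrite ltr_pXn2r ?nnegrE// ltr_norml; apply/andP; split; lra.
have mg : measurable_fun `]c2 - s, c2 + s[ (EFin \o g).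
  by apply/measurable_EFinP; apply: measurable_funTS; exact: continuous_measurable_fun.
rewrite integral_itv_bndoo// -(@integral_itv_bndoo _ _ _ _ true false)//.
rewrite -(@Rintegral_derive _ G g)//; [|by lra|exact: continuous_subspaceT].
rewrite /Rintegral fineK//; apply: integrable_fin_num => //.
exact: cont_itv_integrable.
Qed.

(** Derivative along a real line, taken componentwise because the slices are integrated separately
    in real and imaginary part. *)
Definition pderive (f : R -> C) (x : R) (df : C) :=
  is_derive x 1 (fun x => complex.Re (f x) : R) (complex.Re df) /\
  is_derive x 1 (fun x => complex.Im (f x) : R) (complex.Im df).

Lemma pderive_cst (k : C) x : pderive (fun=> k) x 0.
Proof. by split; exact: is_derive_cst. Qed.

Lemma pderiveD (f1 f2 : R -> C) x d1 d2 : pderive f1 x d1 -> pderive f2 x d2 ->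
  pderive (fun x => f1 x + f2 x) x (d1 + d2).
Proof.
move=> [r1 i1] [r2 i2]; split.
  have -> : (fun x => complex.Re (f1 x + f2 x)) =
    (fun x => complex.Re (f1 x)) + (fun x => complex.Re (f2 x)).
    by apply/funext => y; transitivity (complex.Re (f1 y) + complex.Re (f2 y)) => //;
      case: (f1 y); case: (f2 y).
  by apply: (is_derive_eq (is_deriveD r1 r2)); case: d1 {r1 i1}; case: d2 {r2 i2}.
have -> : (fun x => complex.Im (f1 x + f2 x)) =
  (fun x => complex.Im (f1 x)) + (fun x => complex.Im (f2 x)).
  by apply/funext => y; transitivity (complex.Im (f1 y) + complex.Im (f2 y)) => //;
    case: (f1 y); case: (f2 y).
by apply: (is_derive_eq (is_deriveD i1 i2)); case: d1 {r1 i1}; case: d2 {r2 i2}.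
Qed.

Lemma pderiveM (f1 f2 : R -> C) x d1 d2 : pderive f1 x d1 -> pderive f2 x d2 ->
  pderive (fun x => f1 x * f2 x) x (d1 * f2 x + f1 x * d2).
Proof.
move=> [r1 i1] [r2 i2]; split.
  have -> : (fun x => complex.Re (f1 x * f2 x)) =
    (fun x => complex.Re (f1 x)) * (fun x => complex.Re (f2 x)) -
    (fun x => complex.Im (f1 x)) * (fun x => complex.Im (f2 x)).
    by apply/funext => y; transitivity (complex.Re (f1 y) * complex.Re (f2 y) -
      complex.Im (f1 y) * complex.Im (f2 y)) => //; case: (f1 y); case: (f2 y).
  apply: (is_derive_eq (is_deriveB (is_deriveM r1 r2) (is_deriveM i1 i2))).
  rewrite /GRing.scale/=.
  by case: d1 {r1 i1}; case: d2 {r2 i2}; case: (f1 x); case: (f2 x) => * /=; ring.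
have -> : (fun x => complex.Im (f1 x * f2 x)) =
  (fun x => complex.Re (f1 x)) * (fun x => complex.Im (f2 x)) +
  (fun x => complex.Im (f1 x)) * (fun x => complex.Re (f2 x)).
  by apply/funext => y; transitivity (complex.Re (f1 y) * complex.Im (f2 y) +
    complex.Im (f1 y) * complex.Re (f2 y)) => //; case: (f1 y); case: (f2 y).
apply: (is_derive_eq (is_deriveD (is_deriveM r1 i2) (is_deriveM i1 r2))).
rewrite /GRing.scale/=.
by case: d1 {r1 i1}; case: d2 {r2 i2}; case: (f1 x); case: (f2 x) => * /=; ring.
Qed.

Lemma pderiveX (f1 : R -> C) x d1 n : pderive f1 x d1 ->
  pderive (fun x => f1 x ^+ n) x (n%:R * f1 x ^+ n.-1 * d1).
Proof.
move=> h; elim: n => [|n IH].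
  by under eq_fun do rewrite expr0; rewrite !mul0r; exact: pderive_cst.
under eq_fun do rewrite exprS.
have -> : n.+1%:R * f1 x ^+ n.+1.-1 * d1 = d1 * f1 x ^+ n + f1 x * (n%:R * f1 x ^+ n.-1 * d1).
  case: n {IH} => [|n]; first by rewrite !expr0; ring.
  by rewrite /= -(natr1 n.+1) exprS; ring.
exact: pderiveM.
Qed.

Lemma pderive_continuous (f df : R -> C) : (forall x, pderive f x (df x)) ->
  continuous (fun x => complex.Re (f x)) /\ continuous (fun x => complex.Im (f x)).
Proof.
by move=> h; split=> x; [exact: is_derive_continuous (h x).1|exact: is_derive_continuous (h x).2].
Qed.

Lemma gdisk_slice1 b (c : C) (r x : R) : 0 < r ->
  [set y | plane (gdisk b c r) (x, y)] = slice b (complex.Im c) (r ^+ 2 - (x - complex.Re c) ^+ 2).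
Proof.
by move=> r0; rewrite gdiskE//; apply/funext => y; rewrite /slice/mkset /=; case: b;
  rewrite ?lerBrDl ?ltrBrDl.
Qed.

Lemma gdisk_slice2 b (c : C) (r y : R) : 0 < r ->
  [set x | plane (gdisk b c r) (x, y)] = slice b (complex.Re c) (r ^+ 2 - (y - complex.Im c) ^+ 2).
Proof.
by move=> r0; rewrite gdiskE//; apply/funext => x; rewrite /slice/mkset /=; case: b;
  rewrite ?lerBrDr ?ltrBrDr.
Qed.

(** * Centred moments of a disk, by integration by parts *)

Section Moments.
Variables (b : bool) (c : C) (r : R).
Hypotheses (r0 : 0 < r) (dD : domain (gdisk b c r)).
Let D := gdisk b c r.

Let Cpt1 x (s : R) : 0 <= r ^+ 2 - (x - complex.Re c) ^+ 2 ->
  s ^+ 2 = 1 -> 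
  normc (x +i* (complex.Im c + s * Num.sqrt (r ^+ 2 - (x - complex.Re c) ^+ 2)) - c) ^+ 2 = r ^+ 2.
Proof.
move=> h0 s1; rewrite sqr_normcE; case: c h0 => c1 c2 /= h0.
have -> : c2 + s * Num.sqrt (r ^+ 2 - (x - c1) ^+ 2) - c2 = s * Num.sqrt (r ^+ 2 - (x - c1) ^+ 2) by ring.
by rewrite exprMn s1 sqr_sqrtr// mul1r addrC subrK.
Qed.

Let Cpt2 y (s : R) : 0 <= r ^+ 2 - (y - complex.Im c) ^+ 2 ->
  s ^+ 2 = 1 -> 
  normc ((complex.Re c + s * Num.sqrt (r ^+ 2 - (y - complex.Im c) ^+ 2)) +i* y - c) ^+ 2 = r ^+ 2.
Proof.
move=> h0 s1; rewrite sqr_normcE; case: c h0 => c1 c2 /= h0.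
have -> : c1 + s * Num.sqrt (r ^+ 2 - (y - c2) ^+ 2) - c1 = s * Num.sqrt (r ^+ 2 - (y - c2) ^+ 2) by ring.
by rewrite exprMn s1 sqr_sqrtr// mul1r subrK.
Qed.

(** Fubini and the fundamental theorem on each vertical slice, whose end points lie on the circle
    where [F] vanishes. [F''] serves only to make [F'] continuous along the slice. *)
Lemma IC_dy (F F' F'' : C -> C) : regular F' ->
  (forall x y : R, pderive (fun y => F (x +i* y)) y (F' (x +i* y))) ->
  (forall x y : R, pderive (fun y => F' (x +i* y)) y (F'' (x +i* y))) ->
  (forall z, normc (z - c) ^+ 2 = r ^+ 2 -> F z = 0) ->
  IC D F' = 0.
Proof.
move=> rF' dF dF' F0.
have [i1 i2] := regular_integrable dD rF'.
have end0 x (s : R) : 0 <= r ^+ 2 - (x - complex.Re c) ^+ 2 -> s ^+ 2 = 1 ->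
  F (x +i* (complex.Im c + s * Num.sqrt (r ^+ 2 - (x - complex.Re c) ^+ 2))) = 0.
  by move=> h s1; apply: F0; exact: Cpt1.
have zero (g : C -> R) : g 0 = 0 -> forall x,
   (g (F (x +i* (complex.Im c + Num.sqrt (r ^+ 2 - (x - complex.Re c) ^+ 2)))) -
    g (F (x +i* (complex.Im c - Num.sqrt (r ^+ 2 - (x - complex.Re c) ^+ 2))))) = 0.
  move=> g0 x; have [h|h] := leP 0 (r ^+ 2 - (x - complex.Re c) ^+ 2).
    have := end0 x 1 h (expr1n _ _); rewrite mul1r => ->.
    have s1 : (-1) ^+ 2 = 1 :> R by rewrite sqrrN expr1n.
    by have := end0 x (-1) h s1; rewrite mulN1r => ->; rewrite g0 subrr.
  by rewrite ltr0_sqrtr// addr0 subr0 subrr.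
rewrite /area_integralC /area_integral -/(plane D).
rewrite (@fubini1_real _ _ (fun=> 0) dD.1 i1); last first.
  move=> x; rewrite gdisk_slice1//.
  have [c1 _] := pderive_continuous (dF' x).
  rewrite (slice_integral _ _ _ c1 (fun y => (dF x y).1)).
  by rewrite (zero (@complex.Re R)).
rewrite (@fubini1_real _ _ (fun=> 0) dD.1 i2); last first.
  move=> x; rewrite gdisk_slice1//.
  have [_ c1] := pderive_continuous (dF' x).
  rewrite (slice_integral _ _ _ c1 (fun y => (dF x y).2)).
  by rewrite (zero (@complex.Im R)).
by rewrite Rintegral_cst// mul0r mulr0.
Qed.

Lemma IC_dx (F F' F'' : C -> C) : regular F' ->
  (forall x y : R, pderive (fun x => F (x +i* y)) x (F' (x +i* y))) ->
  (forall x y : R, pderive (fun x => F' (x +i* y)) x (F'' (x +i* y))) ->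
  (forall z, normc (z - c) ^+ 2 = r ^+ 2 -> F z = 0) ->
  IC D F' = 0.
Proof.
move=> rF' dF dF' F0.
have [i1 i2] := regular_integrable dD rF'.
have end0 y (s : R) : 0 <= r ^+ 2 - (y - complex.Im c) ^+ 2 -> s ^+ 2 = 1 ->
  F ((complex.Re c + s * Num.sqrt (r ^+ 2 - (y - complex.Im c) ^+ 2)) +i* y) = 0.
  by move=> h s1; apply: F0; exact: Cpt2.
have zero (g : C -> R) : g 0 = 0 -> forall y,
   (g (F ((complex.Re c + Num.sqrt (r ^+ 2 - (y - complex.Im c) ^+ 2)) +i* y)) -
    g (F ((complex.Re c - Num.sqrt (r ^+ 2 - (y - complex.Im c) ^+ 2)) +i* y))) = 0.
  move=> g0 y; have [h|h] := leP 0 (r ^+ 2 - (y - complex.Im c) ^+ 2).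
    have := end0 y 1 h (expr1n _ _); rewrite mul1r => ->.
    have s1 : (-1) ^+ 2 = 1 :> R by rewrite sqrrN expr1n.
    by have := end0 y (-1) h s1; rewrite mulN1r => ->; rewrite g0 subrr.
  by rewrite ltr0_sqrtr// addr0 subr0 subrr.
rewrite /area_integralC /area_integral -/(plane D).
rewrite (@fubini2_real _ _ (fun=> 0) dD.1 i1); last first.
  move=> y; rewrite gdisk_slice2//.
  have [c1 _] := pderive_continuous (dF' ^~ y).
  rewrite (slice_integral _ _ _ c1 (fun x => (dF x y).1)).
  by rewrite (zero (@complex.Re R)).
rewrite (@fubini2_real _ _ (fun=> 0) dD.1 i2); last first.
  move=> y; rewrite gdisk_slice2//.
  have [_ c1] := pderive_continuous (dF' ^~ y).
  rewrite (slice_integral _ _ _ c1 (fun x => (dF x y).2)).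
  by rewrite (zero (@complex.Im R)).
by rewrite Rintegral_cst// mul0r mulr0.
Qed.

Definition centered_monomial p q (z : C) : C := (z - c) ^+ p * (z - c)^* ^+ q.

Lemma regular_centered p q : regular (centered_monomial p q).
Proof.
have h : regular (fun z => z - c) by apply: regularD; [exact: regular_id|exact: regular_cst].
by apply: regularM; apply: regularX => //; exact: regular_conj.
Qed.

Let dz_y (x y : R) : pderive (fun y => x +i* y - c) y 'i%C.
Proof.
by case: c => c1 c2; split => /=; apply: is_derive_eq; rewrite ?oppr0 ?addr0 ?subr0.
Qed.
Let dzc_y (x y : R) : pderive (fun y => (x +i* y - c)^*) y (- 'i%C).
Proof.
by case: c => c1 c2; split => /=; apply: is_derive_eq; rewrite ?oppr0 ?addr0 ?subr0.
Qed.
Let dz_x (x y : R) : pderive (fun x => x +i* y - c) x 1.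
Proof.
by case: c => c1 c2; split => /=; apply: is_derive_eq; rewrite ?oppr0 ?addr0 ?subr0.
Qed.
Let dzc_x (x y : R) : pderive (fun x => (x +i* y - c)^*) x 1.
Proof.
by case: c => c1 c2; split => /=; apply: is_derive_eq; rewrite ?oppr0 ?addr0 ?subr0.
Qed.

(** The vertical derivative is [i] times the difference of the two Wirtinger derivatives, the
    horizontal one ([mono_x]) their sum. For [p = 0] or [q = 0] the truncated predecessor is
    harmless, as its coefficient is 0. *)
Let mono_y p q (x y : R) : pderive (fun y => centered_monomial p q (x +i* y)) y
  ('i%C * (p%:R * centered_monomial p.-1 q (x +i* y) + - (q%:R * centered_monomial p q.-1 (x +i* y)))).
Proof.
have := pderiveM (pderiveX p (dz_y x y)) (pderiveX q (dzc_y x y)).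
by congr pderive; rewrite /centered_monomial; ring.
Qed.

Let mono_x p q (x y : R) : pderive (fun x => centered_monomial p q (x +i* y)) x
  (p%:R * centered_monomial p.-1 q (x +i* y) + q%:R * centered_monomial p q.-1 (x +i* y)).
Proof.
have := pderiveM (pderiveX p (dz_x x y)) (pderiveX q (dzc_x x y)).
by congr pderive; rewrite /centered_monomial; ring.
Qed.

(* Vanishes on the boundary circle, so that its partial derivatives have zero
   integral: this yields the recurrences for the moments. *)
Let F p q z := (r ^+ 2)%:C * centered_monomial p q z + (-1) * centered_monomial p.+1 q.+1 z.

Let F_boundary p q z : normc (z - c) ^+ 2 = r ^+ 2 -> F p q z = 0.
Proof.
move=> h; have e : (z - c) * (z - c)^* = (r ^+ 2)%:C.
  by rewrite -h sqr_normcE; case: (z - c) => u v; apply/eqP; rewrite eq_complex/=; apply/andP;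
    split; apply/eqP; ring.
rewrite /F /centered_monomial -e !exprS; ring.
Qed.

Let mom p q := IC D (centered_monomial p q).

Let regular_lin2 (k1 k2 : C) f g : regular f -> regular g -> regular (fun z => k1 * f z + k2 * g z).
Proof. by move=> rf rg; apply: regularD; apply: regularM => //; exact: regular_cst. Qed.

Let IClin2 (k1 k2 : C) f g : regular f -> regular g ->
  IC D (fun z => k1 * f z + k2 * g z) = k1 * IC D f + k2 * IC D g.
Proof.
move=> rf rg; rewrite ICD ?ICZ//; apply: regularM => //; exact: regular_cst.
Qed.

Let mom_x p q : (r ^+ 2)%:C * (p%:R * mom p.-1 q + q%:R * mom p q.-1) =
  p.+1%:R * mom p q.+1 + q.+1%:R * mom p.+1 q.
Proof.
pose F' z := (r ^+ 2)%:C * (p%:R * centered_monomial p.-1 q z + q%:R * centered_monomial p q.-1 z) +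
   (-1) * (p.+1%:R * centered_monomial p q.+1 z + q.+1%:R * centered_monomial p.+1 q z).
have rm := regular_centered.
have e : IC D F' = 0.
  apply: (@IC_dx (F p q) F' (fun z => (r ^+ 2)%:C * (p%:R * (p.-1%:R * centered_monomial p.-1.-1 q
    z + q%:R * centered_monomial p.-1 q.-1 z)
     + q%:R * (p%:R * centered_monomial p.-1 q.-1 z + q.-1%:R * centered_monomial p q.-1.-1 z)) +
   (-1) * (p.+1%:R * (p%:R * centered_monomial p.-1 q.+1 z + q.+1%:R * centered_monomial p q z) +
     q.+1%:R * (p.+1%:R * centered_monomial p q z + q%:R * centered_monomial p.+1 q.-1 z)))).
  - by apply: regular_lin2; exact: regular_lin2.
  - move=> x y.
    have h1 := pderiveM (pderive_cst (r ^+ 2)%:C x) (mono_x p q x y).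
    have h2 := pderiveM (pderive_cst (-1) x) (mono_x p.+1 q.+1 x y).
    have := pderiveD h1 h2; congr pderive; rewrite /F'/=; ring.
  - move=> x y.
    have h k p q := pderiveM (pderive_cst k x) (mono_x p q x y).
    have h1 := pderiveM (pderive_cst (r ^+ 2)%:C x) (pderiveD (h p%:R p.-1 q) (h q%:R p q.-1)).
    have h2 := pderiveM (pderive_cst (-1) x) (pderiveD (h p.+1%:R p q.+1) (h q.+1%:R p.+1 q)).
    have := pderiveD h1 h2; congr pderive; rewrite /=; ring.
  - exact: F_boundary.
move: e; rewrite /F' !IClin2//; try exact: regular_lin2.
by rewrite mulN1r => /eqP; rewrite subr_eq0 => /eqP.
Qed.

Let mom_y p q : (r ^+ 2)%:C * (p%:R * mom p.-1 q - q%:R * mom p q.-1) =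
  p.+1%:R * mom p q.+1 - q.+1%:R * mom p.+1 q.
Proof.
pose F' z := (r ^+ 2)%:C * (('i%C * p%:R) * centered_monomial p.-1 q z + (- 'i%C * q%:R) *
  centered_monomial p q.-1 z) +
   (-1) * (('i%C * p.+1%:R) * centered_monomial p q.+1 z + (- 'i%C * q.+1%:R) * centered_monomial p.+1 q z).
have rm := regular_centered.
have e : IC D F' = 0.
  apply: (@IC_dy (F p q) F' (fun z => (r ^+ 2)%:C * (('i%C * p%:R) * ('i%C * (p.-1%:R *
    centered_monomial p.-1.-1 q z + - (q%:R * centered_monomial p.-1 q.-1 z)))
     + (- 'i%C * q%:R) * ('i%C * (p%:R * centered_monomial p.-1 q.-1 z + - (q.-1%:R *
       centered_monomial p q.-1.-1 z)))) +
   (-1) * (('i%C * p.+1%:R) * ('i%C * (p%:R * centered_monomial p.-1 q.+1 z + - (q.+1%:R *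
     centered_monomial p q z))) +
     (- 'i%C * q.+1%:R) * ('i%C * (p.+1%:R * centered_monomial p q z + - (q%:R * centered_monomial
       p.+1 q.-1 z)))))).
  - by apply: regular_lin2; exact: regular_lin2.
  - move=> x y.
    have h1 := pderiveM (pderive_cst (r ^+ 2)%:C y) (mono_y p q x y).
    have h2 := pderiveM (pderive_cst (-1) y) (mono_y p.+1 q.+1 x y).
    have := pderiveD h1 h2; congr pderive; rewrite /F'/=; ring.
  - move=> x y.
    have h k p q := pderiveM (pderive_cst k y) (mono_y p q x y).
    have h1 := pderiveM (pderive_cst (r ^+ 2)%:C y) (pderiveD (h ('i%C * p%:R) p.-1 q) (h (- 'i%C *
      q%:R) p q.-1)).
    have h2 := pderiveM (pderive_cst (-1) y) (pderiveD (h ('i%C * p.+1%:R) p q.+1) (h (- 'i%C *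
      q.+1%:R) p.+1 q)).
    have := pderiveD h1 h2; congr pderive; rewrite /=; ring.
  - exact: F_boundary.
move: e; rewrite /F' !IClin2//; try exact: regular_lin2.
have i0 : 'i%C != 0 :> C by rewrite eq_complex/= oner_eq0 andbF.
move=> e; apply: (mulfI i0); apply/eqP; rewrite -subr_eq0 -[X in _ == X]e.
by apply/eqP; rewrite /mom; ring.
Qed.

(** Half the sum of [mom_x] and [mom_y]: the derivative of [F p q] in [z] alone has integral 0. *)
Lemma moment_recurrence p q : p.+1%:R * mom p q.+1 = (r ^+ 2)%:C * (p%:R * mom p.-1 q).
Proof.
apply: (mulfI (_ : 2 != 0)); first by rewrite pnatr_eq0.
have h1 := mom_x p q; have h2 := mom_y p q.
transitivity ((r ^+ 2)%:C * (p%:R * mom p.-1 q + q%:R * mom p q.-1) +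
  (r ^+ 2)%:C * (p%:R * mom p.-1 q - q%:R * mom p q.-1)); last by ring.
by rewrite h1 h2; ring.
Qed.

Lemma moment_p0 p : mom p.+1 0 = 0.
Proof.
have h1 := mom_x p 0; have h2 := mom_y p 0.
apply: (mulfI (_ : 2 != 0)); first by rewrite pnatr_eq0.
rewrite mulr0; transitivity ((p.+1%:R * mom p 1 + 1%:R * mom p.+1 0) - (p.+1%:R * mom p 1 - 1%:R *
  mom p.+1 0)); first by ring.
by rewrite -h1 -h2; ring.
Qed.

(** The recurrence lowers both indices by one until one of them is 0; what is then left is either
    [mom 0 0] or zero. *)
Lemma moment p q : mom p q = (p == q)%:R * ((r ^+ 2)%:C ^+ p / p.+1%:R) * mom 0 0.
Proof.
elim: q p => [|q IH] [|p].
- by rewrite expr0 divr1 !mul1r.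
- by rewrite moment_p0 !mul0r.
- by have := moment_recurrence 0 q; rewrite !mul0r mulr0 mul1r.
- have p0 n : n.+1%:R != 0 :> C by rewrite pnatr_eq0.
  apply: (mulfI (p0 p.+1)); rewrite moment_recurrence /= IH eqSS.
  move: (mom 0 0) ((r ^+ 2)%:C) (p0 p) (p0 p.+1) => M t.
  move: (p.+1%:R) (p.+2%:R) => u v u0 v0.
  by rewrite exprS; field; rewrite u0 v0.
Qed.

End Moments.

End AreaIntegral.

(** * The extremal problem *)

Section Gram.
Context {R : realType}.
Local Notation mu := (@lebesgue_measure R).
Local Notation mu2 := (mu \x mu)%E.
Local Notation C := R[i].
Local Notation IC := area_integralC.
Implicit Types (D : set C) (f g : C -> C).

(** The integrand is the length of the vertical chord. Off the diameter the root of a negative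
    number is 0, so the line reduces to a segment, parametrized by [c1 + r sin t]. *)
Lemma Rintegral_halfcircle (c1 r : R) : 0 < r ->
  \int[mu]_x (2 * Num.sqrt (r ^+ 2 - (x - c1) ^+ 2)) = pi * r ^+ 2.
Proof.
move=> r0; set H := fun x : R => 2 * Num.sqrt (r ^+ 2 - (x - c1) ^+ 2).
have pi2 : 0 <= pi / 2 :> R by rewrite divr_ge0 ?pi_ge0.
have cH : continuous H.
  move=> x; apply: cvgM; first exact: cvg_cst.
  apply: (@continuous_comp _ _ _ (fun x : R => r ^+ 2 - (x - c1) ^+ 2) Num.sqrt); last exact: sqrt_continuous.
  apply: cvgB; first exact: cvg_cst.
  have c2 : continuous (fun x : R => x - c1) by move=> y; apply: cvgB; [exact: cvg_id|exact: cvg_cst].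
  exact: (@cont_exp _ _ 2 c2).
have -> : \int[mu]_x H x = \int[mu]_(x in `[c1 + r * sin (- (pi / 2)), c1 + r * sin (pi / 2)]) H x.
  rewrite sinN sin_pihalf mulrN !mulr1 [RHS]Rintegral_mkcond; apply: eq_Rintegral => x _.
  rewrite patchE; case: ifPn => //.
  rewrite notin_setE/= in_itv/= => /negP; rewrite negb_and -!ltNge => h.
  rewrite /H ltr0_sqrtr ?mulr0// subr_lt0 -(real_normK (num_real (x - c1))) ltr_pXn2r ?nnegrE ?(ltW r0)//.
  by rewrite lter_normr; move: h => /orP[] h; apply/orP; [right|left]; lra.
transitivity (\int[mu]_(t in `[- (pi / 2), pi / 2]) (H (c1 + r * sin t) * (r * cos t))).
  apply: (@Rintegral_substitution _ (fun t => c1 + r * sin t) (fun t => r * cos t)).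
  - lra.
  - move=> t _; apply: is_derive_eq; rewrite /GRing.scale/=; ring.
  - by move=> t _; apply: cvgM; [exact: cvg_cst|exact: continuous_cos].
  - by move=> t tb; rewrite mulr_gt0// cos_gt0_pihalf.
  - by move=> t _; exact: cH.
  - exact: continuous_subspaceT.
transitivity (\int[mu]_(t in `[- (pi / 2), pi / 2]) (2 * r ^+ 2 * cos t ^+ 2)).
  apply: eq_Rintegral => t; rewrite inE/= in_itv/= => tb.
  have c0 := cos_ge0_pihalf tb.
  have -> : H (c1 + r * sin t) = 2 * (r * cos t).
    rewrite /H; have -> : r ^+ 2 - (c1 + r * sin t - c1) ^+ 2 = (r * cos t) ^+ 2.
      by rewrite exprMn cos2sin2; ring.
    by rewrite sqrtr_sqr ger0_norm// mulr_ge0// ltW.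
  ring.
have dG t : - (pi / 2) <= t <= pi / 2 ->
    is_derive t 1 (fun t : R => r ^+ 2 * (t + sin t * cos t)) (2 * r ^+ 2 * cos t ^+ 2).
  move=> _; apply: is_derive_eq.
  have := cos2Dsin2 t; rewrite /GRing.scale/= !expr2 => e.
  have -> : sin t * - sin t = cos t * cos t - 1 by rewrite -e; ring.
  ring.
have cG : {within `[- (pi / 2), pi / 2], continuous (fun t : R => 2 * r ^+ 2 * cos t ^+ 2)}.
  apply: continuous_subspaceT => t; apply: cvgM; first exact: cvg_cst.
  exact: (@cont_exp _ _ 2 (@continuous_cos R)).
have pp : - (pi / 2) <= pi / 2 :> R by rewrite (le_trans _ pi2)// oppr_le0.
rewrite (Rintegral_derive pp dG cG).
rewrite sinN cosN cos_pihalf !mulr0 !addr0 -mulrBr opprK mulrC; congr (_ * _).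
by move: (pi : R) => p; field.
Qed.

Lemma IC_gdisk1 b (c : C) (r : R) : 0 < r -> domain (gdisk b c r) ->
  IC (gdisk b c r) (centered_monomial c 0 0) = (r ^+ 2)%:C.
Proof.
move=> r0 dD; have -> : centered_monomial c 0 0 = (fun z => (1 : R)%:C).
  by apply/funext => z; rewrite /centered_monomial !expr0 mulr1.
rewrite IC_real /area_integral -/(plane _).
have [i1 _] := regular_integrable dD (regular_cst (1 : R)%:C).
rewrite (@fubini1_real _ _ _ (fun x => 2 * Num.sqrt (r ^+ 2 - (x - complex.Re c) ^+ 2)) dD.1 i1).
  rewrite Rintegral_halfcircle//.
  by rewrite mulrA mulVf ?mul1r// gt_eqF// pi_gt0.
move=> x; rewrite gdisk_slice1// (@slice_integral _ _ _ _ id (fun=> 1)).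
- by congr (_%:E); ring.
- by move=> y; exact: cvg_cst.
Qed.

Lemma IC_gdisk_mono b (c : C) (r : R) p q : 0 < r -> domain (gdisk b c r) ->
  IC (gdisk b c r) (centered_monomial c p q) = (p == q)%:R * (r ^+ (2 * p.+1) / p.+1%:R)%:C.
Proof.
move=> r0 dD; rewrite moment// IC_gdisk1// -mulrA; congr (_ * _).
rewrite mulrAC -exprSr -(rmorphXn (real_complex R)) -exprM.
by rewrite (rmorphM (real_complex R)) (fmorphV (real_complex R)) (rmorph_nat (real_complex R)).
Qed.

Lemma IC_conj D f : domain D -> regular f -> IC D (fun z => (f z)^*) = (IC D f)^*.
Proof.
move=> dD rf; have [i1 i2] := regular_integrable dD rf.
rewrite /area_integralC /area_integral -/(plane _)/=.
have -> : \int[mu2]_(p in plane D) complex.Re (f (p.1 +i* p.2))^* =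
  \int[mu2]_(p in plane D) complex.Re (f (p.1 +i* p.2)).
  by apply: eq_Rintegral => p _; case: (f _).
have -> : \int[mu2]_(p in plane D) complex.Im (f (p.1 +i* p.2))^* =
  \int[mu2]_(p in plane D) (-1 * complex.Im (f (p.1 +i* p.2))).
  by apply: eq_Rintegral => p _; rewrite mulN1r; case: (f _).
by rewrite RintegralZl ?mulN1r ?mulrN//; exact: dD.1.
Qed.

Definition mixed n k (z : C) := z ^+ n * (z ^+ k)^*.

Lemma regular_mixed n k : regular (mixed n k).
Proof. by apply: regularM; [|apply: regular_conj]; apply: regularX; exact: regular_id. Qed.

(** Expand both powers around the centre; only equal centred powers survive. The sum may run to [n]
    because the binomial ['C(k, i)] is 0 for [i > k]. *)
Lemma IC_mixed b (c : C) (r : R) n k : 0 < r -> domain (gdisk b c r) ->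
  IC (gdisk b c r) (mixed n k) = \sum_(i < n.+1) ('C(n, i)%:R * 'C(k, i)%:R) *
    (c ^+ (n - i) * c^* ^+ (k - i)) * (r ^+ (2 * i.+1) / i.+1%:R)%:C.
Proof.
move=> r0 dD.
have -> : mixed n k = fun z => \sum_(i < n.+1) \sum_(l < k.+1)
    (c ^+ (n - i) * c^* ^+ (k - l) * ('C(n, i)%:R * 'C(k, l)%:R)) * centered_monomial c i l z.
  apply/funext => z; rewrite /mixed.
  transitivity ((c + (z - c)) ^+ n * (c^* + (z - c)^*) ^+ k).
    congr (_ * _); first by rewrite [in RHS]addrC subrK.
    by rewrite rmorphXn -rmorphD [in RHS]addrC subrK.
  rewrite !exprDn mulr_suml; apply: eq_bigr => i _.
  rewrite mulr_sumr; apply: eq_bigr => l _.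
  rewrite -(mulr_natr _ 'C(n, i)) -(mulr_natr _ 'C(k, l)) /centered_monomial; ring.
have rk (i l : nat) (w : C) : regular (fun z => w * centered_monomial c i l z).
  by apply: regularM; [exact: regular_cst|exact: regular_centered].
rewrite IC_sum//; last by move=> i; apply: regular_sum => l; exact: rk.
apply: eq_bigr => i _; rewrite IC_sum//.
have [ik|ik] := leqP i k; last first.
  rewrite big1 ?(bin_small ik) ?mulr0 ?mul0r// => l _.
  rewrite ICZ//; last exact: regular_centered.
  rewrite IC_gdisk_mono//; case: eqP => [e|_]; last by rewrite mul0r mulr0.
  by have := ltn_ord l; rewrite -e ltnS leqNgt ik.
rewrite (bigD1 (Ordinal (ik : (i < k.+1)%N)))//= big1 ?addr0; last first.
  move=> l li; rewrite ICZ//; last exact: regular_centered.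
  rewrite IC_gdisk_mono//; case: eqP => [e|_]; last by rewrite mul0r mulr0.
  by case/eqP: li; apply: val_inj => /=; rewrite e.
rewrite ICZ//; last exact: regular_centered.
by rewrite IC_gdisk_mono// eqxx mul1r; ring.
Qed.

Lemma IC_mixed0 b (r : R) n k : 0 < r -> domain (gdisk b 0 r) ->
  IC (gdisk b 0 r) (mixed n k) = (n == k)%:R * (r ^+ (2 * n.+1) / n.+1%:R)%:C.
Proof.
move=> r0 dD; rewrite -(@IC_gdisk_mono b 0)//; congr (IC _ _); apply/funext => z.
by rewrite /centered_monomial /mixed subr0 rmorphXn.
Qed.

Lemma normc_sum (I : Type) (s : seq I) (F : I -> C) :
  normc (\sum_(i <- s) F i) <= \sum_(i <- s) normc (F i).
Proof.
elim: s => [|i s IH]; first by rewrite !big_nil normc0.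
by rewrite !big_cons; apply: (le_trans (le_normcD _ _)); rewrite lerD2l.
Qed.

Lemma normcX (z : C) n : normc (z ^+ n) = normc z ^+ n.
Proof. by elim: n => [|n IH]; rewrite ?expr0 ?normc1// !exprS normcM IH. Qed.

Lemma normc_real (x : R) : 0 <= x -> normc x%:C = x.
Proof. by move=> x0; rewrite /= expr0n/= addr0 sqrtr_sqr ger0_norm. Qed.

Lemma normc_nat n : normc (n%:R : C) = n%:R.
Proof. by rewrite -(rmorph_nat (real_complex R)) normc_real. Qed.

(** Put [a = |c|] and [t = r^2 / (1 - a)], so that [r^(2i) = t^i (1 - a)^i]. The factor
    ['C(k, i) a^(k-i) (1 - a)^i] is one term of [(a + (1 - a))^k = 1], hence at most 1; the
    remaining factors are terms of [(a + t)^n]. The bound is thus uniform in [k]. *)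
Lemma IC_mixed_le b (c : C) (r : R) n k : 0 < r -> normc c + r < 1 -> (k <= n)%N ->
  domain (gdisk b c r) ->
  normc (IC (gdisk b c r) (mixed k n)) <= (normc c + r ^+ 2 / (1 - normc c)) ^+ n.
Proof.
move=> r0 cr kn dD; rewrite IC_mixed//; apply: (le_trans (normc_sum _ _)).
set a := normc c; have a0 : 0 <= a := normc_ge0 c.
have a1 : 0 < 1 - a by rewrite /a; lra.
have r2 : 0 <= r ^+ 2 by exact: sqr_ge0.
set t := r ^+ 2 / (1 - a); have t0 : 0 <= t by rewrite divr_ge0// ltW.
rewrite exprDn.
have -> : \sum_(i < n.+1) (a ^+ (n - i) * t ^+ i) *+ 'C(n, i) =
   \sum_(i < k.+1) ((a ^+ (n - i) * t ^+ i) *+ 'C(n, i)) +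
   \sum_(k.+1 <= i < n.+1) ((a ^+ (n - i) * t ^+ i) *+ 'C(n, i)).
  by rewrite -!(big_mkord predT (fun i => (a ^+ (n - i) * t ^+ i) *+ 'C(n, i))) -big_cat_nat.
rewrite -[leLHS]addr0; apply: lerD; last first.
  by rewrite sumr_ge0// => i _; rewrite mulrn_wge0// mulr_ge0// exprn_ge0.
apply: ler_sum => i _.
rewrite !normcM !normcX normc_conj !normc_nat normc_real; last by rewrite divr_ge0// exprn_ge0// ltW.
rewrite -/a -(mulr_natr _ 'C(n, i)).
have bk : 'C(k, i)%:R * a ^+ (k - i) * (1 - a) ^+ i <= 1 :> R.
  have : 'C(k, i)%:R * a ^+ (k - i) * (1 - a) ^+ i <= (a + (1 - a)) ^+ k.
    rewrite [leRHS]exprDn (bigD1 i)//=.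
    rewrite [X in _ <= X + _](_ : _ = 'C(k, i)%:R * a ^+ (k - i) * (1 - a) ^+ i); last first.
      by rewrite -mulr_natl mulrA.
    rewrite lerDl sumr_ge0// => j _.
    by rewrite mulrn_wge0// mulr_ge0// exprn_ge0// ltW.
  by rewrite [a + _]addrC subrK expr1n.
have rr : r ^+ (2 * i.+1) / i.+1%:R <= (r ^+ 2) ^+ i.
  have r1 : r <= 1 by rewrite ltW// (le_lt_trans _ cr)// lerDr.
  rewrite ler_pdivrMr// exprM exprS mulrC; apply: ler_wpM2l; first by rewrite exprn_ge0.
  apply: (@le_trans _ _ 1); last by rewrite ler1n.
  by apply: exprn_ile1 => //; exact: ltW.
have e : (r ^+ 2) ^+ i = t ^+ i * (1 - a) ^+ i by rewrite -exprMn divfK// gt_eqF.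
rewrite e in rr.
have w0 : 0 <= 'C(n, i)%:R * a ^+ (n - i) by rewrite mulr_ge0// exprn_ge0.
apply: (@le_trans _ _ (('C(n, i)%:R * a ^+ (n - i)) * ('C(k, i)%:R * a ^+ (k - i) * (t ^+ i * (1 -
  a) ^+ i)))).
  rewrite [leLHS](_ : _ = ('C(n, i)%:R * a ^+ (n - i)) * ('C(k, i)%:R * a ^+ (k - i) * (r ^+ (2 *
    i.+1) / i.+1%:R))); last by ring.
  by do 2!rewrite ler_wpM2l ?mulr_ge0 ?exprn_ge0//.
rewrite [leLHS](_ : _ = ('C(n, i)%:R * a ^+ (n - i) * t ^+ i) * ('C(k, i)%:R * a ^+ (k - i) * (1 -
  a) ^+ i)); last by ring.
rewrite [leRHS](_ : _ = 'C(n, i)%:R * a ^+ (n - i) * t ^+ i); last by ring.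
by rewrite ler_piMr// mulr_ge0// exprn_ge0.
Qed.

Lemma mulcJ (z : C) : z * z^* = (normc z ^+ 2)%:C.
Proof.
rewrite sqr_normcE; case: z => u v; apply/eqP; rewrite eq_complex/=.
by apply/andP; split; apply/eqP; ring.
Qed.

(** The denominators [i + 1] are absorbed by [(n+1) 'C(n, i) = (i+1) 'C(n+1, i+1)]. *)
Lemma IC_mixed_diag b (c : C) (r : R) n : 0 < r -> domain (gdisk b c r) ->
  n.+1%:R * IC (gdisk b c r) (mixed n n) = (disk_sum (normc c) r n)%:C.
Proof.
move=> r0 dD; rewrite IC_mixed// /disk_sum (rmorph_sum (real_complex R)) mulr_sumr.
apply: eq_bigr => i _.
have cc : c ^+ (n - i) * c^* ^+ (n - i) = (normc c ^+ (2 * (n - i)))%:C.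
  rewrite -exprMn exprM (rmorphXn (real_complex R)); congr (_ ^+ _).
  exact: mulcJ.
have i0 : i.+1%:R != 0 :> R by rewrite pnatr_eq0.
have bd : n.+1%:R * 'C(n, i)%:R = i.+1%:R * 'C(n.+1, i.+1)%:R :> R.
  by rewrite -!natrM mul_bin_diag.
rewrite cc -!(rmorph_nat (real_complex R)) -!(rmorphM (real_complex R)).
congr (_%:C).
transitivity ('C(n, i)%:R * (n.+1%:R * 'C(n, i)%:R) / i.+1%:R * (normc c ^+ (2 * (n - i)) * r ^+ (2 * i.+1))).
  by ring.
by rewrite bd; move: (i.+1%:R) i0 => u u0; field.
Qed.

(** * The domain with its holes, and the two radii that govern decay *)

Section CMCD.
Variables (s : nat) (c : 'I_s -> C) (r : 'I_s -> R).
Hypothesis hD : is_CMCD c r.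
Let D := CMCD c r.

(** Test the inclusion in the open unit disk at the point of the closed hole farthest from the
    origin. *)
Lemma CMCD_bound j : normc (c j) + r j < 1.
Proof.
case: hD => _ r0 sub _.
have [c0|c0] := eqVneq (c j) 0.
  rewrite c0 normc0 add0r; have := sub j (r j)%:C; rewrite /closed_disk /disk c0/mkset !subr0.
  by rewrite normc_real ?(ltW (r0 j))//; apply.
have n0 : 0 < normc (c j).
  by rewrite lt_neqAle normc_ge0 andbT eq_sym; apply: contra c0 => /eqP/eq0_normc ->.
pose z := ((normc (c j) + r j) / normc (c j))%:C * c j.
have := sub j z; rewrite /closed_disk /disk/= subr0.
have -> : z - c j = (r j / normc (c j))%:C * c j.
  rewrite /z -[X in _ - X]mul1r -mulrBl -(rmorph1 (real_complex R)) -(rmorphB (real_complex R)).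
  by congr (_%:C * _); field; rewrite gt_eqF.
rewrite /z !normcM !normc_real ?divr_ge0 ?addr_ge0 ?(ltW n0) ?(ltW (r0 j))// !divfK ?gt_eqF//.
by apply.
Qed.

Let r_gt0 j : 0 < r j. Proof. by case: hD. Qed.

Lemma domain_disk01 : domain (gdisk false 0 1 : set C).
Proof.
split; first by apply: gdisk_measurable.
by move=> z; rewrite /gdisk /disk/= subr0 => /ltW.
Qed.

Lemma domain_hole j : domain (gdisk true (c j) (r j)).
Proof.
split; first by apply: gdisk_measurable.
case: hD => _ _ sub _ z /(sub j); rewrite /disk/= subr0; exact: ltW.
Qed.

Let domain_holes : domain (\bigcup_(j : 'I_s) closed_disk (c j) (r j)).
Proof. by apply: domain_bigcup => j; exact: domain_hole. Qed.

Lemma domain_CMCD : domain D.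
Proof. exact: domain_setD domain_disk01 domain_holes. Qed.

Let holes_sub : \bigcup_(j : 'I_s) closed_disk (c j) (r j) `<=` gdisk false 0 1.
Proof. by case: hD => _ _ sub _ z [j _ /(sub j)]. Qed.

Lemma IC_CMCD f : regular f ->
  IC D f = IC (gdisk false 0 1) f - \sum_j IC (gdisk true (c j) (r j)) f.
Proof.
move=> rf; rewrite /D /CMCD (IC_setD domain_disk01 domain_holes rf holes_sub).
by rewrite (@IC_bigcup _ _ (fun j => gdisk true (c j) (r j)) f domain_hole rf)//; case: hD.
Qed.

(** The inverse of [rho_x]. *)
Definition outer_radius : R := \big[Num.max/0]_(j < s) (normc (c j) + r j).

Lemma outer_radius_ge j : normc (c j) + r j <= outer_radius.
Proof. by rewrite /outer_radius; apply: le_bigmax. Qed.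

Lemma outer_radius_gt0 : 0 < outer_radius.
Proof.
case: hD => s0 r0 _ _; have := outer_radius_ge (Ordinal s0); apply: lt_le_trans.
by rewrite ltr_wpDl// normc_ge0.
Qed.

Lemma outer_radius_lt1 : outer_radius < 1.
Proof. by apply/bigmax_ltP; split => // j _; exact: CMCD_bound. Qed.

(* The decay rate of the mixed moments in [IC_mixed_le]; it is below
   [outer_radius] because [|c| + r < 1]. *)
Definition inner_radius : R := \big[Num.max/0]_(j < s) (normc (c j) + r j ^+ 2 / (1 - normc (c j))).

Lemma inner_radius_ge j : normc (c j) + r j ^+ 2 / (1 - normc (c j)) <= inner_radius.
Proof. by rewrite /inner_radius; apply: le_bigmax. Qed.

Lemma inner_radius_bound : 0 <= inner_radius < outer_radius.
Proof.
rewrite /inner_radius; apply/andP; split; first exact: bigmax_ge_id.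
apply/bigmax_ltP; split => [|j _]; first exact: outer_radius_gt0.
apply: lt_le_trans (outer_radius_ge j); rewrite ltrD2l.
have := CMCD_bound j; have := r_gt0 j => r0 cr.
rewrite ltr_pdivrMr; last by lra.
by rewrite expr2 ltr_pM2l//; lra.
Qed.

(** * The orthogonal polynomial compared with [z^n] *)

Section Extremal.
Variables (P : {poly C}) (n : nat).
Hypothesis hP : is_monic_orthogonal D n P.

Let q k := P`_k.
Let Q z := \sum_(k < n) q k * z ^+ k.
Let Pf z := P.[z].
Let Z z : C := z ^+ n.

Let PE z : Pf z = Z z + Q z.
Proof.
case: hP => mP sP _; rewrite /Pf /Q horner_coef sP big_ord_recr/= addrC; congr (_ + _).
by move/monicP: mP; rewrite lead_coefE sP/= => ->; rewrite mul1r.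
Qed.

Let rQ : regular Q.
Proof.
apply: regular_sum => k; apply: regularM; first exact: regular_cst.
by apply: regularX; exact: regular_id.
Qed.
Let rZ : regular Z. Proof. by apply: regularX; exact: regular_id. Qed.
Let rP : regular Pf. Proof. exact: regular_horner. Qed.
Let dD := domain_CMCD.
Let rc f g : regular f -> regular g -> regular (fun z => f z * (g z)^*).
Proof. by move=> rf rg; apply: regularM => //; exact: regular_conj. Qed.

Let QcE f E : domain E -> regular f ->
  IC E (fun z => f z * (Q z)^*) = \sum_(k < n) (q k)^* * IC E (fun z => f z * (z ^+ k)^*).
Proof.
move=> dE rf.
have rk k : regular (fun z => f z * (z ^+ k)^*).
  by apply: rc => //; apply: regularX; exact: regular_id.
have -> : (fun z => f z * (Q z)^*) = (fun z => \sum_(k < n) (q k)^* * (f z * (z ^+ k)^*)).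
  apply/funext => z; rewrite /Q rmorph_sum mulr_sumr; apply: eq_bigr => k _.
  by rewrite rmorphM /=; ring.
rewrite IC_sum//; first by apply: eq_bigr => k _; rewrite ICZ.
by move=> k; apply: regularM => //; exact: regular_cst.
Qed.

Let QE f E : domain E -> regular f ->
  IC E (fun z => Q z * (f z)^*) = \sum_(k < n) q k * IC E (fun z => z ^+ k * (f z)^*).
Proof.
move=> dE rf.
have rk k : regular (fun z => z ^+ k * (f z)^*).
  by apply: rc => //; apply: regularX; exact: regular_id.
have -> : (fun z => Q z * (f z)^*) = (fun z => \sum_(k < n) q k * (z ^+ k * (f z)^*)).
  apply/funext => z; rewrite /Q mulr_suml; apply: eq_bigr => k _.
  by rewrite mulrA.
rewrite IC_sum//; first by apply: eq_bigr => k _; rewrite ICZ.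
by move=> k; apply: regularM => //; exact: regular_cst.
Qed.

Let PQ0 : IC D (fun z => Pf z * (Q z)^*) = 0.
Proof.
case: hP => _ _ oP; rewrite QcE//; apply: big1 => k _.
by rewrite /Pf oP ?mulr0.
Qed.

Let QP0 : IC D (fun z => Q z * (Pf z)^*) = 0.
Proof.
have := IC_conj dD (rc rP rQ); rewrite PQ0 rmorph0 => <-.
by congr (IC _ _); apply/funext => z; rewrite rmorphM/= conjcK mulrC.
Qed.

Let B := area_integral D (fun z => normc (Q z) ^+ 2).

Let QQE E : IC E (fun z => Q z * (Q z)^*) = (area_integral E (fun z => normc (Q z) ^+ 2))%:C.
Proof.
by rewrite -IC_real; congr (IC _ _); apply/funext => z; rewrite mulcJ.
Qed.

(** [Q] has degree below [n], hence is orthogonal to [P = Z + Q]. *)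
Let QZB : IC D (fun z => Q z * (Z z)^*) = - B%:C.
Proof.
apply/eqP; rewrite -addr_eq0 -QQE -ICD//; [|exact: rc..].
rewrite -QP0; apply/eqP; congr (IC _ _); apply/funext => z.
by rewrite PE rmorphD mulrDr.
Qed.

(** Pythagoras for [Z = P - Q], whose two terms are orthogonal. *)
Let norm_PE : (area_integral D (fun z => normc (Pf z) ^+ 2))%:C = IC D (mixed n n) - B%:C.
Proof.
rewrite -QZB -ICD; [|exact: dD|exact: rc|exact: rc].
rewrite -IC_real -[RHS]addr0 -PQ0 -ICD; [|exact: dD| |exact: rc]; last first.
  by apply: regularD; exact: rc.
congr (IC _ _); apply/funext => z; rewrite -mulcJ /mixed -/(Z z) PE !rmorphD; ring.
Qed.

Let disk_mixed j k : IC (gdisk false 0 1) (mixed j k) = (j == k)%:R * (j.+1%:R^-1)%:C.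
Proof. by rewrite IC_mixed0// ?expr1n ?div1r//; exact: domain_disk01. Qed.

Lemma norm_monic_orthogonal : n.+1%:R * area_integral D (fun z => normc P.[z] ^+ 2) =
  1 - \sum_j disk_sum (normc (c j)) (r j) n - n.+1%:R * B.
Proof.
have key (u v S : R) (M : C) : u%:C = M - v%:C -> n.+1%:R * M = 1 - S%:C ->
    n.+1%:R * u = 1 - S - n.+1%:R * v.
  move=> h1 h2; apply: (@complexI R).
  rewrite !(rmorphB (real_complex R)) !(rmorphM (real_complex R)) (rmorph_nat (real_complex R))
    (rmorph1 (real_complex R)) /=.
  by rewrite h1 mulrBr h2.
apply: key norm_PE _.
rewrite IC_CMCD ?disk_mixed; last exact: regular_mixed.
rewrite mulrBr eqxx mul1r; congr (_ - _).
  by rewrite (fmorphV (real_complex R)) (rmorph_nat (real_complex R)) mulfV ?pnatr_eq0.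
rewrite mulr_sumr (rmorph_sum (real_complex R)); apply: eq_bigr => j _.
by rewrite IC_mixed_diag//; exact: domain_hole.
Qed.

Let t := inner_radius.
Let rho := outer_radius.

(** By [QZB], [B] is a pairing of [Q] with [z^n]. On the unit disk this pairing is 0, so only the
    mixed moments of the holes contribute. *)
Let B_le : B <= \sum_(j < s) \sum_(k < n) normc (q k) * t ^+ n.
Proof.
have B0 : 0 <= B.
  by apply: mulr_ge0; [rewrite invr_ge0 pi_ge0|apply: Rintegral_ge0 => p _; exact: sqr_ge0].
rewrite -(normc_real B0) -normcN -QZB IC_CMCD; last exact: rc.
rewrite QE//; last exact: domain_disk01.
rewrite big1 ?sub0r ?normcN; last first.
  move=> k _.
  have := disk_mixed k n; rewrite /mixed /Z => ->.
  by rewrite (ltn_eqF (ltn_ord k)) mul0r mulr0.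
apply: (le_trans (normc_sum _ _)); apply: ler_sum => j _.
rewrite QE//; last exact: domain_hole.
apply: (le_trans (normc_sum _ _)); apply: ler_sum => k _.
rewrite normcM ler_wpM2l ?normc_ge0//.
apply: (le_trans (@IC_mixed_le true (c j) (r j) n k _ _ _ _)) => //.
- exact: CMCD_bound.
- exact: ltnW.
- exact: domain_hole.
rewrite lerXn2r ?nnegrE ?inner_radius_ge//.
  rewrite addr_ge0 ?normc_ge0// divr_ge0 ?sqr_ge0// subr_ge0.
  by have := CMCD_bound j; have := r_gt0 j; lra.
by case/andP: inner_radius_bound.
Qed.

Let domain_cd : domain (gdisk true 0 rho : set C).
Proof.
split; first by apply: gdisk_measurable; exact: outer_radius_gt0.
move=> z; rewrite /gdisk /closed_disk/= subr0 => /le_trans; apply.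
by apply: ltW; exact: outer_radius_lt1.
Qed.

Let holes_cd : \bigcup_(j : 'I_s) closed_disk (c j) (r j) `<=` gdisk true 0 rho.
Proof.
move=> z [j _]; rewrite /gdisk /closed_disk/= subr0 => h.
apply: le_trans (outer_radius_ge j); rewrite -[z](subrK (c j)).
by rewrite [leRHS]addrC; apply: (le_trans (le_normcD _ _)); rewrite lerD2r.
Qed.

(** [D] contains the annulus between [rho] and 1. Monomials are orthogonal there, so the integral of
    [|Q|^2] over it is diagonal in the coefficients. *)
Let B_ge : \sum_(k < n) normc (q k) ^+ 2 * ((1 - rho ^+ (2 * k.+1)) / k.+1%:R) <= B.
Proof.
have rQQ := rc rQ rQ.
have e1 : B%:C = IC (gdisk false 0 1) (fun z => Q z * (Q z)^*) -
    IC (\bigcup_(j : 'I_s) closed_disk (c j) (r j)) (fun z => Q z * (Q z)^*).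
  by rewrite -QQE /D /CMCD (IC_setD domain_disk01 domain_holes rQQ holes_sub).
have e2 := IC_setD domain_cd domain_holes rQQ holes_cd.
rewrite QQE in e2; set B' := area_integral _ _ in e2.
have B'0 : 0 <= B'.
  by apply: mulr_ge0; [rewrite invr_ge0 pi_ge0|apply: Rintegral_ge0 => p _; exact: sqr_ge0].
suff e3 : IC (gdisk false 0 1) (fun z => Q z * (Q z)^*) -
   IC (gdisk true 0 rho) (fun z => Q z * (Q z)^*) =
   (\sum_(k < n) normc (q k) ^+ 2 * ((1 - rho ^+ (2 * k.+1)) / k.+1%:R))%:C.
  rewrite -lecR -e3 e1 -subr_ge0.
  have := B'0; rewrite -lecR e2; congr (_ <= _); ring.
have dg E x b : E = gdisk b 0 x -> 0 < x -> domain E ->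
  IC E (fun z => Q z * (Q z)^*) = (\sum_(k < n) normc (q k) ^+ 2 * (x ^+ (2 * k.+1) / k.+1%:R))%:C.
  move=> -> x0 dE; rewrite QE// (rmorph_sum (real_complex R)); apply: eq_bigr => k _.
  rewrite QcE//; last by apply: regularX; exact: regular_id.
  rewrite (bigD1 k)//= big1 ?addr0; last first.
    move=> l lk; have := @IC_mixed0 b x k l x0 dE; rewrite /mixed => ->.
    by rewrite eq_sym in lk; move: lk; rewrite -val_eqE => /negPf ->; rewrite mul0r mulr0.
  have := @IC_mixed0 b x k k x0 dE; rewrite /mixed => ->.
  by rewrite eqxx mul1r mulrA mulcJ -(rmorphM (real_complex R)).
rewrite (dg _ 1 false erefl)//; last exact: domain_disk01.
rewrite (dg _ rho true erefl)//; last exact: outer_radius_gt0.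
rewrite -(rmorphB (real_complex R)) -sumrB; congr (_%:C); apply: eq_bigr => k _.
by rewrite expr1n; ring.
Qed.

Let B_ge0 : 0 <= B.
Proof.
by apply: mulr_ge0; [rewrite invr_ge0 pi_ge0|apply: Rintegral_ge0 => p _; exact: sqr_ge0].
Qed.

Let rho2 : 0 < 1 - rho ^+ 2.
Proof.
rewrite subr_gt0 exprn_ilt1//; [exact: ltW outer_radius_gt0|exact: outer_radius_lt1].
Qed.

Let q_le (k : 'I_n) : normc (q k) <= Num.sqrt (n%:R / (1 - rho ^+ 2)) * Num.sqrt B.
Proof.
have rho0 := outer_radius_gt0; have rho1 := outer_radius_lt1.
have term (i : 'I_n) : 0 <= normc (q i) ^+ 2 * ((1 - rho ^+ (2 * i.+1)) / i.+1%:R).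
  rewrite mulr_ge0 ?sqr_ge0// divr_ge0// subr_ge0 exprn_ile1//; exact: ltW.
have h : normc (q k) ^+ 2 * ((1 - rho ^+ (2 * k.+1)) / k.+1%:R) <= B.
  by apply: le_trans B_ge; rewrite (bigD1 k)//= lerDl sumr_ge0.
rewrite -sqrtrM; last by rewrite divr_ge0// ltW.
rewrite -[leLHS]ger0_norm ?normc_ge0// -sqrtr_sqr ler_wsqrtr//.
rewrite mulrAC ler_pdivlMr//.
have h2 : normc (q k) ^+ 2 * (1 - rho ^+ (2 * k.+1)) <= k.+1%:R * B.
  have -> : normc (q k) ^+ 2 * (1 - rho ^+ (2 * k.+1)) =
      k.+1%:R * (normc (q k) ^+ 2 * ((1 - rho ^+ (2 * k.+1)) / k.+1%:R)).
    have : k.+1%:R != 0 :> R by rewrite pnatr_eq0.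
    by move: (k.+1%:R) => u u0; field.
  by rewrite ler_wpM2l.
apply: (@le_trans _ _ (k.+1%:R * B)); last by rewrite ler_wpM2r// ler_nat.
apply: le_trans h2; rewrite ler_wpM2l ?sqr_ge0// lerD2l lerN2.
by rewrite exprM exprS ler_piMr ?sqr_ge0// exprn_ile1 ?sqr_ge0// exprn_ile1// ltW.
Qed.

(** Inserting [q_le] into [B_le] bounds [B] by [K] times its own square root, so [B <= K^2]. *)
Lemma error_bound : B <= s%:R ^+ 2 * n%:R ^+ 3 / (1 - rho ^+ 2) * t ^+ (2 * n).
Proof.
have t0 : 0 <= t by case/andP: inner_radius_bound.
pose K := s%:R * n%:R * t ^+ n * Num.sqrt (n%:R / (1 - rho ^+ 2)).
have K0 : 0 <= K by rewrite !mulr_ge0// ?exprn_ge0// sqrtr_ge0.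
have h : B <= K * Num.sqrt B.
  apply: (le_trans B_le).
  apply: (@le_trans _ _ (\sum_(j < s) \sum_(k < n) (Num.sqrt (n%:R / (1 - rho ^+ 2)) * Num.sqrt B) * t ^+ n)).
    by apply: ler_sum => j _; apply: ler_sum => k _; rewrite ler_wpM2r ?exprn_ge0 ?q_le.
  rewrite !sumr_const !card_ord /K; move: (Num.sqrt (n%:R / (1 - rho ^+ 2))) => u.
  rewrite -(mulr_natl _ n) -(mulr_natl _ s).
  by rewrite le_eqVlt; apply/orP; left; apply/eqP; ring.
have h' : Num.sqrt B <= K.
  have [B0|Bp] := leP B 0; first by rewrite (ler0_sqrtr B0).
  by move: h; rewrite -{1}(sqr_sqrtr B_ge0) expr2 ler_pM2r// sqrtr_gt0.
rewrite -(sqr_sqrtr B_ge0).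
apply: (@le_trans _ _ (K ^+ 2)); first by rewrite lerXn2r ?nnegrE// sqrtr_ge0.
rewrite /K !exprMn sqr_sqrtr; last by rewrite divr_ge0// ltW.
by rewrite le_eqVlt; apply/orP; left; apply/eqP; rewrite -exprM mulnC; ring.
Qed.

Lemma norm_defect_bound :
  `|n.+1%:R * area_integral D (fun z => normc P.[z] ^+ 2) -
    (1 - \sum_j disk_sum (normc (c j)) (r j) n)| <=
  s%:R ^+ 2 / (1 - outer_radius ^+ 2) * (n.+1%:R ^+ 4 * inner_radius ^+ (2 * n)).
Proof.
have t0 : 0 <= inner_radius by case/andP: inner_radius_bound.
rewrite norm_monic_orthogonal addrAC subrr sub0r normrN.
rewrite ger0_norm; last by apply: mulr_ge0.
apply: (@le_trans _ _ (n.+1%:R * (s%:R ^+ 2 * n%:R ^+ 3 / (1 - rho ^+ 2) * t ^+ (2 * n)))).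
  by apply: ler_wpM2l => //; exact: error_bound.
rewrite /t /rho.
rewrite [leLHS](_ : _ = s%:R ^+ 2 / (1 - outer_radius ^+ 2) * (n.+1%:R * n%:R ^+ 3 * inner_radius
  ^+ (2 * n))); last by ring.
apply: ler_wpM2l; first by rewrite divr_ge0 ?sqr_ge0// ltW.
apply: ler_wpM2r; first by rewrite exprn_ge0.
by rewrite [leRHS]exprS ler_wpM2l// lerXn2r ?nnegrE// ler_nat.
Qed.

End Extremal.
End CMCD.

End Gram.

(** * The expansion *)

Section Coefs.
Context {R : realType}.
Local Notation C := R[i].

Lemma F0_inv (beta w : R) : beta != 0 -> 0 < beta ^+ 2 - 1 - w ->
  F0 beta^-1 w = (beta - 1 - w) / beta * (`|beta| / Num.sqrt (beta ^+ 2 - 1 - w)).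
Proof.
move=> beta0 dd; rewrite /F0.
have -> : 1 - beta^-1 ^+ 2 - w * beta^-1 ^+ 2 = (beta ^+ 2 - 1 - w) / beta ^+ 2 by field.
rewrite sqrtrM ?(ltW dd)// sqrtrV ?sqr_ge0// sqrtr_sqr.
have sd : Num.sqrt (beta ^+ 2 - 1 - w) != 0 by rewrite gt_eqF// sqrtr_gt0.
have n0 : `|beta| != 0 by rewrite normr_eq0.
move: (Num.sqrt (beta ^+ 2 - 1 - w)) (`|beta|) sd n0 => S N S0 N0.
by field; rewrite beta0 S0 N0.
Qed.

(** Everything at [z = 0] depends only on [y / x], which is the real number [beta = 1 / b]; the case
    [r = |c|] corresponds to [b = 0] and gives -1 on both sides. *)
Lemma Rfun_at0 (c : C) (r w : R) : c != 0 -> 0 < r -> 0 <= w ->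
  let b := (normc c - r) / (normc c + r) in
  0 < 1 - b ^+ 2 - w * b ^+ 2 -> Rfun c r w%:C 0 = - (F0 b w)%:C.
Proof.
move=> c0 r0 w0 b d0.
set a := normc c in b d0 *.
have a0 : 0 < a.
  by rewrite lt_neqAle normc_ge0 andbT eq_sym; apply: contra c0 => /eqP/eq0_normc ->.
have aC : a%:C != 0 :> C by rewrite -(rmorph0 (real_complex R)) (inj_eq (@complexI R)) gt_eqF.
have arC : (a + r)%:C != 0 :> C by rewrite -(rmorph0 (real_complex R)) (inj_eq (@complexI R))
  gt_eqF// addr_gt0.
have w1 : 1 + w%:C != 0 :> C.
  by rewrite -(rmorph1 (real_complex R)) -(rmorphD (real_complex R)) -(rmorph0 (real_complex R))
    (inj_eq (@complexI R)) gt_eqF// ltr_wpDr.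
rewrite /Rfun !mul0r !mulr0 !mul0r -/a; case: eqP => [e|/eqP ne].
  have b0 : b = 0 by rewrite /b e subrr mul0r.
  have -> : F0 b w = 1 by rewrite /F0 b0 expr0n/= !mulr0 !subr0 sqrtr1 divr1.
  by rewrite !subr0 addr0 mulr1 expr1n divff.
have amr : a - r != 0 by rewrite subr_eq0 eq_sym.
have amrC : (a - r)%:C != 0 :> C by rewrite -(rmorph0 (real_complex R)) (inj_eq (@complexI R)).
set beta := (a + r) / (a - r).
have bE : b = beta^-1 by rewrite /b /beta invf_div.
have beta0 : beta != 0 by rewrite mulf_neq0 ?invr_eq0// gt_eqF// addr_gt0.
have yE : ypt c r = xpt c r * beta%:C.
  rewrite /ypt /xpt -/a /beta (rmorphM (real_complex R)) (fmorphV (real_complex R)) /=.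
  by rewrite mulrA divfK.
have x0 : xpt c r != 0 by rewrite /xpt -/a !mulf_neq0 ?invr_eq0.
have yx : ypt c r / xpt c r = beta%:C by rewrite yE mulrC mulKf.
have beta1 : beta - 1 != 0.
  rewrite subr_eq0 /beta; apply/eqP => h; have := r0.
  have : a + r = a - r by rewrite -[RHS]mul1r -h divfK.
  by move=> h2 h3; lra.
have dd : 0 < beta ^+ 2 - 1 - w.
  have -> : beta ^+ 2 - 1 - w = (1 - b ^+ 2 - w * b ^+ 2) * beta ^+ 2 by rewrite bE; field.
  by rewrite mulr_gt0// exprn_even_gt0.
rewrite yx.
(* With [y = beta x] the numerator is [(1 + w)(beta - 1 - w) / (beta - 1)], and [1 + w] cancels
   against the denominator. *)
have num : (1 - 0 + w%:C * ((ypt c r - 2 * xpt c r) / (ypt c r - xpt c r) + 0) -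
      xpt c r * w%:C ^+ 2 / (ypt c r - xpt c r)) / ((1 - 0) ^+ 2 + w%:C * (1 - 0)) =
   ((beta - 1 - w) / (beta - 1))%:C.
  have b1C : beta%:C - 1 != 0 :> C.
    by rewrite -(rmorph1 (real_complex R)) -(rmorphB (real_complex R)) -(rmorph0 (real_complex R))
      (inj_eq (@complexI R)).
  rewrite (rmorphM (real_complex R)) (fmorphV (real_complex R)) !(rmorphB (real_complex R))
    (rmorph1 (real_complex R)) /= yE.
  have -> : xpt c r * beta%:C - xpt c r = xpt c r * (beta%:C - 1) by ring.
  by field; rewrite x0 b1C w1.
rewrite num.
have sq : sqrtc (beta%:C ^+ 2 - 1 - w%:C) = (Num.sqrt (beta ^+ 2 - 1 - w))%:C.
  have -> : beta%:C ^+ 2 - 1 - w%:C = (beta ^+ 2 - 1 - w)%:C.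
    by rewrite !(rmorphB (real_complex R)) (rmorphXn (real_complex R)) (rmorph1 (real_complex R)).
  by rewrite sqrtc_sqrtr//= lecR ltW.
rewrite sq.
have F0E : F0 b w = (beta - 1 - w) / beta * (`|beta| / Num.sqrt (beta ^+ 2 - 1 - w)).
  by rewrite bE F0_inv.
have sd : Num.sqrt (beta ^+ 2 - 1 - w) != 0 by rewrite gt_eqF// sqrtr_gt0.
(* [epsilon] is minus the sign of [beta], which accounts both for the quotient of [|beta|] by [beta]
   in [F0] and for the minus sign in the claim. *)
rewrite F0E /epsilon -/a; have [ar|ar] := leP a r.
  have bn : beta < 0.
    rewrite /beta pmulr_rlt0 ?addr_gt0// invr_lt0 subr_lt0 lt_neqAle ar andbT.
    by rewrite eq_sym.
  rewrite ltr0_norm// mul1r -(rmorph1 (real_complex R)) -!(rmorphB (real_complex R)) -!(fmorphV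
    (real_complex R)) -!(rmorphM (real_complex R)) -!(rmorphN (real_complex R)) /=.
  by congr (_%:C); field; rewrite beta0 sd beta1.
have bp : 0 < beta by apply: divr_gt0; [exact: addr_gt0|rewrite subr_gt0].
rewrite gtr0_norm// mulN1r !mulNr -(rmorph1 (real_complex R)) -!(rmorphB (real_complex R))
  -!(fmorphV (real_complex R)) -!(rmorphM (real_complex R)) /=.
by congr (- _%:C); field; rewrite beta0 sd beta1.
Qed.

Lemma normc_cvg (u : nat -> C) (l : C) : (u : nat -> C^o) @ \oo --> (l : C^o) ->
  forall e : R, 0 < e -> \forall n \near \oo, normc (l - u n) < e.
Proof.
move=> ul e e0.
have eC : 0 < e%:C :> C by rewrite -(rmorph0 (real_complex R)) ltcR.
move/cvgrPdist_lt : ul => /(_ _ eC).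
by apply: filterS => n; rewrite -[`|_|]/((normc _)%:C) ltcR.
Qed.

(** Convergence at [w1] bounds the terms there by some [M]. For [w <= w1 / 2] the tail is then
    dominated by a geometric series of ratio at most 1/2, which costs the factor 2; the limit is
    reached through partial sums within an arbitrary [e]. *)
Lemma power_series_tail (a : nat -> C) (w1 : R) (F : R -> C) : 0 < w1 ->
  (forall w, 0 <= w <= w1 -> (series (fun k => a k * w%:C ^+ k) : nat -> C^o) @ \oo --> (F w : C^o)) ->
  forall m, exists2 K : R, 0 <= K & forall w, 0 <= w <= w1 / 2 ->
    normc (F w - \sum_(k < m.+1) a k * w%:C ^+ k) <= K * w ^+ m.+1.
Proof.
move=> w10 hF m.
have w11 : 0 <= w1 <= w1 by rewrite lexx ltW.
have [M M0 hM] : exists2 M : R, 0 <= M & forall k, normc (a k) * w1 ^+ k <= M.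
  have [N _ hN] := normc_cvg (hF _ w11) ltr01.
  (* From index [N] on, a term is the difference of two partial sums, each within 1 of the limit. *)
  exists (2 + \sum_(k < N) normc (a k) * w1 ^+ k).
    by rewrite addr_ge0// sumr_ge0// => k _; rewrite mulr_ge0 ?normc_ge0// exprn_ge0 ?(ltW w10).
  move=> k; have [kN|kN] := ltnP k N.
    rewrite (bigD1 (Ordinal kN))//= addrCA lerDl addr_ge0// sumr_ge0// => i _.
    by rewrite mulr_ge0 ?normc_ge0// exprn_ge0 ?(ltW w10).
  apply: (@le_trans _ _ 2); last first.
    by rewrite lerDl sumr_ge0// => i _; rewrite mulr_ge0 ?normc_ge0// exprn_ge0 ?(ltW w10).
  have h1 := hN k kN; have h2 := hN k.+1 (leq_trans kN (leqnSn _)).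
  have -> : normc (a k) * w1 ^+ k = normc (a k * w1%:C ^+ k).
    by rewrite normcM normcX normc_real ?ltW.
  have -> : a k * w1%:C ^+ k = (F w1 - series (fun k => a k * w1%:C ^+ k) k) +
     - (F w1 - series (fun k => a k * w1%:C ^+ k) k.+1).
    by rewrite /series /= big_nat_recr//=; ring.
  apply: (le_trans (le_normcD _ _)); rewrite normcN.
  by have := ltW h1; have := ltW h2; move=> ? ?; lra.
exists (2 * M / w1 ^+ m.+1); first by rewrite !mulr_ge0// invr_ge0 exprn_ge0 ?(ltW w10).
move=> w /andP[w0 ww].
have wb : 0 <= w <= w1 by rewrite w0/=; lra.
apply/ler_addgt0Pr => e e0.
have [N _ hN] := normc_cvg (hF _ wb) e0.
pose n := maxn N m.+1.
have h1 := hN n (leq_maxl _ _).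
have -> : F w - \sum_(k < m.+1) a k * w%:C ^+ k = (F w - series (fun k => a k * w%:C ^+ k) n) +
   (series (fun k => a k * w%:C ^+ k) n - \sum_(k < m.+1) a k * w%:C ^+ k) by ring.
apply: (le_trans (le_normcD _ _)); rewrite addrC; apply: lerD; last exact: ltW.
rewrite /series/= (@big_cat_nat _ _ _ m.+1) ?leq_maxr//=.
have <- : \sum_(0 <= k < m.+1) a k * w%:C ^+ k = \sum_(k < m.+1) a k * w%:C ^+ k.
  by rewrite big_mkord.
rewrite [X in normc X](_ : _ = \sum_(m.+1 <= i < n) a i * w%:C ^+ i); last by ring.
apply: (le_trans (normc_sum _ _)).
have q1 : w / w1 <= 1 / 2 by rewrite ler_pdivrMr//; lra.
have q0 : 0 <= w / w1 by rewrite divr_ge0// ltW.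
have geo N' : \sum_(m.+1 <= k < m.+1 + N') (w / w1) ^+ k <= 2 * (w / w1) ^+ m.+1 * (1 - (w / w1) ^+ N').
  elim: N' => [|N' IH]; first by rewrite addn0 big_geq// expr0 subrr mulr0.
  rewrite addnS big_nat_recr ?leq_addr//= exprD (exprS _ N').
  have h2 : 0 <= (w / w1) ^+ m.+1 * (w / w1) ^+ N' by rewrite mulr_ge0// exprn_ge0.
  apply: (le_trans (lerD IH (lexx _))).
  have h3 : 0 <= 1 - 2 * (w / w1) by lra.
  have := mulr_ge0 h2 h3.
  move: ((w / w1) ^+ m.+1) ((w / w1) ^+ N') (w / w1) => p t x.
  by rewrite -subr_ge0 => h4; rewrite -subr_ge0; move: h4; congr (_ <= _); ring.
apply: (@le_trans _ _ (\sum_(m.+1 <= k < n) M * (w / w1) ^+ k)).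
  apply: ler_sum => k _; rewrite normcM normcX normc_real// expr_div_n mulrA.
  rewrite ler_pdivlMr ?exprn_gt0// mulrAC ler_wpM2r ?exprn_ge0//.
rewrite -mulr_sumr.
have -> : 2 * M / w1 ^+ m.+1 * w ^+ m.+1 = M * (2 * (w / w1) ^+ m.+1).
  by rewrite expr_div_n; ring.
rewrite ler_wpM2l//.
have -> : n = (m.+1 + (n - m.+1))%N by rewrite subnKC// leq_maxr.
apply: (le_trans (geo _)).
rewrite -[leRHS]mulr1 ler_wpM2l// ?mulr_ge0 ?exprn_ge0//.
by rewrite gerDl oppr_le0 exprn_ge0.
Qed.

End Coefs.

(** * From the single disk to the expansion of the theorem *)

Section Assembly.
Context {R : realType}.
Local Notation C := R[i].

(** The factor 2 turns the prefactor [1 / (2 pi)] of the expansion into the [1 / pi] of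
    [disk_sum_asymp]. *)
Lemma Gamma_ratio n k : (k <= n.+1)%N ->
  Gamma (k%:R + 1 / 2 : R) * Gamma (n%:R - k%:R + 3 / 2 : R) / Gamma (n%:R + 2 : R) =
  2 * sc k (n.+1 - k).
Proof.
move=> kn.
have -> : n%:R - k%:R + 3 / 2 = (n.+1 - k)%:R + 1 / 2 :> R.
  by rewrite natrB// -(natr1 n); field.
have -> : n%:R + 2 = n.+1%:R + 1 :> R by rewrite -(natr1 n); ring.
rewrite !Gamma_half Gamma_natr scE subnKC//.
have : Num.sqrt pi * Num.sqrt pi = pi :> R by rewrite -expr2 sqr_sqrtr// pi_ge0.
have f0 : (n.+1)`!%:R != 0 :> R by rewrite pnatr_eq0 -lt0n fact_gt0.
move: (Num.sqrt (pi : R)) => u; move: (pi : R) ((n.+1)`!%:R : R) f0 => p f f0 <-.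
by field.
Qed.

Lemma Rcoef_expansion (c : C) (r : R) (Rk : nat -> C -> C) m : c != 0 -> 0 < r -> is_Rcoef c r Rk ->
  exists w0 K : R, [/\ 0 < w0, 0 <= K & forall w, 0 <= w <= w0 ->
    normc (- (F0 ((normc c - r) / (normc c + r)) w)%:C - \sum_(k < m.+1) Rk k 0 * w%:C ^+ k) <= K *
      w ^+ m.+1].
Proof.
move=> c0 r0 hR.
have a0 : 0 < normc c.
  by rewrite lt_neqAle normc_ge0 andbT eq_sym; apply: contra c0 => /eqP/eq0_normc ->.
have realC0 (x : R) : x != 0 -> x%:C != 0 :> C.
  by rewrite -(rmorph0 (real_complex R)) (inj_eq (@complexI R)).
have x0 : 0 != xpt c r.
  by rewrite eq_sym /xpt !mulf_neq0 ?invr_eq0 ?realC0// gt_eqF// addr_gt0.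
set b := (normc c - r) / (normc c + r).
have b1 : b ^+ 2 < 1.
  have s0 : 0 < normc c + r by rewrite addr_gt0.
  have hb : -1 < b < 1 by rewrite ltr_pdivlMr// ltr_pdivrMr//; apply/andP; split; lra.
  by rewrite -(real_normK (num_real b)) exprn_ilt1// ltr_norml.
have /nbhs_ballP [e /= e0 he] := hR 0 x0.
(* The radius of a ball is an element of [R[i]]; being positive, it is real. *)
have [e' e'0 ee] : exists2 e' : R, 0 < e' & e = e'%:C.
  move: e0; case: e {he} => e1 e2; rewrite ltcE/= => /andP[/eqP -> h].
  by exists e1.
(* The first bound stays strictly inside the ball of convergence, the second keeps
   [1 - b ^+ 2 - w * b ^+ 2] positive. *)
pose w1 := Num.min (e' / 2) ((1 - b ^+ 2) / 2).
have w10 : 0 < w1 by rewrite lt_min; apply/andP; split; lra.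
have w1e : w1 <= e' / 2 by rewrite ge_min lexx.
have w1b : w1 <= (1 - b ^+ 2) / 2 by rewrite ge_min lexx orbT.
have hF w : 0 <= w <= w1 -> (series (fun k => Rk k 0 * w%:C ^+ k) : nat -> C^o) @ \oo --> (- (F0 b
  w)%:C : C^o).
  move=> /andP[w0 ww].
  rewrite -(@Rfun_at0 _ c r w)//; last first.
    have b2 : 0 <= b ^+ 2 by exact: sqr_ge0.
    have : w * b ^+ 2 <= w * 1 by rewrite ler_wpM2l// ltW.
    by move=> ?; rewrite -/b; lra.
  apply: he; rewrite /ball/= sub0r normrN ee -[`|_|]/((normc _)%:C) ltcR normc_real//.
  by lra.
have [K K0 hK] := power_series_tail w10 hF m.
by exists (w1 / 2), K; split => //; lra.
Qed.

Lemma normc_le_ReIm (z : C) : normc z <= `|complex.Re z| + `|complex.Im z|.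
Proof.
rewrite -[leLHS]ger0_norm ?normc_ge0// -[leRHS]ger0_norm ?addr_ge0//.
rewrite -ler_sqr ?nnegrE// !real_normK ?num_real// sqr_normcE sqrrD !real_normK ?num_real//.
by rewrite [leRHS]addrAC lerDl mulrn_wge0// mulr_ge0.
Qed.

Lemma pow_geometric_bounded q (th : R) : 0 <= th < 1 ->
  exists K : R, forall n, (0 < n)%N -> n.+1%:R ^+ q * th ^+ n <= K.
Proof.
move=> /andP[th0 th1].
have [->|thn0] := eqVneq th 0.
  by exists 0 => n n0; rewrite expr0n gtn_eqF// mulr0.
have thp : 0 < th by rewrite lt_neqAle eq_sym thn0.
pose d := - ln th; have d0 : 0 < d by rewrite oppr_gt0 ln_lt0// thp.
(* Here [th^n = exp(- d n)] and [exp(d n) >= (d n)^(q+1) / (q+1)!]; the power of 2 comes from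
   [n + 1 <= 2n], valid for [n > 0]. *)
exists (2 ^+ q.+1 * (q.+1)`!%:R / d ^+ q.+1) => n n0.
have thE : th ^+ n = (expR (d * n%:R))^-1.
  by rewrite -expRN -mulNr opprK expRM_natr lnK.
have h1 := @expR_ge1Dxn R (d * n%:R) q (mulr_ge0 (ltW d0) (ler0n _ _)).
have h2 : (d * n%:R) ^+ q.+1 / (q.+1)`!%:R <= expR (d * n%:R).
  by apply: le_trans h1; rewrite lerDr.
have f0 : 0 < (q.+1)`!%:R :> R by rewrite ltr0n fact_gt0.
have e0 := expR_gt0 (d * n%:R).
rewrite thE ler_pdivrMr// mulrAC ler_pdivlMr ?exprn_gt0//.
rewrite ler_pdivrMr// in h2.
apply: (@le_trans _ _ (2 ^+ q.+1 * (d * n%:R) ^+ q.+1)); last first.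
  by rewrite -mulrA; apply: ler_wpM2l; [rewrite exprn_ge0|rewrite [leRHS]mulrC].
rewrite exprMn mulrCA [leLHS]mulrC; apply: ler_wpM2l; first by rewrite exprn_ge0// ltW.
rewrite -exprMn; apply: (@le_trans _ _ (n.+1%:R ^+ q.+1)).
  by apply: ler_weXn2l => //; rewrite ler1n.
rewrite lerXn2r ?nnegrE// ?mulr_ge0//.
by rewrite -natrM ler_nat mul2n -addnn -addn1 leq_add2l.
Qed.

(** * Remainders of the allowed order *)

Section Small.
Variables (m : nat) (T : R).
Hypothesis T0 : 0 < T.

Let rate (n : nat) : R := n%:R `^ (- m%:R - 3 / 2).

(** A one-sided bound, without absolute value: it is applied to nonnegative quantities only. *)
Definition small_rate (f : nat -> R) := exists K : R, exists N : nat, forall n, (N <= n)%N ->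
  f n <= K * (T ^+ (2 * n) * rate n).

Lemma smallD f g : small_rate f -> small_rate g -> small_rate (fun n => f n + g n).
Proof.
move=> [K [N h]] [K' [N' h']]; exists (K + K'), (maxn N N') => n.
rewrite geq_max => /andP[n1 n2]; rewrite [leRHS]mulrDl; apply: lerD; [exact: h|exact: h'].
Qed.

Lemma small_sum (I : Type) (s : seq I) (F : I -> nat -> R) : (forall i, small_rate (F i)) ->
  small_rate (fun n => \sum_(i <- s) F i n).
Proof.
move=> hF; elim: s => [|i s IH].
  by exists 0, 0%N => n _; rewrite big_nil mul0r.
have [K [N h]] := smallD (hF i) IH.
by exists K, N => n /h; rewrite big_cons.
Qed.

Lemma small_le f g N (K : R) : 0 <= K -> small_rate g -> (forall n, (N <= n)%N -> f n <= K * g n)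
  -> small_rate f.
Proof.
move=> K0 [L [M h]] fg; exists (K * L), (maxn N M) => n; rewrite geq_max => /andP[n1 n2].
apply: (le_trans (fg _ n1)); rewrite -mulrA; apply: ler_wpM2l => //; exact: h.
Qed.

Let rateE n : (0 < n)%N -> rate n = (n%:R ^+ m.+1 * Num.sqrt n%:R)^-1.
Proof.
move=> n0; rewrite /rate.
have -> : - m%:R - 3 / 2 = - (m.+1%:R + 2^-1) :> R by rewrite -(natr1 m); field.
rewrite powRN powRD; last by rewrite pnatr_eq0 -lt0n n0 implybT.
by rewrite powR_mulrn// powR12_sqrt.
Qed.

Lemma small_sc : small_rate (fun n => T ^+ (2 * n) * sc m.+1 (n - m)).
Proof.
set A := pi / 2 * (\prod_(i < m.+1) (i%:R + 1 / 2)) : R.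
have A0 : 0 <= A.
  by rewrite mulr_ge0 ?divr_ge0 ?pi_ge0// prodr_ge0// => i _; rewrite addr_ge0.
(* For [n > 2m] the index [n - m + 1] exceeds [n / 2]. This costs [2^(m+1)] in the integer power
   and, generously, one more 2 in the square root. *)
exists (A * 2 ^+ m.+2), (2 * m).+1 => n mn.
have n0 : (0 < n)%N by rewrite (leq_trans _ mn).
rewrite mulrCA; apply: ler_wpM2l; first by rewrite exprn_ge0 ?(ltW T0).
apply: (le_trans (sc_le _ _)); rewrite -/A rateE// -[leLHS]mulrA -[leRHS]mulrA.
apply: ler_wpM2l => //.
have hn : n%:R / 2 <= (n - m).+1%:R :> R.
  rewrite ler_pdivrMr// -natrM ler_nat; move: mn; rewrite mul2n muln2 -!addnn => mn.
  have mn' : (m <= n)%N by rewrite (leq_trans _ mn)// ltnW// ltnS leq_addr.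
  have -> : n = (m + (n - m))%N by rewrite subnKC.
  rewrite addKn addSn addnS; apply: leqW; apply: leqW.
  rewrite leq_add2r leq_subRL//; exact: leq_trans mn.
have x0 : 0 < n%:R :> R by rewrite ltr0n.
have y0 : 0 < (n - m).+1%:R :> R by rewrite ltr0n.
rewrite -invfM.
have -> : 2 ^+ m.+2 * (n%:R ^+ m.+1 * Num.sqrt n%:R)^-1 = ((n%:R / 2) ^+ m.+1 * (Num.sqrt n%:R / 2))^-1 :> R.
  rewrite expr_div_n (exprS _ m.+1).
  have s0 : Num.sqrt n%:R != 0 :> R by rewrite gt_eqF// sqrtr_gt0.
  have p0 : n%:R ^+ m.+1 != 0 :> R by rewrite expf_neq0// gt_eqF.
  have q0 : 2 ^+ m.+1 != 0 :> R by rewrite expf_neq0// pnatr_eq0.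
  move: (Num.sqrt n%:R : R) (n%:R ^+ m.+1 : R) (2 ^+ m.+1 : R) s0 p0 q0 => s p q s0 p0 q0.
  by field; rewrite s0 p0 q0.
have s2 : Num.sqrt n%:R / 2 <= Num.sqrt (n - m).+1%:R :> R.
  rewrite -[leLHS]ger0_norm ?divr_ge0 ?sqrtr_ge0// -sqrtr_sqr ler_wsqrtr//.
  rewrite expr_div_n sqr_sqrtr//; apply: le_trans hn; rewrite ler_wpM2l//.
  by rewrite lef_pV2 ?posrE//; lra.
rewrite lef_pV2 ?posrE ?mulr_gt0 ?exprn_gt0 ?sqrtr_gt0 ?divr_gt0 ?sqrtr_gt0//.
apply: ler_pM => //; rewrite ?exprn_ge0 ?divr_ge0 ?sqrtr_ge0//.
by apply: lerXn2r; rewrite ?nnegrE ?divr_ge0.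
Qed.

Lemma small_geometric p (th : R) : 0 <= th < 1 -> small_rate (fun n => T ^+ (2 * n) * (n.+1%:R ^+ p
  * th ^+ n)).
Proof.
move=> th1; have [K hK] := pow_geometric_bounded (p + m.+2) th1.
exists K, 1%N => n n0; rewrite [leRHS]mulrCA; apply: ler_wpM2l; first by rewrite exprn_ge0 ?(ltW T0).
have x0 : 0 < n%:R :> R by rewrite ltr0n.
rewrite rateE// ler_pdivlMr ?mulr_gt0 ?exprn_gt0 ?sqrtr_gt0//.
apply: le_trans (hK n n0); rewrite exprD [leLHS]mulrAC; apply: ler_wpM2r.
  by case/andP: th1 => ? _; rewrite exprn_ge0.
apply: ler_wpM2l; first by rewrite exprn_ge0.
rewrite (exprSr _ m.+1); apply: ler_pM; rewrite ?exprn_ge0 ?sqrtr_ge0//.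
  by apply: lerXn2r; rewrite ?nnegrE// ler_nat.
rewrite -[leRHS]ger0_norm// -sqrtr_sqr ler_wsqrtr//.
rewrite (@le_trans _ _ n.+1%:R) ?ler_nat// expr2 -natrM ler_nat.
by rewrite leq_pmulr.
Qed.

End Small.

(** The two terms are added because the [Rk] expand [- F0]. Real and imaginary parts are estimated
    apart, by [disk_sum_asymp] and [zero_asymp]. *)
Lemma small_max_term (c : C) (r : R) (Rk : nat -> C -> C) m : c != 0 -> 0 < r -> is_Rcoef c r Rk ->
  small_rate m (normc c + r) (fun n => normc ((disk_sum (normc c) r n)%:C +
    ((normc c + r) ^+ (2 * n.+1) / pi)%:C * \sum_(k < m.+1) Rk k 0 * (sc k (n.+1 - k))%:C)).
Proof.
move=> c0 r0 hR.
have a0 : 0 < normc c.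
  by rewrite lt_neqAle normc_ge0 andbT eq_sym; apply: contra c0 => /eqP/eq0_normc ->.
have [w0 [K [w00 K0 hK]]] := Rcoef_expansion m c0 r0 hR.
set T := normc c + r; have T0 : 0 < T by rewrite addr_gt0.
have Resum (x : nat -> R) : complex.Re (\sum_(k < m.+1) Rk k 0 * (x k)%:C) = \sum_(k < m.+1)
  complex.Re (Rk k 0) * x k.
  rewrite raddf_sum; apply: eq_bigr => k _ /=; case: (Rk k 0) => u v /=; ring.
have Imsum (x : nat -> R) : complex.Im (\sum_(k < m.+1) Rk k 0 * (x k)%:C) = \sum_(k < m.+1)
  complex.Im (Rk k 0) * x k.
  rewrite raddf_sum; apply: eq_bigr => k _ /=; case: (Rk k 0) => u v /=; ring.
have wC w : \sum_(k < m.+1) Rk k 0 * w%:C ^+ k = \sum_(k < m.+1) Rk k 0 * (w ^+ k)%:C.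
  by apply: eq_bigr => k _; rewrite (rmorphXn (real_complex R)).
have hRe w : 0 <= w <= w0 -> `|F0 ((normc c - r) / (normc c + r)) w -
    \sum_(k < m.+1) (- complex.Re (Rk k 0)) * w ^+ k| <= K * w ^+ m.+1.
  move=> wb; apply: le_trans (hK w wb); apply: le_trans (Re_le_normc _).
  rewrite wC -[X in _ <= X]normrN raddfB raddfN /= Resum.
  rewrite opprB opprK [X in `|X| <= _](_ : _ = \sum_(k < m.+1) complex.Re (Rk k 0) * w ^+ k + F0
    ((normc c - r) / (normc c + r)) w)//.
  rewrite addrC; congr (_ + _); rewrite -sumrN; apply: eq_bigr => k _; ring.
have hIm w : 0 <= w <= w0 -> `|\sum_(k < m.+1) complex.Im (Rk k 0) * w ^+ k| <= K * w ^+ m.+1.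
  move=> wb; apply: le_trans (hK w wb); apply: le_trans (Im_le_normc _).
  by rewrite wC -[X in _ <= X]normrN raddfB raddfN /= Imsum oppr0 sub0r opprK.
have [C1 [rho1 [C10 rho1b h1]]] := @disk_sum_asymp _ (normc c) r w0 K (fun k => - complex.Re (Rk k
  0)) m a0 r0 w00 K0 hRe.
have [C2 [rho2 [C20 rho2b h2]]] := @zero_asymp _ w0 K (fun k => complex.Im (Rk k 0)) m w00 K0 hIm.
have s1 := small_geometric m T0 0 rho1b.
have s2 := small_geometric m T0 0 rho2b.
have s3 := small_sc m T0.
have pi0 := @pi_gt0 R.
have L0 : 0 <= T ^+ 2 * (C1 + pi^-1 * C2).
  by apply: mulr_ge0; [exact: sqr_ge0|apply: addr_ge0 => //; apply: mulr_ge0 => //; rewrite invr_ge0 ltW].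
apply: (@small_le m T _ _ m (T ^+ 2 * (C1 + pi^-1 * C2)) L0 (smallD s3 (smallD s1 s2))) => n mn.
apply: (le_trans (normc_le_ReIm _)).
have -> : complex.Re ((disk_sum (normc c) r n)%:C + (T ^+ (2 * n.+1) / pi)%:C *
    \sum_(k < m.+1) Rk k 0 * (sc k (n.+1 - k))%:C) =
    T ^+ (2 * n.+1) * (disk_sum (normc c) r n / T ^+ (2 * n.+1) - pi^-1 * \sum_(k < m.+1) (-
      complex.Re (Rk k 0)) * sc k (n.+1 - k)).
  have ReD (u v : R) (z : C) : complex.Re (u%:C + v%:C * z) = u + v * complex.Re z by case: z => x y /=; ring.
  rewrite ReD (Resum (fun k => sc k (n.+1 - k))); have -> : \sum_(k < m.+1) - complex.Re (Rk k 0) *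
    sc k (n.+1 - k) =
     - \sum_(k < m.+1) complex.Re (Rk k 0) * sc k (n.+1 - k) :> R.
    by rewrite -sumrN; apply: eq_bigr => k _; rewrite mulNr.
  have t0 : T ^+ (2 * n.+1) != 0 by rewrite expf_neq0// gt_eqF.
  move: (pi : R) pi0 (T ^+ (2 * n.+1)) t0 => P P0 t t0.
  by field; rewrite t0 gt_eqF.
have -> : complex.Im ((disk_sum (normc c) r n)%:C + (T ^+ (2 * n.+1) / pi)%:C *
    \sum_(k < m.+1) Rk k 0 * (sc k (n.+1 - k))%:C) =
    T ^+ (2 * n.+1) * (pi^-1 * \sum_(k < m.+1) complex.Im (Rk k 0) * sc k (n.+1 - k)).
  have ImD (u v : R) (z : C) : complex.Im (u%:C + v%:C * z) = v * complex.Im z by case: z => x y /=; ring.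
  by rewrite ImD (Imsum (fun k => sc k (n.+1 - k))) mulrA.
have t0 : 0 <= T ^+ (2 * n.+1) by rewrite exprn_ge0 ?(ltW T0).
rewrite !normrM (ger0_norm t0) -mulrDr.
have := h1 n mn; set A1 := `|disk_sum (normc c) r n / _ - _| => h1n.
have -> : T ^+ (2 * n.+1) = T ^+ 2 * T ^+ (2 * n) by rewrite -exprD mulnS.
have pV0 : 0 <= pi^-1 :> R by rewrite invr_ge0 ltW.
rewrite (ger0_norm pV0) -mulrA -[leRHS]mulrA; apply: ler_wpM2l; first exact: sqr_ge0.
rewrite !expr0 !mul1r -!mulrDr mulrCA; apply: ler_wpM2l; first by rewrite exprn_ge0 ?(ltW T0).
have sc0 : 0 <= sc m.+1 (n - m) :> R := sc_ge0 _ _.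
have r1 : 0 <= rho1 ^+ n by case/andP: rho1b => ? _; rewrite exprn_ge0.
have r2 : 0 <= rho2 ^+ n by case/andP: rho2b => ? _; rewrite exprn_ge0.
rewrite [leRHS]mulrDl; apply: lerD.
  apply: (le_trans h1n); apply: ler_wpM2l => //.
  by rewrite lerD2l lerDl.
rewrite -[leRHS]mulrA; apply: ler_wpM2l => //.
apply: (le_trans (h2 n mn)); apply: ler_wpM2l => //.
by rewrite lerD2l lerDr.
Qed.

(** For the holes that do not reach the outer radius: against [T^(2n)] their moment decays like the
    power [n] of [((a + r) / T)^2 < 1]. *)
Lemma small_disk_sum (a r T : R) m : 0 <= a -> 0 < r -> a + r < T ->
  small_rate m T (fun n => disk_sum a r n).
Proof.
move=> a0 r0 aT; have ar : 0 < a + r by rewrite ltr_wpDl.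
have T0 : 0 < T := lt_trans ar aT.
pose th := ((a + r) / T) ^+ 2.
have th1 : 0 <= th < 1.
  rewrite /th sqr_ge0/= exprn_ilt1// ?divr_ge0 ?(ltW ar) ?(ltW T0)//.
  by rewrite ltr_pdivrMr// mul1r.
have L0 : 0 <= (a + r) * r by rewrite mulr_ge0 ?(ltW ar) ?(ltW r0).
apply: (@small_le m T _ _ 0 ((a + r) * r) L0 (small_geometric m T0 0 th1)) => n _.
apply: (le_trans (disk_sum_le _ a0 (ltW r0))).
rewrite expr0 mul1r /th -exprM expr_div_n.
have -> : T ^+ (2 * n) * ((a + r) ^+ (2 * n) / T ^+ (2 * n)) = (a + r) ^+ (2 * n).
  by rewrite mulrCA divff ?mulr1// expf_neq0// gt_eqF.
by rewrite exprSr le_eqVlt; apply/orP; left; apply/eqP; ring.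
Qed.

(* If [a != 0], then [Phi a] maps the disk of radius [r < 1] about [0] to a disk
   whose centre is not [0]: compare the images of the points at distance [r] on
   the diameter through [a]. *)
Lemma Moebius_center_neq0 (r sigma : R) (a : C) : r < 1 -> a != 0 ->
  ~ is_Moebius_data 0 r a sigma.
Proof.
move=> r1 an0 [a1 /andP[s0 s1] him].
set al := normc a in a1.
have al0 : 0 < al.
  by rewrite lt_neqAle normc_ge0 andbT eq_sym; apply: contra an0 => /eqP/eq0_normc ->.
have aC : al%:C != 0 :> C by rewrite -(rmorph0 (real_complex R)) (inj_eq (@complexI R)) gt_eqF.
have aac : a * a^* = al%:C ^+ 2 by rewrite mulcJ (rmorphXn (real_complex R)).
have rotE : Defs.rot a = a^* / al%:C by rewrite /Defs.rot (negPf an0).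
(* The fraction is the modulus of the image of [- t a / |a|], on the side of the diameter away from
   [a]. *)
have fwd (t : R) : 0 <= t < r -> (t + al) / (1 + al * t) < sigma.
  move=> /andP[t0 tr].
  have al_t : 0 < 1 + al * t by rewrite ltr_wpDr// mulr_ge0// ltW.
  have zin : disk 0 r ((- t)%:C * (a / al%:C)).
    rewrite /disk/= subr0 normcM (_ : normc (a / al%:C) = 1) ?mulr1.
      by rewrite (rmorphN (real_complex R)) normcN normc_real.
    by rewrite normcM normcV normc_real ?(ltW al0)// divff// gt_eqF.
  have : disk 0 sigma (Phi a ((- t)%:C * (a / al%:C))) by rewrite -him; exists ((- t)%:C * (a / al%:C)).
  have -> : Phi a ((- t)%:C * (a / al%:C)) = (- ((t + al) / (1 + al * t)))%:C.
    rewrite /Phi rotE.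
    have d1 : 1 - a^* * ((- t)%:C * (a / al%:C)) = (1 + al * t)%:C.
      have -> : a^* * ((- t)%:C * (a / al%:C)) = (- t)%:C * (a * a^*) / al%:C by ring.
      rewrite aac (rmorphD (real_complex R)) (rmorphM (real_complex R)) (rmorphN (real_complex R))
        (rmorph1 (real_complex R)) /=.
      by field.
    rewrite d1.
    have -> : a^* / al%:C * (((- t)%:C * (a / al%:C) - a) / (1 + al * t)%:C) =
      (a * a^*) * ((- t)%:C - al%:C) / al%:C ^+ 2 / (1 + al * t)%:C.
      have : (1 + al * t)%:C != 0 :> C by rewrite -(rmorph0 (real_complex R)) (inj_eq (@complexI R)) gt_eqF.
      by move: ((1 + al * t)%:C) => D D0; field; rewrite aC D0.
    have -> : (- ((t + al) / (1 + al * t)))%:C = (- t%:C - al%:C) / (1 + al * t)%:C.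
      by rewrite -mulNr opprD (rmorphM (real_complex R)) (fmorphV (real_complex R)) (rmorphB
        (real_complex R)) (rmorphN (real_complex R)).
    rewrite aac (_ : (- t)%:C = - t%:C); last by rewrite (rmorphN (real_complex R)).
    have : (1 + al * t)%:C != 0 :> C by rewrite -(rmorph0 (real_complex R)) (inj_eq (@complexI R)) gt_eqF.
    by move: ((1 + al * t)%:C) => D D0; field; rewrite aC D0.
  rewrite /disk /mkset subr0 (rmorphN (real_complex R)) normcN normc_real//.
  by rewrite divr_ge0 ?(ltW al_t)// addr_ge0 ?(ltW al0).
(* Here it is the modulus of the preimage of [v]. The preimage is recovered by [PhiK], whose
   denominator is nonzero because [|z| < r < 1]. *)
have bwd (v : R) : 0 <= v < sigma -> (v + al) / (1 + al * v) < r.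
  move=> /andP[v0 vs].
  have al_v : 0 < 1 + al * v by rewrite ltr_wpDr// mulr_ge0// ltW.
  have : disk 0 sigma v%:C by rewrite /disk /mkset subr0 normc_real.
  rewrite -him => -[z]; rewrite /disk/= subr0 => zr Pz.
  have d0 : 1 - a^* * z != 0.
    apply/eqP => h; have : normc (a^* * z) < 1.
      rewrite normcM normc_conj -/al -[ltRHS]mulr1; apply: ltr_pM => //; rewrite ?normc_ge0 ?(ltW al0)//.
      exact: lt_trans zr r1.
    by move/eqP: h; rewrite subr_eq0 => /eqP <-; rewrite normc1 ltxx.
  have := PhiK a1 d0; rewrite Pz => zE.
  have : normc z = (v + al) / (1 + al * v).
    rewrite -zE /Phi_inv rotE.
    have -> : a^* / al%:C * a = al%:C by rewrite mulrAC [a^* * a]mulrC aac expr2 mulfK.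
    have -> : a^* / al%:C + a^* * v%:C = a^* / al%:C * (1 + al * v)%:C.
      rewrite (rmorphD (real_complex R)) (rmorphM (real_complex R)) (rmorph1 (real_complex R)) /=; by field.
    rewrite -(rmorphD (real_complex R)) normcM normcV !normcM normcV normc_conj !normc_real ?(ltW
      al_v) ?(ltW al0) ?(addr_ge0 v0 (ltW al0))// -/al divff ?mul1r//.
    by rewrite gt_eqF.
  by move=> <-.
(* Otherwise [bwd] applies at [v = r] and gives [al < al r^2], which is absurd. *)
have sig_r : sigma <= r.
  rewrite leNgt; apply/negP => rs.
  have r0 : 0 <= r.
    have [z] : (Phi a @` disk 0 r) 0 by rewrite him /disk /mkset subr0 normc0.
    by rewrite /disk/= subr0 => /(le_lt_trans (normc_ge0 _))/ltW.
  have := bwd r; rewrite r0 rs => /(_ isT).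
  rewrite ltr_pdivrMr; last by rewrite ltr_wpDr// mulr_ge0// ltW.
  have : r * r < 1 by nra.
  nra.
(* A lower bound, for [t <= r], of the gain [(t + al) / (1 + al t) - t = al (1 - t^2) / (1 + al t)].
   By [fwd] then [t + d < sigma <= r], which fails for [t] within [d / 2] of [r]. *)
pose d := al * (1 - r ^+ 2) / 2.
have r0 : 0 < r by exact: lt_le_trans sig_r.
have r2 : 0 < 1 - r ^+ 2 by rewrite subr_gt0 exprn_ilt1// ltW.
have d0 : 0 < d by rewrite !mulr_gt0.
pose t := r - Num.min r d / 2.
have m1 : Num.min r d <= r by rewrite ge_min lexx.
have m2 : Num.min r d <= d by rewrite ge_min lexx orbT.
have m0 : 0 < Num.min r d by rewrite lt_min r0.
have tb : 0 <= t < r by rewrite /t; apply/andP; split; lra.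
have /andP[t0 tr] := tb.
have := fwd _ tb; have al_t : 0 < 1 + al * t by rewrite ltr_wpDr// mulr_ge0// ltW.
rewrite ltr_pdivrMr// => h.
have h2 : (t + d) * (1 + al * t) <= t + al.
  have h3 : al * t <= 1 by rewrite -[leRHS]mulr1; apply: ler_pM => //; lra.
  have h4 : t ^+ 2 <= r ^+ 2 by rewrite lerXn2r ?nnegrE//; lra.
  have h5 : d * (al * t) <= d * 1 by rewrite ler_pM2l.
  have h6 : al * t ^+ 2 <= al * r ^+ 2 by rewrite ler_pM2l.
  have dE : 2 * d = al - al * r ^+ 2 by rewrite /d; field.
  have -> : (t + d) * (1 + al * t) = t + al * t ^+ 2 + (d + d * (al * t)) by ring.
  by lra.
have : t + d < sigma by rewrite -(ltr_pM2r al_t); exact: le_lt_trans h.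
rewrite /t; lra.
Qed.

(** An extremal hole centred at 0 would contain every other centre, hence be the only hole. Its [a]
    would then be nonzero because [rho_a] is positive, against [Moebius_center_neq0]. *)
Lemma max_center_neq0 (s : nat) (c : 'I_s -> C) (r : 'I_s -> R) (a : 'I_s -> C) (sigma : 'I_s -> R) j :
  is_CMCD c r -> (forall j, is_Moebius_data (c j) (r j) (a j) (sigma j)) -> 0 < rho_a a ->
  normc (c j) + r j = outer_radius c r -> c j != 0.
Proof.
move=> hD ha hrho hj; apply/eqP => cj0.
case: (hD) => _ r0 _ dis.
have rj : r j = outer_radius c r by rewrite -hj cj0 normc0 add0r.
have only k : k = j.
  apply/eqP; apply/negPn/negP => kj.
  have : (closed_disk (c k) (r k) `&` closed_disk (c j) (r j)) (c k).
    split; rewrite /closed_disk/=; first by rewrite subrr normc0 ltW.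
    rewrite cj0 subr0 rj; apply: le_trans (outer_radius_ge c r k).
    by rewrite lerDl ltW.
  by rewrite dis.
have aj : a j != 0.
  apply/eqP => aj0; move: hrho; rewrite /rho_a.
  rewrite ltNge => /negP; apply; apply: bigmax_le => // k _.
  by rewrite (only k) aj0 normc0.
have := ha j; rewrite cj0; apply: Moebius_center_neq0 => //.
by have := CMCD_bound hD j; rewrite cj0 normc0 add0r.
Qed.

End Assembly.

Theorem theorem1p3 (R : realType) (s : nat)
    (c : 'I_s -> R[i]) (r : 'I_s -> R)
    (a : 'I_s -> R[i]) (sigma : 'I_s -> R)
    (P : nat -> {poly R[i]}) (Rk : 'I_s -> nat -> R[i] -> R[i])
    (hD : is_CMCD c r)
    (ha : forall j, is_Moebius_data (c j) (r j) (a j) (sigma j))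
    (hP : forall n, is_monic_orthogonal (CMCD c r) n (P n))
    (hRk : forall j, c j != 0 -> is_Rcoef (c j) (r j) (Rk j))
    (hA : assumptionA a sigma)
    (hrho : 0 < rho_a a) :
  forall m : nat,
    (fun n : nat =>
       normc (((n.+1)%:R * kappa (CMCD c r) (P n) ^- 2)%:C
              - truncated_expansion c r Rk m n) : R^o)
    =O_\oo
    (fun n : nat =>
       rho_x c r ^- (2 * n) * n%:R `^ (- m%:R - 3 / 2) : R^o).
Proof.
move=> m; set T := outer_radius c r.
have T0 : 0 < T := outer_radius_gt0 hD.
have T1 : T < 1 := outer_radius_lt1 hD.
have /andP[tau0 tauT] := inner_radius_bound hD.
have rho_xV : (rho_x c r)^-1 = T by rewrite /rho_x invrK.
pose E0 n := s%:R ^+ 2 / (1 - T ^+ 2) * (n.+1%:R ^+ 4 * inner_radius c r ^+ (2 * n)).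
(* An extremal hole is charged for the distance to its own truncated expansion, any other hole for
   its whole moment; [E0] is charged for replacing [P n] by [z^n]. *)
pose g j n := if normc (c j) + r j == T then normc ((disk_sum (normc (c j)) (r j) n)%:C +
    (T ^+ (2 * n.+1) / pi)%:C * \sum_(k < m.+1) Rk j k 0 * (sc k (n.+1 - k))%:C)
   else disk_sum (normc (c j)) (r j) n.
have r0 j : 0 < r j by case: hD.
have sE0 : small_rate m T E0.
  pose th := (inner_radius c r / T) ^+ 2.
  have th1 : 0 <= th < 1.
    rewrite /th sqr_ge0/= exprn_ilt1// ?divr_ge0// ?(ltW T0)//.
    by rewrite ltr_pdivrMr// mul1r.
  have L0 : 0 <= s%:R ^+ 2 / (1 - T ^+ 2).
    by rewrite divr_ge0 ?sqr_ge0// subr_ge0 exprn_ile1// ltW.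
  apply: (@small_le _ m T _ _ 0 _ L0 (small_geometric m T0 4 th1)) => n _.
  rewrite /E0; apply: ler_wpM2l => //.
  rewrite /th -exprM expr_div_n [leRHS]mulrCA; apply: ler_wpM2l; first by rewrite exprn_ge0.
  by rewrite mulrCA divff ?mulr1// expf_neq0// gt_eqF.
have sg j : small_rate m T (g j).
  rewrite /g; case: eqP => [e|/eqP ne]; last first.
    apply: small_disk_sum => //; first exact: normc_ge0.
    by rewrite lt_neqAle ne outer_radius_ge.
  have cj := max_center_neq0 hD ha hrho e.
  by have := small_max_term m cj (r0 j) (hRk j cj); rewrite e.
have [K [N hK]] := smallD sE0 (small_sum (index_enum 'I_s) sg).
have key n : (m <= n)%N -> normc (((n.+1)%:R * kappa (CMCD c r) (P n) ^- 2)%:C -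
  truncated_expansion c r Rk m n)
   <= E0 n + \sum_j g j n.
  move=> mn.
  set A := area_integral (CMCD c r) (fun z => normc (P n).[z] ^+ 2).
  have A0 : 0 <= A.
    by apply: mulr_ge0; [rewrite invr_ge0 pi_ge0|apply: Rintegral_ge0 => p _; exact: sqr_ge0].
  have kA : kappa (CMCD c r) (P n) ^- 2 = A.
    rewrite /kappa -/A powRN powR12_sqrt// exprVn invrK sqr_sqrtr//.
  have hE := norm_defect_bound hD (hP n); rewrite -/A -/T in hE.
  have TE : truncated_expansion c r Rk m n = 1 + \sum_(j < s | normc (c j) + r j == T)
      (T ^+ (2 * n.+1) / pi)%:C * \sum_(k < m.+1) Rk j k 0 * (sc k (n.+1 - k))%:C.
    rewrite /truncated_expansion; congr (1 + _).
    have -> : (2 * n + 2 = 2 * n.+1)%N by rewrite mulnS addnC.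
    rewrite big_mkord.
    have pow2 : rho_x c r ^- (2 * n.+1) = T ^+ (2 * n.+1) by rewrite -exprVn rho_xV.
    rewrite pow2.
    transitivity (\sum_(k < m.+1) \sum_(j < s | normc (c j) + r j == T)
       (T ^+ (2 * n.+1) / pi)%:C * (Rk j k 0 * (sc k (n.+1 - k))%:C)).
      rewrite mulr_sumr; apply: eq_bigr => k _.
      have kn : (k <= n.+1)%N by rewrite ltnW// ltnS (leq_trans _ mn)// -ltnS.
      rewrite Gamma_ratio// /Ccoef rho_xV mulr_suml mulr_sumr; apply: eq_bigr => j _.
      rewrite mulrCA [RHS]mulrCA; congr (_ * _).
      rewrite -!(rmorphM (real_complex R)); congr (_%:C).
      have : pi != 0 :> R by rewrite gt_eqF// pi_gt0.
      by move: (pi : R) => p p0; field.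
    (* The statement sums over [k] outside and over the holes inside; the estimates are made hole by
       hole. *)
    rewrite exchange_big; apply: eq_bigr => j _.
    by rewrite mulr_sumr.
  rewrite kA TE.
  have -> : (n.+1%:R * A)%:C - (1 + \sum_(j < s | normc (c j) + r j == T)
      (T ^+ (2 * n.+1) / pi)%:C * \sum_(k < m.+1) Rk j k 0 * (sc k (n.+1 - k))%:C) =
    (n.+1%:R * A - (1 - \sum_j disk_sum (normc (c j)) (r j) n))%:C -
    \sum_j (if normc (c j) + r j == T then (disk_sum (normc (c j)) (r j) n)%:C +
    (T ^+ (2 * n.+1) / pi)%:C * \sum_(k < m.+1) Rk j k 0 * (sc k (n.+1 - k))%:C
     else (disk_sum (normc (c j)) (r j) n)%:C).
    have -> : \sum_j (if normc (c j) + r j == T then (disk_sum (normc (c j)) (r j) n)%:C +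
      (T ^+ (2 * n.+1) / pi)%:C * \sum_(k < m.+1) Rk j k 0 * (sc k (n.+1 - k))%:C
       else (disk_sum (normc (c j)) (r j) n)%:C) =
       (\sum_j disk_sum (normc (c j)) (r j) n)%:C + \sum_(j < s | normc (c j) + r j == T)
      (T ^+ (2 * n.+1) / pi)%:C * \sum_(k < m.+1) Rk j k 0 * (sc k (n.+1 - k))%:C.
      rewrite (rmorph_sum (real_complex R)) [X in _ = _ + X]big_mkcond -big_split; apply: eq_bigr => j _ /=.
      by case: ifP => // _; rewrite addr0.
    rewrite !(rmorphB (real_complex R)) (rmorph1 (real_complex R)) /=; ring.
  apply: (le_trans (le_normcD _ _)); rewrite normcN; apply: lerD.
    rewrite [leLHS](_ : _ = `|n.+1%:R * A - (1 - \sum_j disk_sum (normc (c j)) (r j) n)|)//.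
    by rewrite /= expr0n/= addr0 sqrtr_sqr.
  apply: (le_trans (normc_sum _ _)); apply: ler_sum => j _; rewrite /g.
  by case: ifP => // _; rewrite normc_real// disk_sum_ge0 ?normc_ge0 ?ltW.
(* The constant has to be positive, while nothing is known about the sign of [K]. *)
apply/eqO_exP; exists (`|K| + 1); first by rewrite ltr_wpDl.
exists (maxn N m) => // n /=; rewrite geq_max => /andP[Nn mn].
have w0 : 0 <= T ^+ (2 * n) * n%:R `^ (- m%:R - 3 / 2) by rewrite mulr_ge0 ?powR_ge0 ?exprn_ge0 ?(ltW T0).
have -> : rho_x c r ^- (2 * n) = T ^+ (2 * n) by rewrite -exprVn rho_xV.
rewrite ger0_norm ?normc_ge0// [X in _ <= _ * X]ger0_norm//.
apply: (le_trans (key n mn)); apply: (le_trans (hK n Nn)).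
apply: ler_wpM2r => //; apply: (le_trans (ler_norm K)); by rewrite lerDl.
Qed.
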